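(* Let $d\ge1$ and let $c$ be a positive number. For non-empty $T\subset\{0,\ldots,d\}$ let $\lambda_T$ be the uniform probability on the convex hull of $\{e_i: i\in T\}$. For $k=0,\ldots,d$ let $$\Lambda_k=\frac{(k+1)!(d-k)!}{(d+1)!}\sum_{T\subset\{0,\ldots,d\};\ |T|=k+1}\lambda_T ,$$ and consider the signed measure on $E_{d+1}$ $$\nu_{c,d}=\frac{d!(d+1)!}{(c+1)(c+2)\cdots(c+d)}\sum_{k=0}^d\frac{(c-1)(c-2)\cdots(c-k)}{k!(k+1)!(d-k)!}\Lambda_k .$$ Then for all $f_0,\ldots,f_d>0$, $$\int_{E_{d+1}}\frac{\nu_{c,d}(dx)}{\langle f,x\rangle^c}=f_0\cdots f_d\int_{E_{d+1}}\frac{\Lambda_d(dx)}{\langle f,x\rangle^{c+d+1}} .$$ In particular, if $Y\sim\beta(c,d+1)$ and $X\sim\Lambda_d$ are independent, then there exists a random variable $B$ on $E_{d+1}$ independent of $(Y,X)$ such that $X\sim(1-Y)X+YB$ if and only if either $c$ is a non-negative integer or $c>d$. Under these circumstances $B\sim\nu_{c,d}$.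
   Context: $e_0,\ldots,e_d$ is the natural basis of $\mathbb{R}^{d+1}$, and $E_{d+1}$ is its convex hull, i.e. the set of $\lambda\in\mathbb{R}^{d+1}$ with $\lambda_i\ge0$ and $\lambda_0+\cdots+\lambda_d=1$. $\langle f,x\rangle=\sum_{i=0}^df_ix_i$. The uniform probability on the convex hull of a single point is the Dirac mass at that point. The empty product (case $k=0$ of $(c-1)\cdots(c-k)$) is $1$. $U\sim V$ between random variables means equality in distribution, and $U\sim\mu$ means that $U$ has law $\mu$. For $p,q>0$, $\beta(p,q)$ is the law on $(0,1)$ with density $\frac{\Gamma(p+q)}{\Gamma(p)\Gamma(q)}x^{p-1}(1-x)^{q-1}$. *)

(* Defs.v *)
From HB Require Import structures.
From mathcomp Require Import all_boot all_order all_algebra.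
From mathcomp Require Import all_classical all_reals all_analysis.

Set Implicit Arguments.
Unset Strict Implicit.
Unset Printing Implicit Defensive.

Import Order.TTheory GRing.Theory Num.Theory.
Import numFieldNormedType.Exports.

Local Open Scope classical_set_scope.
Local Open Scope ring_scope.

(* Points of R^n are n-tuples, with the product sigma-algebra. *)

Section lebesgue_tuple.
Variable R : realType.
Local Open Scope ereal_scope.

Definition cons_pair k (p : k.-tuple R * R) : k.+1.-tuple R :=
  [tuple of p.2 :: p.1].

Lemma measurable_cons_pair k : measurable_fun setT (@cons_pair k).
Proof. exact: measurable_cons. Qed.

HB.instance Definition _ k :=
  isMeasurableFun.Build _ _ _ _ (@cons_pair k) (@measurable_cons_pair k).

Definition lebesgue_cons k (mu : {measure set (k.-tuple R) -> \bar R}) :=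
  pushforward (mu \x (@lebesgue_measure R)) (@cons_pair k).

Section lebesgue_cons_measure.
Variables (k : nat) (mu : {measure set (k.-tuple R) -> \bar R}).

Let lebesgue_cons0 : lebesgue_cons mu set0 = 0.
Proof. by rewrite /lebesgue_cons /pushforward preimage_set0 measure0. Qed.

Let lebesgue_cons_ge0 A : 0 <= lebesgue_cons mu A.
Proof. by rewrite /lebesgue_cons /pushforward measure_ge0. Qed.

Let lebesgue_cons_sigma_additive : semi_sigma_additive (lebesgue_cons mu).
Proof.
exact: (@measure_semi_sigma_additive _ _ _
  (measure_function_pushforward__canonical__measure_function_Measure
     (mu \x (@lebesgue_measure R)) (@measurable_cons_pair k))).
Qed.

HB.instance Definition _ := isMeasure.Build _ _ _ (lebesgue_cons mu)
  lebesgue_cons0 lebesgue_cons_ge0 lebesgue_cons_sigma_additive.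

End lebesgue_cons_measure.

(* k-dimensional Lebesgue measure; R^0 is a single point of mass 1. *)
Fixpoint lebesgue_tuple k : {measure set (k.-tuple R) -> \bar R} :=
  if k is k'.+1 then lebesgue_cons (lebesgue_tuple k')
  else \d_ ([tuple] : 0.-tuple R).

End lebesgue_tuple.

Section uniform_face.
Variable R : realType.

Definition solid_simplex k : set (k.-tuple R) :=
  [set u | (forall i, 0 <= tnth u i) /\ \sum_(i < k) tnth u i <= 1].

Lemma measurable_solid_simplex k : measurable (@solid_simplex k).
Proof.
rewrite (_ : @solid_simplex k =
  (\bigcap_(i in [set: 'I_k]) ((@tnth k R ^~ i) @^-1` `[0, +oo[%classic)) `&`
  ((fun u : k.-tuple R => \sum_(i < k) tnth u i) @^-1` `]-oo, 1]%classic)).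
  apply: measurableI.
    apply: fin_bigcap_measurable => [|i _]; first exact: finite_finset.
    rewrite -[X in measurable X]setTI.
    by apply: measurable_tnth => //; exact: measurable_itv.
  rewrite -[X in measurable X]setTI.
  by apply: measurable_sum => // i; exact: measurable_tnth.
apply/seteqP; split=> u /= [u0 u1]; split; rewrite ?in_itv//=.
  by move=> i _ /=; rewrite in_itv/= andbT.
by move=> i; have := u0 i I; rewrite /= in_itv/= andbT.
Qed.

Variable d : nat.

(* With T = {i_0 < ... < i_k}, the affine map sending u in R^k to
   u_0 e_{i_0} + ... + u_{k-1} e_{i_{k-1}} + (1 - u_0 - ... - u_{k-1}) e_{i_k};
   it maps the solid simplex of R^k bijectively onto the convex hull of
   {e_i : i in T}. *)
Definition face_map (T : {set 'I_d.+1}) (u : #|T|.-1.-tuple R) :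
    d.+1.-tuple R :=
  [tuple if i \in T then nth (1 - \sum_j tnth u j) u (index i (enum T)) else 0
     | i < d.+1].

Lemma measurable_face_map T : measurable_fun setT (@face_map T).
Proof.
apply/measurable_fun_tnthP => i.
rewrite (_ : _ \o _ = fun u : #|T|.-1.-tuple R => if i \in T then
    nth (1 - \sum_j tnth u j) u (index i (enum T)) else 0); last first.
  by apply/funext => u /=; rewrite tnth_mktuple.
case: (i \in T) => //.
have [jT|jT] := ltnP (index i (enum T)) #|T|.-1.
  rewrite (_ : (fun _ => _) = @tnth _ R ^~ (Ordinal jT)).
    exact: measurable_tnth.
  by apply/funext => u; rewrite (tnth_nth (1 - \sum_j tnth u j)).
rewrite (_ : (fun _ => _) = fun u : #|T|.-1.-tuple R => 1 - \sum_j tnth u j).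
  by apply: measurable_realfun.measurable_funB => //; apply: measurable_sum => j;
    exact: measurable_tnth.
by apply/funext => u; rewrite nth_default// size_tuple.
Qed.

HB.instance Definition _ T :=
  isMeasurableFun.Build _ _ _ _ (@face_map T) (@measurable_face_map T).

(* The uniform probability on the convex hull of {e_i : i in T}, for T
   non-empty: normalised Lebesgue measure in affine coordinates.  The second
   argument of mnormalize is a default value for null or infinite mass, which
   does not occur since the solid simplex of R^k has volume 1/k!. *)
Definition lambda (T : {set 'I_d.+1}) : probability (d.+1.-tuple R) R :=
  distribution
    (mnormalize
       (mrestr (lebesgue_tuple R #|T|.-1) (@measurable_solid_simplex #|T|.-1))
       (\d_ ([tuple 0 | _ < #|T|.-1] : #|T|.-1.-tuple R)))
    (@face_map T).

End uniform_face.

Section Lambda.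
Variables (R : realType) (d : nat).
Local Open Scope ereal_scope.

Definition Lambda (k : nat) (A : set (d.+1.-tuple R)) : \bar R :=
  ((k.+1`!)%:R * ((d - k)`!)%:R / (d.+1`!)%:R)%:E *
  \sum_(T : {set 'I_d.+1} | #|T| == k.+1) lambda R T A.

Section Lambda_measure.
Variable k : nat.

Let Lambda0 : Lambda k set0 = 0.
Proof. by rewrite /Lambda big1 ?mule0// => T _; rewrite measure0. Qed.

Let Lambda_ge0 A : 0 <= Lambda k A.
Proof. by apply: mule_ge0; [rewrite lee_fin divr_ge0// mulr_ge0|exact: sume_ge0]. Qed.

Let Lambda_sigma_additive : semi_sigma_additive (Lambda k).
Proof.
move=> F mF tF mUF.
rewrite (_ : (fun n => _) = fun n =>
    ((k.+1`!)%:R * ((d - k)`!)%:R / (d.+1`!)%:R)%:E *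
    \sum_(T : {set 'I_d.+1} | #|T| == k.+1)
      \sum_(0 <= i < n) lambda R T (F i)); last first.
  apply/funext => n; rewrite exchange_big ge0_sume_distrr// => i _.
  exact: sume_ge0.
apply: cvgeZl => //; apply: cvg_nnesum => T _.
  by apply: nearW => n; exact: sume_ge0.
exact: measure_semi_sigma_additive.
Qed.

HB.instance Definition _ := isMeasure.Build _ _ _ (Lambda k)
  Lambda0 Lambda_ge0 Lambda_sigma_additive.

Let Lambda_fin : fin_num_fun (Lambda k).
Proof.
move=> A mA; rewrite /Lambda fin_numM// sum_fin_num.
by apply/allP => x /mapP[T _ ->]; exact: fin_num_measure.
Qed.

HB.instance Definition _ := Measure_isFinite.Build _ _ _ (Lambda k) Lambda_fin.

End Lambda_measure.

Definition nu (c : R) (A : set (d.+1.-tuple R)) : \bar R :=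
  ((d`!)%:R * (d.+1`!)%:R / \prod_(1 <= j < d.+1) (c + j%:R))%:E *
  \sum_(k < d.+1)
    ((\prod_(1 <= j < k.+1) (c - j%:R)) /
       ((k`!)%:R * (k.+1`!)%:R * ((d - k)`!)%:R))%:E * Lambda k A.

Section nu_charge.
Variable c : R.

Let nuE : exists mu : {charge set (d.+1.-tuple R) -> \bar R}, nu c = mu.
Proof.
pose w (k : 'I_d.+1) : R := ((\prod_(1 <= j < k.+1) (c - j%:R)) /
  ((k`!)%:R * (k.+1`!)%:R * ((d - k)`!)%:R))%R.
pose add (m1 m2 : {charge set (d.+1.-tuple R) -> \bar R}) :
  {charge set (d.+1.-tuple R) -> \bar R} := cadd m1 m2.
pose z : {charge set (d.+1.-tuple R) -> \bar R} := czero.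
pose t (k : 'I_d.+1) : {charge set (d.+1.-tuple R) -> \bar R} :=
  cscale (w k) (charge_of_finite_measure (Lambda k)).
pose s := \big[add/z]_(k < d.+1) t k.
exists (cscale ((d`!)%:R * (d.+1`!)%:R / \prod_(1 <= j < d.+1) (c + j%:R)) s).
apply/funext => A; rewrite /nu /= /cscale /=; congr (_ * _).
by rewrite /s (big_morph (fun m : {charge set _ -> \bar R} => m A)
  (id1 := 0) (op1 := +%E)).
Qed.

Let nu0 : nu c set0 = 0.
Proof. by have [mu ->] := nuE; exact: charge0. Qed.

Let nu_fin A : measurable A -> nu c A \is a fin_num.
Proof. by have [mu ->] := nuE; exact: fin_num_measure. Qed.

Let nu_sigma_additive : semi_sigma_additive (nu c).
Proof. by have [mu ->] := nuE; exact: charge_semi_sigma_additive. Qed.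

HB.instance Definition _ := isCharge.Build _ _ _ (nu c)
  nu0 nu_fin nu_sigma_additive.

End nu_charge.

End Lambda.
Arguments Lambda : clear implicits.
Arguments nu {R} d c A.

Section charge_integral.
Context (disp : measure_display) (T : measurableType disp) (R : realType).
Local Open Scope ereal_scope.

(* Integral against a signed measure, through its Jordan decomposition (which
   does not depend on the Hahn decomposition chosen). *)
Definition charge_integral (mu : {charge set T -> \bar R}) (D : set T)
    (f : T -> \bar R) : \bar R :=
  let hP := cid (Hahn_decomposition mu) in
  let hN := cid (projT2 hP) in
  \int[jordan_pos (projT2 hN)]_(x in D) f x -
  \int[jordan_neg (projT2 hN)]_(x in D) f x.

End charge_integral.

Section simplex.
Variables (R : realType) (d : nat).

Definition simplex : set (d.+1.-tuple R) :=
  [set x | (forall i, 0 <= tnth x i) /\ \sum_(i < d.+1) tnth x i = 1].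

Definition dot (f x : d.+1.-tuple R) : R :=
  \sum_(i < d.+1) tnth f i * tnth x i.

End simplex.
Arguments simplex : clear implicits.

Section beta_law.
Variable R : realType.

Definition Gamma (p : R) : R :=
  \int[@lebesgue_measure R]_(t in `]0, +oo[) (t `^ (p - 1) * expR (- t)).

(* The library's beta_prob only has natural number parameters. *)
Definition beta_law (p q : R) (A : set R) : \bar R :=
  (\int[@lebesgue_measure R]_(x in A `&` `]0%R, 1%R[)
    (Gamma (p + q) / (Gamma p * Gamma q) *
       x `^ (p - 1) * (1 - x) `^ (q - 1))%:E)%E.

End beta_law.

Section random.
Context (disp : measure_display) (Om : measurableType disp) (R : realType).
Variable P : probability Om R.

Definition has_law d1 (T : measurableType d1) (X : Om -> T)
    (mu : set T -> \bar R) : Prop :=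
  forall A, measurable A -> pushforward P X A = mu A.

Definition independent d1 d2 (T1 : measurableType d1) (T2 : measurableType d2)
    (X : Om -> T1) (Y : Om -> T2) : Prop :=
  forall A B, measurable A -> measurable B ->
    P (X @^-1` A `&` Y @^-1` B) = (P (X @^-1` A) * P (Y @^-1` B))%E.

Definition mix n (Y : Om -> R) (X B : Om -> n.-tuple R) (w : Om) : n.-tuple R :=
  [tuple (1 - Y w) * tnth (X w) i + Y w * tnth (B w) i | i < n].

(* B takes values in the simplex, is independent of (Y, X), and
   X ~ (1 - Y) X + Y B. *)
Definition perpetuity_solution d (Y : Om -> R) (X B : Om -> d.+1.-tuple R) :
    Prop :=
  [/\ forall w, simplex R d (B w),
      independent B (fun w => (Y w, X w)) &
      has_law X (pushforward P (mix Y X B))].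

End random.

(* Main.v *)
(* For distinct f_i, iterating the fundamental theorem of calculus (the formula of
   Hermite and Genocchi) turns the integral of a power of <f, x> against lambda_T
   into a divided difference, and gives
     (c-1)...(c-k)/k! * int <f, x>^-c dlambda_T
       = sum_(i in T) f_i^-c prod_(j in T, j <> i) f_i / (f_j - f_i)
   when |T| = k+1.  The sum over T then factors: the coefficient of f_i^-c is
   prod_(j <> i) (1 + f_i/(f_j - f_i)) = prod_(j <> i) f_j / (f_j - f_i), which is
   also, by the same formula on the full simplex, the one in the right-hand side.
   Continuity removes the distinctness.

   For Y ~ beta(c, d+1), E[((1-Y)a + Yb)^-(c+d+1)] = a^-(d+1) b^-c, and
   E[<f, X>^-(d+1)] = 1/(f_0...f_d).  Hence X ~ (1-Y)X + YB amounts to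
   E[<f, B>^-c] = f_0...f_d E[<f, X>^-(c+d+1)] for all f, as the transforms
   int <f, x>^-s dmu determine a finite measure mu on the simplex: their
   derivatives in f yield the moments of mu.  By the first identity this says
   B ~ nu, so a solution exists if and only if nu is nonnegative, and nu gives to
   the relative interior of a face of dimension k a mass of the sign of
   (c-1)...(c-k). *)
From HB Require Import structures.
Require Import Defs.
From mathcomp Require Import all_boot all_order all_algebra.
From mathcomp Require Import all_classical all_reals all_analysis.
From mathcomp Require Import measurable_realfun ring lra.

Set Implicit Arguments.
Unset Strict Implicit.
Unset Printing Implicit Defensive.

Import Order.TTheory GRing.Theory Num.Theory.
Import numFieldNormedType.Exports.

Local Open Scope classical_set_scope.
Local Open Scope ring_scope.

(** * Powers of linear forms on the solid simplex *)

(** Four obstacles shape the proof. For a small integer c the factor (c-1)...(c-k) vanishes and the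
    face integral involves a logarithm instead of a power. The Hermite-Genocchi identities are
    therefore kept multiplied by their exponents: at such a c they remain true, as identities
    between zeros, and no case distinction on c is made. The measure nu is signed, whereas changes
    of variables and uniqueness theorems are about nonnegative measures. It is written as a
    difference m1 - m2 of two finite combinations of face laws, and each claim about it is
    rearranged into an equality between sums of nonnegative measures. From moments to measures, the
    indicator of a box is approached by explicit polynomials that converge at every point of the
    simplex, so that dominated convergence suffices and no boundary set needs care. Finally, the
    space that carries (Y, X) may be too small for an independent B. A solution therefore lives on
    an extension, given by a measure-preserving map to the original space along which Y and X are
    pulled back. *)

Section sigma_finite_product.
Context d1 d2 (T1 : measurableType d1) (T2 : measurableType d2) (R : realType).
Variables (m1 : {measure set T1 -> \bar R})
  (m2 : {sigma_finite_measure set T2 -> \bar R}).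
Hypothesis sm1 : sigma_finite setT m1.
Local Open Scope ereal_scope.

(* m1 is only sigma-finite through the proof sm1; this alias carries that proof,
   so that Tonelli's theorem can find a structure instance on it. *)
Definition sigma_finite_of (_ : sigma_finite setT m1) : set T1 -> \bar R := m1.

Let m0 : sigma_finite_of sm1 set0 = 0. Proof. exact: measure0. Qed.

Let m_ge0 A : 0 <= sigma_finite_of sm1 A. Proof. exact: measure_ge0. Qed.

Let m_additive : semi_sigma_additive (sigma_finite_of sm1).
Proof. exact: measure_semi_sigma_additive. Qed.

HB.instance Definition _ := isMeasure.Build _ _ _ (sigma_finite_of sm1) m0 m_ge0 m_additive.
HB.instance Definition _ := Measure_isSigmaFinite.Build _ _ _ (sigma_finite_of sm1) sm1.

Lemma tonelli_sigma_finite (f : T1 * T2 -> \bar R) :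
  measurable_fun setT f -> (forall x, 0 <= f x) ->
  \int[m1 \x m2]_z f z = \int[m1]_x \int[m2]_y f (x, y).
Proof. exact: (fubini_tonelli1 (m1 := sigma_finite_of sm1)). Qed.

End sigma_finite_product.

Section lebesgue_tuple_theory.
Variable R : realType.
Local Open Scope ereal_scope.

Lemma sigma_finite_lebesgue_tuple k : sigma_finite setT (lebesgue_tuple R k).
Proof.
elim: k => [|k ih].
  exact: (sigma_finiteT (\d_ ([tuple] : 0.-tuple R) : {measure set _ -> \bar R})).
have /sigma_finiteP[F [TF ndF Foo]] := ih.
have /sigma_finiteP[G [TG ndG Goo]] := sigma_finiteT (@lebesgue_measure R).
(* [g] undoes [cons_pair], so a pulled-back rectangle keeps the measure of the rectangle. Both
   exhaustions increase, which lets the larger of two indices serve for both factors. *)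
pose g (x : k.+1.-tuple R) : k.-tuple R * R := ([tuple of behead x], thead x).
have mg : measurable_fun setT g.
  apply: measurable_fun_pair; first exact: measurable_behead.
  exact: measurable_tnth.
exists (fun n => g @^-1` (F n `*` G n)).
  apply/esym/seteqP; split=> // x _.
  have : [set: k.-tuple R] (g x).1 by [].
  have : [set: R] (g x).2 by [].
  rewrite TF TG => -[n _ Gn] [m _ Fm]; exists (maxn n m) => //; split.
    by have /subsetPset := ndF _ _ (leq_maxr n m); apply.
  by have /subsetPset := ndG _ _ (leq_maxl n m); apply.
move=> n; have [mF Fn] := Foo n; have [mG Gn] := Goo n; split.
  by rewrite -[X in measurable X]setTI; apply: mg => //; exact: measurableX.
rewrite /= /lebesgue_cons /pushforward.
rewrite (_ : @cons_pair R k @^-1` (g @^-1` (F n `*` G n)) = F n `*` G n).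
  by rewrite product_measure1E// lte_mul_pinfty// ge0_fin_numE.
apply/seteqP; split => -[u r] /=; rewrite /g /cons_pair /= theadE;
  by rewrite (_ : [tuple of _] = u)//; exact/val_inj.
Qed.

Lemma integral_lebesgue_tupleS k (f : k.+1.-tuple R -> \bar R) :
  measurable_fun setT f -> (forall x, 0 <= f x) ->
  \int[lebesgue_tuple R k.+1]_x f x =
  \int[lebesgue_tuple R k]_u \int[@lebesgue_measure R]_r f (cons_pair (u, r)).
Proof.
move=> mf f0.
have mc : measurable_fun setT
  (@cons_pair R k : (k.-tuple R * measurableTypeR R)%type -> _).
  exact: measurable_cons.
have H := ge0_integral_pushforward mc (lebesgue_tuple R k \x @lebesgue_measure R)
  measurableT mf (fun x _ => f0 x).
transitivity (\int[lebesgue_tuple R k \x @lebesgue_measure R]_z f (cons_pair z)).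
  exact: H.
rewrite tonelli_sigma_finite//; first exact: sigma_finite_lebesgue_tuple.
by apply: measurableT_comp => //; exact: measurable_cons_pair.
Qed.

End lebesgue_tuple_theory.

Section simplex_powers.
Variable R : realType.

Lemma affine_gt0 (A dl l r : R) : 0 < A -> 0 < A + l * dl -> 0 <= r <= l ->
  0 < A + r * dl.
Proof.
move=> A0 Al /andP[r0 rl]; have [d0|d0] := leP 0 dl.
  by rewrite ltr_wpDr// mulr_ge0.
by apply: lt_le_trans Al _; rewrite lerD2l ler_wnM2r// ltW.
Qed.

Lemma is_derive_powR_affine (A dl p r : R) : 0 < A + r * dl ->
  is_derive r 1 (fun r => (A + r * dl) `^ p)
    (p * (A + r * dl) `^ (p - 1) * dl).
Proof.
move=> Ar.
have H1 : is_derive r 1 (fun r : R => A + r * dl) dl.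
  by apply: is_derive_eq; rewrite add0r mul1r scaler0 add0r /GRing.scale/= mulr1.
have H2 : is_derive (A + r * dl) 1 (@powR R ^~ p) (p * (A + r * dl) `^ (p - 1)).
  exact: is_derive1_powR.
exact: (@is_derive1_comp R (@powR R ^~ p) (fun r => A + r * dl) r _ _ H2 H1).
Qed.

(** The condition [p * dl != 0] excludes a constant base and the exponent -1, whose primitive is a
    logarithm. *)
Lemma integral_powR_affine (A dl l p : R) : 0 <= l -> 0 < A ->
  0 < A + l * dl -> p * dl != 0 ->
  (\int[@lebesgue_measure R]_(r in `[0%R, l]) ((A + r * dl) `^ (p - 1))%:E)%E =
  ((p * dl)^-1 * ((A + l * dl) `^ p - A `^ p))%:E.
Proof.
rewrite le_eqVlt => /predU1P[<- A0 _ _|l0 A0 Al pd0].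
  by rewrite set_itv1 integral_set1 mul0r addr0 subrr mulr0.
pose F r := (p * dl)^-1 * (A + r * dl) `^ p.
have Apos r : r \in `[0, l] -> 0 < A + r * dl.
  by rewrite in_itv /= => rl; exact: (@affine_gt0 _ _ l).
have dF r : r \in `[0, l] -> is_derive r 1 F ((A + r * dl) `^ (p - 1)).
  move=> rl; have H := is_derive_powR_affine p (Apos r rl).
  have -> : (A + r * dl) `^ (p - 1) =
      (p * dl)^-1 *: (p * (A + r * dl) `^ (p - 1) * dl).
    by rewrite /GRing.scale /=; field; move: pd0; rewrite mulf_eq0 negb_or andbC.
  exact: is_deriveZ.
have cF r : r \in `[0, l] -> {for r, continuous F}.
  move=> rl; have [H _] := dF r rl.
  by apply: differentiable_continuous; exact/derivable1_diffP.
rewrite (@continuous_FTC2 _ _ F 0 l)//.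
- by rewrite /F mul0r addr0 -EFinB mulrBr.
- apply: derivable_within_continuous => r rl.
  by have [] := is_derive_powR_affine (p - 1) (Apos r rl).
- split.
  + move=> r rl; have [] // := dF r _.
    by apply: subset_itv_oo_cc rl.
  + by apply: cvg_at_right_filter; apply: cF; rewrite in_itv /= lexx ltW.
  + by apply: cvg_at_left_filter; apply: cF; rewrite in_itv /= lexx ltW.
- move=> r rl; rewrite derive1E; apply: derive_val.
    by apply: dF; apply: subset_itv_oo_cc rl.
Qed.

End simplex_powers.

Section solid_simplex_integral.
Variable R : realType.

Lemma tnth_cons_pair0 k (u : k.-tuple R) r : tnth (cons_pair (u, r)) ord0 = r.
Proof. by []. Qed.

Lemma tnth_cons_pairS k (u : k.-tuple R) r j :
  tnth (cons_pair (u, r)) (lift ord0 j) = tnth u j.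
Proof. exact: tnthS. Qed.

Lemma sum_cons_pair k (u : k.-tuple R) r :
  \sum_j tnth (cons_pair (u, r)) j = r + \sum_j tnth u j.
Proof.
rewrite big_ord_recl tnth_cons_pair0; congr (_ + _).
by apply: eq_bigr => j _; rewrite tnth_cons_pairS.
Qed.

Lemma solid_simplex_cons k (u : k.-tuple R) r :
  @solid_simplex R k.+1 (cons_pair (u, r)) <->
  @solid_simplex R k u /\ r \in `[0, 1 - \sum_j tnth u j].
Proof.
rewrite in_itv /= lerBrDr; split.
  rewrite [X in X -> _]/solid_simplex => -[u0 s1].
  rewrite sum_cons_pair in s1.
  have r0 : 0 <= r by exact: (u0 ord0).
  split; last by rewrite r0.
  split; last by apply: le_trans s1; rewrite lerDr.
  by move=> i; have := u0 (lift ord0 i); rewrite tnth_cons_pairS.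
move=> [[u0 s1] /andP[r0 rs]]; split; last by rewrite sum_cons_pair.
by move=> i; case: (unliftP ord0 i) => [j|] ->;
  rewrite ?tnth_cons_pairS ?tnth_cons_pair0.
Qed.

(** Slicing along the head coordinate: the slice over [u] is an interval whose length is the
    barycentric weight that [u] leaves for the last vertex. *)
Lemma integral_solid_simplexS k (f : k.+1.-tuple R -> \bar R) :
  measurable_fun setT f -> (forall x, 0 <= f x)%E ->
  (\int[lebesgue_tuple R k.+1]_(x in @solid_simplex R k.+1) f x =
   \int[lebesgue_tuple R k]_(u in @solid_simplex R k)
     \int[@lebesgue_measure R]_(r in `[0%R, (1 - \sum_j tnth u j)%R])
       f (cons_pair (u, r)))%E.
Proof.
move=> mf f0; rewrite integral_mkcond integral_lebesgue_tupleS; last 2 first.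
- apply/(measurable_restrictT _ _).1 => //; first exact: measurable_solid_simplex.
  exact: measurable_funS mf.
- by move=> x; exact: erestrict_ge0.
rewrite [RHS]integral_mkcond; apply: eq_integral => u _.
rewrite [RHS]/patch; case: ifPn => us; last first.
  apply: integral0_eq => r _; rewrite /patch ifF//.
  apply/negbTE; apply: contra us; rewrite !inE => /solid_simplex_cons.
  by case.
rewrite [RHS]integral_mkcond; apply: eq_integral => r _.
rewrite /patch; congr (if _ then _ else _).
apply/idP/idP; rewrite !inE.
  by move/solid_simplex_cons => [].
by move=> rs; apply/solid_simplex_cons; rewrite inE in us.
Qed.

(** Slices have length at most 1. Finiteness is what integrability requires; the exact volume comes
    later, as a special power integral. *)
Lemma lebesgue_solid_simplex_fin k :
  (lebesgue_tuple R k (@solid_simplex R k) < +oo)%E.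
Proof.
elim: k => [|k ih].
  by rewrite /= diracE ltry.
rewrite -[ltLHS]mul1e -integral_cst; last exact: measurable_solid_simplex.
rewrite integral_solid_simplexS//.
rewrite (eq_integral (fun u : k.-tuple R => (1 - \sum_j tnth u j)%:E)); last first.
  move=> u /[!inE] -[u0 u1]; rewrite integral_cst//= mul1e.
  rewrite lebesgue_measure_itv /= lte_fin -EFinB subr0; case: ifPn => //.
  by rewrite -leNgt subr_le0 => u1'; congr _%:E; apply/esym/eqP;
    rewrite subr_eq0 eq_le u1'.
apply: le_lt_trans ih.
rewrite -[leRHS]mul1e -integral_cst; last exact: measurable_solid_simplex.
apply: ge0_le_integral => //.
- exact: measurable_solid_simplex.
- by move=> u [_ u1]; rewrite lee_fin subr_ge0.
- apply/measurable_EFinP; apply: measurable_funTS.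
  apply: measurable_funB => //.
  by apply: measurable_sum => j; exact: measurable_tnth.
- by move=> u [u0 _]; rewrite lee_fin gerBl; exact: sumr_ge0.
Qed.

(** The affine function with value [z] at the origin and the entries of [v] at the unit vectors:
    this is <f, x> read in the affine chart of a face. *)
Definition barycentre k (v : k.-tuple R) (z : R) (u : k.-tuple R) : R :=
  \sum_j tnth v j * tnth u j + (1 - \sum_j tnth u j) * z.

Lemma measurable_barycentre k (v : k.-tuple R) (z : R) :
  measurable_fun setT (barycentre v z).
Proof.
apply: measurable_funD.
  apply: measurable_sum => j; apply: measurable_funM => //.
  exact: measurable_tnth.
apply: measurable_funM => //; apply: measurable_funB => //.
by apply: measurable_sum => j; exact: measurable_tnth.
Qed.

Lemma barycentre_cons k (v : k.-tuple R) f0 z u r :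
  barycentre [tuple of f0 :: v] z (cons_pair (u, r)) =
  barycentre v z u + r * (f0 - z).
Proof.
rewrite /barycentre sum_cons_pair big_ord_recl tnth0 tnth_cons_pair0.
under eq_bigr do rewrite tnthS tnth_cons_pairS.
by ring.
Qed.

(** The upper end of the slice over [u], where all the weight of [z] has passed to [f0]. Hence the
    primitive at the two ends yields power integrals of the same shape in one dimension less. *)
Lemma barycentre_change k (v : k.-tuple R) f0 z u :
  barycentre v f0 u = barycentre v z u + (1 - \sum_j tnth u j) * (f0 - z).
Proof. by rewrite /barycentre; ring. Qed.

Lemma barycentre_itv k (v : k.-tuple R) z u m M :
  (forall j, m <= tnth v j <= M) -> m <= z <= M ->
  @solid_simplex R k u -> m <= barycentre v z u <= M.
Proof.
move=> vm /andP[mz zM] [u0 u1]; rewrite /barycentre; apply/andP; split.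
  rewrite [leLHS](_ : _ = \sum_j m * tnth u j + (1 - \sum_j tnth u j) * m).
    by rewrite lerD ?ler_wpM2l ?subr_ge0// ler_sum// => j _;
      rewrite ler_wpM2r//; case/andP: (vm j).
  by rewrite -mulr_sumr; ring.
rewrite [leRHS](_ : _ = \sum_j M * tnth u j + (1 - \sum_j tnth u j) * M).
  by rewrite lerD ?ler_wpM2l ?subr_ge0// ler_sum// => j _;
    rewrite ler_wpM2r//; case/andP: (vm j).
by rewrite -mulr_sumr; ring.
Qed.

End solid_simplex_integral.

Section bounded_powers.
Variable R : realType.

Lemma positive_bounds (I : finType) (f : I -> R) : (forall i, 0 < f i) ->
  exists m M, 0 < m /\ forall i, m <= f i <= M.
Proof.
(* The added 1 keeps the lower bound positive when [I] is empty. *)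
move=> f0; exists (1 + \sum_i (f i)^-1)^-1, (\sum_i f i).
have s0 : 0 < 1 + \sum_i (f i)^-1.
  by rewrite ltr_wpDr// sumr_ge0// => i _; rewrite invr_ge0 ltW.
split=> [|i]; first by rewrite invr_gt0.
apply/andP; split.
  rewrite -[leRHS]invrK lef_pV2 ?posrE ?invr_gt0//.
  rewrite (bigD1 i)//= addrCA lerDl addr_ge0// sumr_ge0// => j _.
  by rewrite invr_ge0 ltW.
by rewrite (bigD1 i)//= lerDl sumr_ge0// => j _; exact: ltW.
Qed.

(** A power is monotone, so its maximum is at one of the ends, which one depending on the sign of
    [p]; the sum serves for both signs. *)
Lemma powR_bound (m M t p : R) : 0 < m -> m <= t <= M ->
  t `^ p <= m `^ p + M `^ p.
Proof.
move=> m0 /andP[mt tM]; have t0 := lt_le_trans m0 mt.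
have [p0|p0] := leP 0 p.
  rewrite -[leLHS]add0r lerD ?powR_ge0//.
  by rewrite ge0_ler_powR// nnegrE ltW// (lt_le_trans t0).
rewrite -[leLHS]addr0 lerD ?powR_ge0//.
rewrite -[p]opprK (powRN t) (powRN m) lef_pV2 ?posrE ?powR_gt0//.
by rewrite ge0_ler_powR ?oppr_ge0 ?nnegrE// ltW.
Qed.

Lemma integrable_bounded d (T : measurableType d)
    (mu : {measure set T -> \bar R}) (D : set T) (f : T -> R) (M : R) :
  measurable D -> (mu D < +oo)%E -> measurable_fun D f ->
  (forall x, D x -> `|f x| <= M) -> mu.-integrable D (EFin \o f).
Proof.
move=> mD Doo mf fM; apply: measurable_bounded_integrable => //.
exists M; split; first exact: num_real.
by move=> N MN x Dx /=; apply: le_trans (fM _ Dx) (ltW MN).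
Qed.

Lemma integrable_powR d (T : measurableType d)
    (mu : {measure set T -> \bar R}) (D : set T) (f : T -> R) (m M p : R) :
  measurable D -> (mu D < +oo)%E -> measurable_fun D f -> 0 < m ->
  (forall x, D x -> m <= f x <= M) ->
  mu.-integrable D (fun x => (f x `^ p)%:E).
Proof.
move=> mD Doo mf m0 fm; apply: (integrable_bounded (M := m `^ p + M `^ p)) => //.
  apply: (measurableT_comp (measurable_powR p)) => //.
move=> x Dx; rewrite ger0_norm ?powR_ge0//.
by apply: powR_bound => //; exact: fm.
Qed.

End bounded_powers.

Section power_integral.
Variable R : realType.

Definition power_integral k (p : R) (v : k.-tuple R) (z : R) : R :=
  \int[lebesgue_tuple R k]_(u in @solid_simplex R k) (barycentre v z u `^ p).

Lemma positive_bounds_rcons k (v : k.-tuple R) (z : R) :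
  (forall j, 0 < tnth v j) -> 0 < z ->
  exists m M, [/\ 0 < m, forall j, m <= tnth v j <= M & m <= z <= M].
Proof.
move=> v0 z0; have [m [M [m0 vM]]] := positive_bounds v0.
exists (Num.min m z), (Num.max M z); split.
- by rewrite lt_min m0.
- by move=> j; rewrite ge_min le_max; case/andP: (vM j) => -> ->.
- by rewrite ge_min le_max !lexx !orbT.
Qed.

Lemma integrable_barycentre k p (v : k.-tuple R) (z : R) :
  (forall j, 0 < tnth v j) -> 0 < z ->
  (lebesgue_tuple R k).-integrable (@solid_simplex R k)
    (fun u => (barycentre v z u `^ p)%:E).
Proof.
move=> v0 z0; have [m [M [m0 vM zM]]] := positive_bounds_rcons v0 z0.
apply: (integrable_powR (m := m) (M := M)) => //.
- exact: measurable_solid_simplex.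
- exact: lebesgue_solid_simplex_fin.
- by apply: measurable_funTS; exact: measurable_barycentre.
- by move=> u; exact: barycentre_itv.
Qed.

Lemma barycentre_gt0 k (v : k.-tuple R) z u :
  (forall j, 0 < tnth v j) -> 0 < z -> @solid_simplex R k u ->
  0 < barycentre v z u.
Proof.
move=> v0 z0; have [m [M [m0 vM zM]]] := positive_bounds_rcons v0 z0.
by move=> /(barycentre_itv vM zM)/andP[+ _]; exact: lt_le_trans.
Qed.

(* The Hermite-Genocchi recursion: the first coordinate is integrated by the
   fundamental theorem of calculus, the integrand being a power of an affine
   function of it with slope y - z. *)
Lemma power_integralS k p (v : k.-tuple R) (y z : R) :
  (forall j, 0 < tnth v j) -> 0 < y -> 0 < z ->
  p * (y - z) * power_integral (p - 1) [tuple of y :: v] z =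
  power_integral p v y - power_integral p v z.
Proof.
move=> v0 y0 z0.
(* The degenerate case holds too: for [p] = 0 both terms on the right are the volume, and for [y] =
   [z] they coincide. The exponent 0 does occur when c is a small integer. *)
have [/eqP|pyz] := eqVneq (p * (y - z)) 0.
  rewrite mulf_eq0 => /orP[/eqP->|/eqP/subr0_eq->]; last by rewrite !subrr !(mulr0,mul0r).
  rewrite !mul0r /power_integral; apply/esym/eqP; rewrite subr_eq0; apply/eqP.
  by apply: eq_Rintegral => u _; rewrite !powRr0.
have -> : power_integral (p - 1) [tuple of y :: v] z =
    \int[lebesgue_tuple R k]_(u in @solid_simplex R k)
      ((p * (y - z))^-1 * (barycentre v y u `^ p - barycentre v z u `^ p)).
  rewrite /power_integral /Rintegral; congr fine.
  rewrite integral_solid_simplexS; last 2 first.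
  - apply/measurable_EFinP; apply: (measurableT_comp (measurable_powR _)).
    exact: measurable_barycentre.
  - by move=> x; rewrite lee_fin powR_ge0.
  apply: eq_integral => u /[!inE] us.
  under eq_integral do rewrite barycentre_cons.
  rewrite integral_powR_affine//.
  - by rewrite -barycentre_change.
  - by case: us => _; rewrite subr_ge0.
  - exact: barycentre_gt0.
  - by rewrite -barycentre_change barycentre_gt0.
rewrite RintegralZl; last 2 first.
- exact: measurable_solid_simplex.
- rewrite (_ : EFin \o _ = fun u => ((barycentre v y u `^ p)%:E -
      (barycentre v z u `^ p)%:E)%E); last by apply/funext.
  apply: integrableB; [exact: measurable_solid_simplex|..];
    exact: integrable_barycentre.
rewrite RintegralB ?mulVKf ?mulVf//; first exact: measurable_solid_simplex.
- exact: integrable_barycentre.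
- exact: integrable_barycentre.
Qed.

Lemma power_integral0 p (v : 0.-tuple R) (z : R) :
  power_integral p v z = z `^ p.
Proof.
rewrite /power_integral /Rintegral integral_dirac//; last 2 first.
- exact: measurable_solid_simplex.
- apply: measurable_funTS; apply/measurable_EFinP.
  by apply: (measurableT_comp (measurable_powR _)); exact: measurable_barycentre.
rewrite diracE mem_set; last by split; [case|rewrite big_ord0].
by rewrite mul1e /= /barycentre !big_ord0 add0r subr0 mul1r.
Qed.

End power_integral.

(** * Divided differences of powers *)

Section divided_difference.
Variable F : fieldType.
Implicit Types (g : F -> F) (s v : seq F).

(** The Lagrange form, visibly symmetric in the points. As [y != x] compares values and not
    positions, it is the divided difference only for sequences without repetition. *)
Definition divided_difference g s : F :=
  \sum_(x <- s) g x / \prod_(y <- s | y != x) (x - y).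

Lemma divided_difference_perm g s1 s2 : perm_eq s1 s2 ->
  divided_difference g s1 = divided_difference g s2.
Proof.
move=> s12; rewrite /divided_difference (perm_big s2)//=.
by apply: eq_bigr => x _; rewrite (perm_big s2).
Qed.

(** At a point x of [v] this is (y - z)/((x - y)(x - z)) = 1/(x - y) - 1/(x - z); at [y] and at [z]
    the factor [y - z] cancels a denominator up to sign. *)
Lemma divided_differenceS g y z v : uniq [:: y, z & v] ->
  (y - z) * divided_difference g [:: y, z & v] =
  divided_difference g (y :: v) - divided_difference g (z :: v).
Proof.
rewrite /= inE negb_or -andbA => /and4P[yz yv zv uv].
rewrite /divided_difference !big_cons !eqxx /= (eq_sym z y) yz.
have nv w : w \notin v -> forall x, x \in v -> (w != x).
  by move=> wv x xv; apply: contraNneq wv => ->.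
have p0 w : w \notin v -> \prod_(x <- v | x != w) (w - x) != 0.
  move=> wv; rewrite prodf_seq_neq0; apply/allP => x xv; apply/implyP => _.
  by rewrite subr_eq0 nv.
rewrite !mulrDr addrA opprD [RHS]addrACA; congr (_ + _); last first.
  rewrite mulr_sumr -sumrB big_seq [RHS]big_seq; apply: eq_bigr => x xv.
  rewrite !big_cons !nv//.
  have : \prod_(j <- v | j != x) (x - j) != 0.
    rewrite prodf_seq_neq0; apply/allP => w wv; apply/implyP.
    by rewrite subr_eq0 eq_sym.
  have : x - y != 0 by rewrite subr_eq0 eq_sym nv.
  have : x - z != 0 by rewrite subr_eq0 eq_sym nv.
  by move=> h1 h2 h3; field; rewrite h1 h2 h3.
have yz0 : y - z != 0 by rewrite subr_eq0.
have zy0 : z - y != 0 by rewrite subr_eq0 eq_sym.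
have := p0 _ yv; have := p0 _ zv => h1 h2.
field; rewrite ?h1 ?h2 ?yz0 ?zy0//.
Qed.

End divided_difference.

Section power_integral_divided_difference.
Variable R : realType.

Lemma perm_rcons_cons (T : eqType) (s : seq T) y z :
  perm_eq (rcons (y :: s) z) [:: y, z & s].
Proof. by rewrite rcons_cons perm_cons perm_rcons. Qed.

Lemma tuple_cons_pos k (v : k.-tuple R) y :
  (forall j, 0 < tnth [tuple of y :: v] j) ->
  0 < y /\ forall j, 0 < tnth v j.
Proof.
move=> h; split; first by have := h ord0; rewrite tnth0.
by move=> j; have := h (lift ord0 j); rewrite tnthS.
Qed.

(** Multiplied by [y - z], both sides obey the same recursion. The factors [p - j] are the exponents
    met in the successive integrations. *)
Lemma power_integral_divided_difference k (p : R) (v : k.-tuple R) z :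
  (forall j, 0 < tnth v j) -> 0 < z -> uniq (rcons v z) ->
  \prod_(j < k) (p - j%:R) * power_integral (p - k%:R) v z =
  divided_difference (@powR R ^~ p) (rcons v z).
Proof.
elim: k v z => [|k ih] v z.
  rewrite power_integral0 big_ord0 mul1r subr0 (tuple0 v) /= => _ _ _.
  by rewrite /divided_difference big_seq1 big_cons eqxx big_nil invr1 mulr1.
case/tupleP: v => y v /tuple_cons_pos[y0 v0] z0.
rewrite (perm_uniq (perm_rcons_cons _ _ _)) => u.
rewrite (divided_difference_perm _ (perm_rcons_cons _ _ _)).
have uy : uniq (rcons v y).
  by move: u; rewrite rcons_uniq /= inE negb_or => /and3P[/andP[_ ->]].
have uz : uniq (rcons v z).
  by move: u; rewrite rcons_uniq /= inE => /and3P[_ -> ->].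
have yz : y - z != 0.
  by move: u; rewrite /= inE negb_or subr_eq0 => /and3P[/andP[->]].
apply: (mulfI yz); rewrite divided_differenceS//.
have E w : divided_difference (@powR R ^~ p) (w :: v) =
    divided_difference (@powR R ^~ p) (rcons v w).
  by apply: divided_difference_perm; rewrite perm_sym perm_rcons.
rewrite !E -!ih//.
rewrite -mulrBr -power_integralS// big_ord_recr /= -natr1.
by rewrite opprD addrA; ring.
Qed.

(** The divided differences of 1/t have a closed form, since 1/y - 1/z = (z - y)/(y z) reproduces a
    reciprocal product at each step of the recursion. *)
Lemma power_integral_prod_uniq k (v : k.-tuple R) z :
  (forall j, 0 < tnth v j) -> 0 < z -> uniq (rcons v z) ->
  k`!%:R * power_integral (- k.+1%:R) v z = (\prod_j tnth v j * z)^-1.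
Proof.
elim: k v z => [|k ih] v z.
  by rewrite power_integral0 big_ord0 fact0 !mul1r => _ z0 _; rewrite powR_inv1// ltW.
case/tupleP: v => y v /tuple_cons_pos[y0 v0] z0.
rewrite (perm_uniq (perm_rcons_cons _ _ _)) => u.
have uy : uniq (rcons v y).
  by move: u; rewrite rcons_uniq /= inE negb_or => /and3P[/andP[_ ->]].
have uz : uniq (rcons v z).
  by move: u; rewrite rcons_uniq /= inE => /and3P[_ -> ->].
have yz : y - z != 0.
  by move: u; rewrite /= inE negb_or subr_eq0 => /and3P[/andP[->]].
have H := power_integralS (- k.+1%:R) v0 y0 z0.
rewrite big_ord_recl tnth0; under eq_bigr do rewrite tnthS.
have P0 : \prod_j tnth v j != 0.
  by apply/prodf_neq0 => j _; rewrite gt_eqF.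
have -> : - k.+2%:R = - k.+1%:R - 1 :> R by rewrite -[in LHS]natr1 opprD.
rewrite factS natrM; move: H.
set I := power_integral _ [tuple of _] _ => H.
apply: (mulfI yz).
transitivity (- (k`!%:R * (- k.+1%:R * (y - z) * I))); first by ring.
rewrite H mulrBr !ih//.
by field; rewrite P0 !gt_eqF.
Qed.

End power_integral_divided_difference.

Section perturbation.
Variable R : realType.

(* Adding w i / (n + 1) makes coinciding values distinct, which reduces
   identities between continuous expressions to distinct arguments. *)
Lemma cvg_perturbed (a b : R) : a + b * n.+1%:R^-1 @[n --> \oo] --> a.
Proof.
have H : a + b * n.+1%:R^-1 @[n --> \oo] --> a + b * 0.
  apply: cvgD; first exact: cvg_cst.
  by apply: cvgMr; exact: cvg_harmonic.
by rewrite mulr0 addr0 in H.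
Qed.

Lemma cvg_perturbed_powR (a b p : R) : 0 < a ->
  (a + b * n.+1%:R^-1) `^ p @[n --> \oo] --> a `^ p.
Proof.
move=> a0; apply: (@cvg_comp _ _ _ (fun n => a + b * n.+1%:R^-1) (@powR R ^~ p)).
  exact: cvg_perturbed.
have [H _] := is_derive1_powR p a0.
have : {for a, continuous (@powR R ^~ p)}.
  by apply: differentiable_continuous; exact/derivable1_diffP.
exact.
Qed.

(** The perturbation is upwards and at most [B], so every base stays in [m, A + B] and a constant
    dominates. *)
Lemma cvg_integral_perturbed_powR d (T : measurableType d)
    (mu : {measure set T -> \bar R}) (D : set T) (a b : T -> R) (m A B p : R) :
  measurable D -> (mu D < +oo)%E ->
  measurable_fun D a -> measurable_fun D b -> 0 < m ->
  (forall x, D x -> m <= a x <= A) -> (forall x, D x -> 0 <= b x <= B) ->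
  \int[mu]_(x in D) ((a x + b x * n.+1%:R^-1) `^ p) @[n --> \oo] -->
  \int[mu]_(x in D) (a x `^ p).
Proof.
move=> mD Doo ma mb m0 aD bD.
have bound n x : D x -> m <= a x + b x * n.+1%:R^-1 <= A + B.
  move=> Dx; have /andP[am aA] := aD _ Dx; have /andP[b0 bB] := bD _ Dx.
  have n0 : 0 <= (n.+1%:R^-1 : R) by [].
  have n1 : (n.+1%:R^-1 : R) <= 1 by rewrite invf_le1// ler1n.
  rewrite ler_wpDr ?mulr_ge0//= lerD//; apply: le_trans bB.
  by rewrite ler_piMr.
have mf n : measurable_fun D (fun x => (a x + b x * n.+1%:R^-1) `^ p).
  apply: (measurableT_comp (measurable_powR p)) => //.
  by apply: measurable_funD => //; exact: measurable_funM.
have iM : mu.-integrable D (cst (m `^ p + (A + B) `^ p)%:E).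
  apply: (@integrable_bounded _ _ _ mu D (cst (m `^ p + (A + B) `^ p))
    `|m `^ p + (A + B) `^ p|) => //.
apply: fine_cvg.
have := @dominated_cvg _ _ _ mu D mD
  (fun n x => ((a x + b x * n.+1%:R^-1) `^ p)%:E) (fun x => (a x `^ p)%:E)
  (cst (m `^ p + (A + B) `^ p)%:E).
rewrite fineK; last first.
  have := integrable_powR p mD Doo ma m0 aD.
  by move/integrable_fin_num; exact.
apply => //.
- by move=> n; exact/measurable_EFinP.
- move=> x Dx; apply/fine_cvgP; split; first exact: nearW.
  apply: cvg_perturbed_powR.
  by have /andP[+ _] := aD _ Dx; exact: lt_le_trans.
- move=> n x Dx; rewrite /= lee_fin ger0_norm ?powR_ge0//.
  by apply: powR_bound => //; exact: bound.
Qed.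

(** There are finitely many pairs, so one pair at a time suffices: if f_i = f_j the difference is
    (w_i - w_j)/(n + 1), never zero; otherwise it tends to f_i - f_j. *)
Lemma perturbed_injective (I : finType) (f w : I -> R) : injective w ->
  \forall n \near \oo, injective (fun i => f i + w i * n.+1%:R^-1).
Proof.
move=> wI.
suff H i j : i != j ->
    \forall n \near \oo, f i + w i * n.+1%:R^-1 != f j + w j * n.+1%:R^-1.
  have : \forall n \near \oo, forall ij : I * I, ij.1 != ij.2 ->
      f ij.1 + w ij.1 * n.+1%:R^-1 != f ij.2 + w ij.2 * n.+1%:R^-1.
    apply: filter_forall => -[i j] /=.
    have [ij|ij] := eqVneq i j; first by apply: nearW => n /eqP.
    by apply: filterS (H _ _ ij).
  apply: filterS => n Hn i j E; apply/eqP/negPn/negP => ij.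
  by have := Hn (i, j) ij; rewrite /= E eqxx.
move=> ij.
have wij : w i - w j != 0.
  by rewrite subr_eq0; apply: contra ij => /eqP/wI->.
have [fij|fij] := eqVneq (f i) (f j).
  apply: nearW => n; rewrite -subr_eq0 fij opprD addrACA subrr add0r -mulrBl.
  by rewrite mulf_neq0// invr_neq0.
have cf : (f i - f j) + (w i - w j) * n.+1%:R^-1 @[n --> \oo] --> f i - f j.
  exact: cvg_perturbed.
have f0 : f i - f j != 0 by rewrite subr_eq0.
have : \forall n \near \oo, f i - f j + (w i - w j) * n.+1%:R^-1 != 0.
  exact: cvgr_neq0 cf f0.
apply: filterS => n; apply: contra => /eqP E; apply/eqP.
have -> : f i - f j + (w i - w j) * n.+1%:R^-1 =
  f i + w i * n.+1%:R^-1 - (f j + w j * n.+1%:R^-1) by ring.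
by rewrite E subrr.
Qed.

End perturbation.

Section simplex_volume.
Variable R : realType.

Lemma cvg_prod_seq (I : Type) (s : seq I) (F : I -> nat -> R) (l : I -> R) :
  (forall i, F i n @[n --> \oo] --> l i) ->
  \prod_(i <- s) F i n @[n --> \oo] --> \prod_(i <- s) l i.
Proof.
move=> Fl; elim: s => [|i s ih].
  by rewrite big_nil; under eq_fun do rewrite big_nil; exact: cvg_cst.
rewrite big_cons; under eq_fun do rewrite big_cons.
by apply: cvgM => //; exact: Fl.
Qed.

Lemma barycentre_perturbed k (v w : k.-tuple R) y z e u :
  barycentre [tuple tnth v j + tnth w j * e | j < k] (y + z * e) u =
  barycentre v y u + barycentre w z u * e.
Proof.
rewrite /barycentre (_ : \sum_j tnth [tuple _ | _ < _] j * _ =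
    \sum_j tnth v j * tnth u j + (\sum_j tnth w j * tnth u j) * e); last first.
  rewrite mulr_suml -big_split; apply: eq_bigr => j _.
  by rewrite tnth_mktuple /=; ring.
by ring.
Qed.

Lemma power_integral_prod k (v : k.-tuple R) z :
  (forall j, 0 < tnth v j) -> 0 < z ->
  k`!%:R * power_integral (- k.+1%:R) v z = (\prod_j tnth v j * z)^-1.
Proof.
move=> v0 z0.
(* The perturbation weights are the positions in [rcons v z], hence the weight [k] for [z] below. *)
pose w : k.-tuple R := [tuple j%:R | j < k].
pose e n : R := n.+1%:R^-1.
pose v_ n := [tuple tnth v j + tnth w j * e n | j < k].
pose z_ n := z + k%:R * e n.
have [m [M [m0 vM zM]]] := positive_bounds_rcons v0 z0.
have lhs : k`!%:R * power_integral (- k.+1%:R) (v_ n) (z_ n) @[n --> \oo] -->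
    k`!%:R * power_integral (- k.+1%:R) v z.
  apply: cvgMr; rewrite /power_integral.
  under eq_fun do under eq_Rintegral do rewrite barycentre_perturbed.
  apply: (@cvg_integral_perturbed_powR _ _ _ _ _ _ _ m M k%:R) => //.
  - exact: measurable_solid_simplex.
  - exact: lebesgue_solid_simplex_fin.
  - by apply: measurable_funTS; exact: measurable_barycentre.
  - by apply: measurable_funTS; exact: measurable_barycentre.
  - by move=> u; exact: barycentre_itv.
  - move=> u; apply: barycentre_itv; last by rewrite ler0n lexx.
    by move=> j; rewrite tnth_mktuple ler0n ler_nat ltnW.
have rhs : (\prod_j tnth (v_ n) j * z_ n)^-1 @[n --> \oo] -->
    (\prod_j tnth v j * z)^-1.
  apply: cvgV.
    by rewrite gt_eqF// mulr_gt0// prodr_gt0.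
  apply: cvgM; last exact: cvg_perturbed.
  under eq_fun do under eq_bigr do rewrite tnth_mktuple.
  by apply: cvg_prod_seq => j; exact: cvg_perturbed.
apply: (cvg_unique _ lhs) => //; apply: cvg_trans rhs.
apply: near_eq_cvg.
pose f (i : 'I_k.+1) := nth 0 (rcons v z) i.
have wI : injective (fun i : 'I_k.+1 => i%:R : R).
  by move=> i j /eqP; rewrite eqr_nat => /eqP; exact: val_inj.
have := perturbed_injective f wI; apply: filterS => n inj.
have e0 : 0 <= e n by rewrite invr_ge0.
rewrite power_integral_prod_uniq//.
- by move=> j; rewrite !tnth_mktuple ltr_wpDr// mulr_ge0.
- by rewrite ltr_wpDr// mulr_ge0.
rewrite (_ : rcons (v_ n) (z_ n) = map (fun i : 'I_k.+1 => f i + i%:R * e n) (enum 'I_k.+1)).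
  by rewrite map_inj_uniq ?enum_uniq.
apply: (@eq_from_nth _ 0) => [|i].
  by rewrite size_rcons size_tuple size_map size_enum_ord.
rewrite size_rcons size_tuple => ik.
rewrite (nth_map ord0) ?size_enum_ord//.
rewrite (_ : nth ord0 _ i = Ordinal ik); last first.
  by apply: val_inj; rewrite /= nth_enum_ord.
rewrite /f !nth_rcons !size_tuple.
case: (ltnP i k) => [ik'|ki]; rewrite -?[nat_of_ord (Ordinal ik)]/i.
  have nE (t : k.-tuple R) : nth 0 t i = tnth t (Ordinal ik').
    by rewrite (tnth_nth 0).
  by rewrite !nE !tnth_mktuple.
by have -> : i = k; [apply/eqP; rewrite eqn_leq ki -ltnS ik|rewrite eqxx].
Qed.

(** With all vertex values equal to 1 the integrand is 1, so the product formula reads k! times the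
    volume is 1. *)
Lemma volume_solid_simplex k :
  lebesgue_tuple R k (@solid_simplex R k) = (k`!%:R^-1)%:E.
Proof.
have mS : measurable (@solid_simplex R k) by exact: measurable_solid_simplex.
have fV : lebesgue_tuple R k (@solid_simplex R k) \is a fin_num.
  by rewrite ge0_fin_numE//; exact: lebesgue_solid_simplex_fin.
have v0 j : 0 < tnth [tuple 1 : R | _ < k] j by rewrite tnth_mktuple.
have := power_integral_prod v0 ltr01.
rewrite big1 => [|j _]; last by rewrite tnth_mktuple.
rewrite mul1r invr1.
rewrite /power_integral.
rewrite (@eq_Rintegral _ _ _ _ _ (cst 1)); last first.
  move=> u _; rewrite /barycentre.
  under eq_bigr do rewrite tnth_mktuple mul1r.
  by rewrite mulr1 addrC subrK powR1.
rewrite Rintegral_cst// mul1r => H.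
have k0 : (k`!%:R : R) != 0 by rewrite pnatr_eq0 -lt0n fact_gt0.
by rewrite -(fineK fV); congr _%:E; apply: (mulfI k0); rewrite divff.
Qed.

End simplex_volume.

(** * Uniform laws on faces and the first identity *)

Lemma ge0_integral_full_set d (T : measurableType d) (R : realType)
    (mu : {measure set T -> \bar R}) (D : set T) (f : T -> \bar R) :
  measurable D -> mu (~` D) = 0%E -> measurable_fun setT f ->
  (forall x, 0 <= f x)%E ->
  (\int[mu]_x f x = \int[mu]_(x in D) f x)%E.
Proof.
move=> mD D0 mf f0; rewrite -(setUv D) ge0_integral_setU//.
- rewrite [X in (_ + X)%E]null_set_integral ?adde0//; first exact: measurableC.
  exact: measurable_funTS.
- exact: measurableC.
- exact: measurable_funTS.
- by apply/disj_setPCl.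
Qed.

Section face_integral.
Variables (R : realType) (d : nat).
Implicit Types (T : {set 'I_d.+1}) (f : d.+1.-tuple R).

(** [face_map] gives the last vertex of [T] the remaining weight. The values of [f] on [T] are split
    in the same way, to become the arguments of [barycentre]. *)
Definition face_init T f : #|T|.-1.-tuple R :=
  [tuple tnth f (nth ord0 (enum T) j) | j < #|T|.-1].

Definition face_last T f : R := tnth f (nth ord0 (enum T) #|T|.-1).

Lemma rcons_face T f : T != finset.set0 ->
  rcons (face_init T f) (face_last T f) = [seq tnth f i | i <- enum T].
Proof.
rewrite -card_gt0 => T0; apply: (@eq_from_nth _ 0) => [|i].
  by rewrite size_rcons size_tuple size_map -cardE prednK.
rewrite size_rcons size_tuple prednK// => iT.
rewrite (nth_map ord0) -?cardE// nth_rcons size_tuple.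
case: ltnP => [iT'|]; last first.
  rewrite leq_eqVlt => /predU1P[<-|]; first by rewrite eqxx.
  by rewrite -ltnS prednK// ltnS leqNgt iT.
have -> : (face_init T f)`_i = tnth (face_init T f) (Ordinal iT').
  by rewrite (tnth_nth 0).
by rewrite tnth_mktuple.
Qed.

Lemma face_init_gt0 T f : (forall i, 0 < tnth f i) ->
  forall j, 0 < tnth (face_init T f) j.
Proof. by move=> f0 j; rewrite tnth_mktuple. Qed.

Lemma face_last_gt0 T f : (forall i, 0 < tnth f i) -> 0 < face_last T f.
Proof. by move=> f0; exact: f0. Qed.

Lemma dot_face_map T f u : T != finset.set0 ->
  dot f (@face_map R d T u) = barycentre (face_init T f) (face_last T f) u.
Proof.
rewrite -card_gt0 => T0; rewrite /dot.
under eq_bigr do rewrite tnth_mktuple.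
rewrite (bigID (mem T))/= [X in _ + X]big1 ?addr0; last first.
  by move=> i /negbTE ->; rewrite mulr0.
rewrite (eq_bigr (fun i => tnth f i *
    nth (1 - \sum_j tnth u j) u (index i (enum T)))); last by move=> i ->.
rewrite -big_enum /= (big_nth ord0) -cardE.
pose G i := tnth f (nth ord0 (enum T) i) *
  nth (1 - \sum_j tnth u j) u (index (nth ord0 (enum T) i) (enum T)).
rewrite -[LHS]/(\sum_(0 <= i < #|T|) G i).
rewrite [LHS](_ : _ = \sum_(0 <= i < #|T|.-1) G i + G #|T|.-1); last first.
  by rewrite -big_nat_recr//= prednK.
rewrite big_mkord /barycentre /G {G}.
congr (_ + _).
  apply: eq_bigr => j _; rewrite tnth_mktuple index_uniq ?enum_uniq//; last first.
    by rewrite -cardE (leq_trans (ltn_ord j))// leq_pred.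
  by congr (_ * _); rewrite [RHS](tnth_nth (1 - \sum_j tnth u j)).
rewrite index_uniq ?enum_uniq//; last by rewrite -cardE prednK.
by rewrite mulrC; congr (_ * _); rewrite nth_default ?size_tuple.
Qed.

Lemma dot1 (x : d.+1.-tuple R) :
  dot [tuple 1 | _ < d.+1] x = \sum_(i < d.+1) tnth x i.
Proof. by apply: eq_bigr => i _; rewrite tnth_mktuple mul1r. Qed.

Lemma face_map_simplex T u : T != finset.set0 -> @solid_simplex R _ u ->
  simplex R d (@face_map R d T u).
Proof.
move=> T0 us; have [u0 u1] := us; split; last first.
  rewrite -dot1 dot_face_map// /barycentre /face_last tnth_mktuple mulr1.
  under eq_bigr do rewrite tnth_mktuple tnth_mktuple mul1r.
  by rewrite addrC subrK.
move=> i; rewrite tnth_mktuple; case: ifPn => // iT.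
have [iu|iu] := ltnP (index i (enum T)) #|T|.-1.
  by have := u0 (Ordinal iu); rewrite (tnth_nth (1 - \sum_j tnth u j)).
by rewrite nth_default ?size_tuple// subr_ge0.
Qed.

Lemma integral_lambda T (F : d.+1.-tuple R -> \bar R) : T != finset.set0 ->
  measurable_fun setT F -> (forall x, 0 <= F x)%E ->
  (\int[lambda R T]_x F x = (#|T|.-1`!%:R)%:E *
   \int[lebesgue_tuple R #|T|.-1]_(u in @solid_simplex R #|T|.-1)
      F (@face_map R d T u))%E.
Proof.
move=> T0 mF F0.
set k := #|T|.-1.
have mS : measurable (@solid_simplex R k) by exact: measurable_solid_simplex.
have mFf : measurable_fun setT (F \o @face_map R d T).
  by apply: measurableT_comp => //; exact: measurable_face_map.
pose L : {measure set (k.-tuple R) -> \bar R} :=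
  mrestr (lebesgue_tuple R k) mS.
pose D : probability (k.-tuple R) R := \d_ ([tuple 0 | _ < k] : k.-tuple R).
have LT : L setT = (k`!%:R^-1)%:E.
  by rewrite /L /= /mrestr setTI volume_solid_simplex.
have PE A : mnormalize L D A = (L A * (k`!%:R)%:E)%E.
  rewrite /mnormalize LT /= invrK ifF//; apply/negbTE; rewrite negb_or andbT.
  by rewrite eqe invr_eq0 pnatr_eq0 -lt0n fact_gt0.
transitivity (\int[mnormalize L D]_u F (@face_map R d T u))%E.
  have := ge0_integral_pushforward (@measurable_face_map R d T)
    (mnormalize L D) measurableT mF (fun x _ => F0 x).
  by rewrite preimage_setT.
rewrite (@ge0_integral_full_set _ _ _ _ (@solid_simplex R k))//; last first.
  by apply: etrans (PE _) _; rewrite /L /= /mrestr setICl measure0 mul0e.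
have k0 : 0 <= (k`!%:R : R) by [].
rewrite (eq_measure_integral (mscale (NngNum k0) (lebesgue_tuple R k))); last first.
  move=> A mA AS; apply: etrans (PE _) _.
  by rewrite /L /= /mrestr /mscale muleC (setIidl AS).
by rewrite ge0_integral_mscale//; exact: measurable_funTS.
Qed.

End face_integral.

Lemma measure_full_set d (T : measurableType d) (R : realType)
    (mu : {measure set T -> \bar R}) (D A : set T) :
  measurable D -> mu (~` D) = 0%E -> measurable A -> mu A = mu (A `&` D).
Proof.
move=> mD D0 mA; apply: etrans (measureDI mu mA mD) _.
rewrite [X in (X + _)%E](_ : _ = 0%E) ?add0e//.
apply: (subset_measure0 _ _ _ D0); [exact: measurableD|exact: measurableC|].
by move=> x [].
Qed.

Section simplex_theory.
Variables (R : realType) (d : nat).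

Lemma measurable_simplex : measurable (simplex R d).
Proof.
rewrite (_ : simplex R d =
  (\bigcap_(i in [set: 'I_d.+1]) ((@tnth d.+1 R ^~ i) @^-1` `[0, +oo[%classic)) `&`
  ((fun x : d.+1.-tuple R => \sum_(i < d.+1) tnth x i) @^-1` [set 1])).
  apply: measurableI.
    apply: fin_bigcap_measurable => [|i _]; first exact: finite_finset.
    rewrite -[X in measurable X]setTI.
    by apply: measurable_tnth => //; exact: measurable_itv.
  rewrite -[X in measurable X]setTI.
  by apply: measurable_sum => // i; exact: measurable_tnth.
apply/seteqP; split=> x /= [x0 x1]; split => //.
  by move=> i _ /=; rewrite in_itv/= andbT.
by move=> i; have := x0 i I; rewrite /= in_itv/= andbT.
Qed.

Lemma measurable_dot (f : d.+1.-tuple R) : measurable_fun setT (dot f).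
Proof.
by apply: measurable_sum => j; apply: measurable_funM => //; exact: measurable_tnth.
Qed.

Lemma measurable_dot_powR (f : d.+1.-tuple R) p :
  measurable_fun setT (fun x => dot f x `^ p).
Proof.
by apply: (measurableT_comp (measurable_powR p)); exact: measurable_dot.
Qed.

Lemma dot_itv (f : d.+1.-tuple R) m M : (forall i, m <= tnth f i <= M) ->
  forall x, simplex R d x -> m <= dot f x <= M.
Proof.
move=> fm x [x0 x1]; rewrite /dot; apply/andP; split.
  rewrite -[leLHS]mulr1 -x1 mulr_sumr ler_sum// => i _.
  by rewrite ler_wpM2r//; case/andP: (fm i).
rewrite -[leRHS]mulr1 -x1 mulr_sumr ler_sum// => i _.
by rewrite ler_wpM2r//; case/andP: (fm i).
Qed.

Lemma dot_gt0 (f : d.+1.-tuple R) : (forall i, 0 < tnth f i) ->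
  forall x, simplex R d x -> 0 < dot f x.
Proof.
move=> /positive_bounds[m [M [m0 fM]]] x xS.
by have /andP[+ _] := dot_itv fM xS; exact: lt_le_trans.
Qed.

Lemma integrable_dot (mu : {measure set (d.+1.-tuple R) -> \bar R})
    (f : d.+1.-tuple R) (p : R) : (mu (simplex R d) < +oo)%E ->
  (forall i, 0 < tnth f i) ->
  mu.-integrable (simplex R d) (fun x => (dot f x `^ p)%:E).
Proof.
move=> muS /positive_bounds[m [M [m0 fM]]].
apply: (integrable_powR (m := m) (M := M)) => //; first exact: measurable_simplex.
  by apply: measurable_funTS; exact: measurable_dot.
exact: dot_itv.
Qed.

End simplex_theory.

Section lambda_theory.
Variables (R : realType) (d : nat).
Implicit Types (T : {set 'I_d.+1}) (f : d.+1.-tuple R).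

Lemma lambda_eq0 T (A : set (d.+1.-tuple R)) : T != finset.set0 ->
  measurable A -> (forall u, @solid_simplex R _ u -> ~ A (@face_map R d T u)) ->
  lambda R T A = 0%E.
Proof.
move=> T0 mA nA; rewrite -(setIT A) -integral_indic//.
have mF : measurable_fun setT (fun x : d.+1.-tuple R => (\1_A x : R)%:E).
  exact/measurable_EFinP/measurable_indic.
have F0 (x : d.+1.-tuple R) : (0 <= (\1_A x : R)%:E :> \bar R)%E by rewrite lee_fin.
rewrite (integral_lambda T0 mF F0).
rewrite integral0_eq ?mule0// => u us.
by rewrite indicE memNset//; exact: nA.
Qed.

Lemma lambda_simplexC T : T != finset.set0 -> lambda R T (~` simplex R d) = 0%E.
Proof.
move=> T0; apply: lambda_eq0 => //.
  by apply: measurableC; exact: measurable_simplex.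
by move=> u us; apply; exact: face_map_simplex.
Qed.

Lemma lambda_coord_notin T i : T != finset.set0 -> i \notin T ->
  lambda R T [set x | tnth x i != 0] = 0%E.
Proof.
move=> T0 iT; apply: lambda_eq0 => //.
  rewrite (_ : [set x | _] = (@tnth d.+1 R ^~ i) @^-1` (~` [set 0])).
    rewrite -[X in measurable X]setTI.
    by apply: measurable_tnth => //; exact: measurableC.
  by apply/seteqP; split => x /=; [move/eqP|move=> /eqP].
by move=> u _ /=; rewrite tnth_mktuple (negbTE iT) eqxx.
Qed.

Definition lambda_power T (p : R) f : R :=
  \int[lambda R T]_(x in simplex R d) (dot f x `^ p).

Lemma integral_lambda_power T p f : (forall i, 0 < tnth f i) ->
  (\int[lambda R T]_(x in simplex R d) (dot f x `^ p)%:E =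
   (lambda_power T p f)%:E)%E.
Proof.
move=> f0; rewrite /lambda_power /Rintegral fineK//.
apply: integrable_fin_num; first exact: measurable_simplex.
apply: integrable_dot => //; apply: le_lt_trans (ltry 1).
by apply: probability_le1; exact: measurable_simplex.
Qed.

Lemma lambda_powerE T p f : T != finset.set0 -> (forall i, 0 < tnth f i) ->
  lambda_power T p f =
  #|T|.-1`!%:R * power_integral p (face_init T f) (face_last T f).
Proof.
move=> T0 f0; apply: EFin_inj; rewrite -integral_lambda_power//.
rewrite integral_mkcond integral_lambda//; last 2 first.
- apply/(measurable_restrictT _ _).1; first exact: measurable_simplex.
  by apply: measurable_funTS; apply/measurable_EFinP; exact: measurable_dot_powR.
- by move=> x; apply: erestrict_ge0 => y _; rewrite lee_fin powR_ge0.
rewrite EFinM; congr (_ * _)%E.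
rewrite /power_integral /Rintegral fineK; last first.
  apply: integrable_fin_num; first exact: measurable_solid_simplex.
  by apply: integrable_barycentre; [exact: face_init_gt0|exact: face_last_gt0].
apply: eq_integral => u /[!inE] us.
by rewrite patchE mem_set ?dot_face_map//; exact: face_map_simplex.
Qed.

Lemma prod_face T f (F : R -> R) : T != finset.set0 ->
  \prod_j F (tnth (face_init T f) j) * F (face_last T f) =
  \prod_(i in T) F (tnth f i).
Proof.
move=> T0; rewrite -[RHS]big_enum /=.
transitivity (\prod_(x <- [seq tnth f i | i <- enum T]) F x); last exact: big_map.
rewrite -rcons_face// big_rcons /=; congr (_ * _).
by rewrite -(big_tuple _ _ (face_init T f) xpredT F).
Qed.

Lemma lambda_power_prod T f : T != finset.set0 -> (forall i, 0 < tnth f i) ->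
  lambda_power T (- #|T|%:R) f = (\prod_(i in T) tnth f i)^-1.
Proof.
move=> T0 f0; rewrite lambda_powerE// -(prod_face _ id)//.
rewrite -power_integral_prod; last 2 first.
- exact: face_init_gt0.
- exact: face_last_gt0.
by rewrite prednK// card_gt0.
Qed.

Lemma lambda_power_divided_difference T p f : T != finset.set0 ->
  (forall i, 0 < tnth f i) -> injective (tnth f) ->
  \prod_(j < #|T|.-1) (p - j%:R) * lambda_power T (p - #|T|.-1%:R) f =
  #|T|.-1`!%:R *
  \sum_(i in T) tnth f i `^ p / \prod_(j in T | j != i) (tnth f i - tnth f j).
Proof.
move=> T0 f0 fI; rewrite lambda_powerE// mulrCA; congr (_ * _).
rewrite power_integral_divided_difference; last 3 first.
- exact: face_init_gt0.
- exact: face_last_gt0.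
- by rewrite rcons_face// map_inj_uniq// enum_uniq.
rewrite rcons_face// /divided_difference big_map big_enum /=.
apply: eq_bigr => i _; congr (_ / _).
rewrite big_map big_enum_cond /=; apply: eq_bigl => j.
by rewrite (inj_eq fI).
Qed.

(* With f_i = n + 1 and f_j = 1 elsewhere, <f, x> = 1 where x_i = 0, so that the
   mass of this set is at most the integral 1 / (n + 1) of <f, x>^(- #|T|). *)
Lemma lambda_coord_in T i : i \in T -> lambda R T [set x | tnth x i = 0] = 0%E.
Proof.
move=> iT; have T0 : T != finset.set0 by apply/set0Pn; exists i.
pose Z : set (d.+1.-tuple R) := [set x | tnth x i = 0].
rewrite -/Z; have mi : measurable Z.
  rewrite (_ : Z = (@tnth d.+1 R ^~ i) @^-1` [set 0])//.
  by rewrite -[X in measurable X]setTI; exact: measurable_tnth.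
have mA : measurable (Z `&` simplex R d).
  by apply: measurableI => //; exact: measurable_simplex.
have bound n : (lambda R T Z <= (n.+1%:R^-1)%:E)%E.
  pose f : d.+1.-tuple R := [tuple if j == i then n.+1%:R else 1 | j < d.+1].
  have f0 j : 0 < tnth f j by rewrite tnth_mktuple; case: ifP.
  have -> : (n.+1%:R^-1)%:E =
      (\int[lambda R T]_(x in simplex R d) (dot f x `^ (- #|T|%:R))%:E)%E.
    rewrite integral_lambda_power// lambda_power_prod// (bigD1 i)//=.
    rewrite tnth_mktuple eqxx big1 ?mulr1// => j /andP[_ /negbTE ji].
    by rewrite tnth_mktuple ji.
  have -> : lambda R T Z =
      lambda R T (Z `&` simplex R d).
    apply: measure_full_set => //; first exact: measurable_simplex.
    exact: lambda_simplexC.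
  rewrite -[leLHS]mul1e -integral_cst//.
  apply: (@le_trans _ _ (\int[lambda R T]_(x in Z `&` simplex R d)
     (dot f x `^ (- #|T|%:R))%:E)%E).
    rewrite le_eqVlt; apply/orP; left; apply/eqP; apply: eq_integral => x.
    rewrite inE => -[/= xi xS]; congr _%:E.
    rewrite (_ : dot f x = 1) ?powR1//; have [_ <-] := xS.
    apply: eq_bigr => j _; rewrite tnth_mktuple; case: eqP => [->|]; last by rewrite mul1r.
    by rewrite xi mulr0.
  apply: ge0_subset_integral => //; first exact: measurable_simplex.
    apply: measurable_funTS; apply/measurable_EFinP; exact: measurable_dot_powR.
  by move=> x _; rewrite lee_fin powR_ge0.
apply/eqP; rewrite eq_le measure_ge0 andbT; apply/lee_addgt0Pr => e e0.
rewrite add0e; have [n ne] := ltr_add_invr e0.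
by apply: le_trans (bound n) _; rewrite lee_fin ltW// -[ltLHS]add0r.
Qed.

End lambda_theory.

Section face_sum.
Variables (R : realType) (d : nat).
Implicit Types (T : {set 'I_d.+1}) (f : d.+1.-tuple R).

(** The coefficient (c-1)...(c-k)/k!, with k = #|T| - 1, that a face has in [nu] up to a factor
    common to all faces: the (k+1)! and (d-k)! of [nu] cancel those of [Lambda]. *)
Definition face_weight (c : R) T : R :=
  \prod_(1 <= j < #|T|) (c - j%:R) / #|T|.-1`!%:R.

(** Reversing the order, the factor of index k - 1 - j is -(c - (j + 1)). *)
Lemma prod_falling (c : R) k :
  \prod_(j < k) (k%:R - c - j%:R) =
  (-1) ^+ k * \prod_(1 <= j < k.+1) (c - j%:R).
Proof.
rewrite (reindex_inj rev_ord_inj) /= big_add1 /= big_mkord.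
rewrite -[k in (-1) ^+ k]card_ord -prodr_const -big_split /=.
apply: eq_bigr => j _; rewrite natrB//; by rewrite -natr1; ring.
Qed.

Lemma prod_rising (c : R) k :
  \prod_(j < k) (- c - 1 - j%:R) =
  (-1) ^+ k * \prod_(1 <= j < k.+1) (c + j%:R).
Proof.
rewrite big_add1 /= big_mkord.
rewrite -[k in (-1) ^+ k]card_ord -prodr_const -big_split /=.
by apply: eq_bigr => j _; rewrite -natr1; ring.
Qed.

Lemma card_neq_in T i : i \in T -> #|[pred j in T | j != i]| = #|T|.-1.
Proof.
move=> iT; rewrite (cardsD1 i T) iT /= -[RHS]cardsE; apply: eq_card => j.
by rewrite !inE andbC.
Qed.

Lemma fact_neq0 n : (n`!%:R : R) != 0.
Proof. by rewrite pnatr_eq0 -lt0n fact_gt0. Qed.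

(** This is the divided difference of t^(k-c), whose k-th derivative is a multiple of t^-c. The k
    spare factors f_i go one to each denominator. The sign (-1)^k of the falling product cancels the
    one from turning f_i - f_j into f_j - f_i. *)
Lemma face_weight_lambda_power c T f : T != finset.set0 ->
  (forall i, 0 < tnth f i) -> injective (tnth f) ->
  face_weight c T * lambda_power T (- c) f =
  \sum_(i in T) tnth f i `^ (- c) *
    \prod_(j in T | j != i) (tnth f i / (tnth f j - tnth f i)).
Proof.
move=> T0 f0 fI; have cT : (0 < #|T|)%N by rewrite card_gt0.
set k := #|T|.-1; pose e : R := (-1) ^+ k.
have ee : e * e = 1 by rewrite -expr2 sqrr_sign.
have eV : e^-1 = e by rewrite -exprVn invrN invr1.
have := lambda_power_divided_difference (k%:R - c) T0 f0 fI.
rewrite -/k prod_falling -/e (_ : k%:R - c - k%:R = - c); last by ring.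
set S := \sum_(i in T) _ => E.
have -> : face_weight c T * lambda_power T (- c) f = e * S.
  rewrite -[LHS]mul1r -[X in X * _ = _]ee /face_weight -/k -[in X in X / _](prednK cT) -/k.
  have K0 := fact_neq0 k.
  transitivity (e * k`!%:R^-1 *
    (e * \prod_(1 <= j < k.+1) (c - j%:R) * lambda_power T (- c) f)).
    by field.
  by rewrite E; field.
rewrite mulr_sumr; apply: eq_bigr => i iT.
rewrite prodf_div prodr_const card_neq_in// -/k.
rewrite (_ : \prod_(j in T | j != i) (tnth f j - tnth f i) =
    e * \prod_(j in T | j != i) (tnth f i - tnth f j)); last first.
  rewrite /e /k -(card_neq_in iT) -prodr_const -big_split /=.
  by apply: eq_bigr => j _; ring.
rewrite addrC powRD; last by apply/implyP => _; rewrite gt_eqF.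
by rewrite powR_mulrn ?ltW// invfM eV; ring.
Qed.

Lemma sum_face_prod i (g : 'I_d.+1 -> R) :
  \sum_(T : {set 'I_d.+1} | i \in T) \prod_(j in T | j != i) g j =
  \prod_(j | j != i) (1 + g j).
Proof.
(* In the expansion of prod_j (F j + G j) over subsets, [G i] = 0 keeps only those containing [i],
   and [F i] = 1 lets [i] contribute no factor. *)
pose F j := if j == i then 1 else g j.
pose G j : R := if j == i then 0 else 1.
transitivity (\prod_j (F j + G j)).
  rewrite bigA_distr [RHS](bigID (fun T : {set 'I_d.+1} => i \in T)) /=.
  rewrite [X in _ = _ + X]big1 ?addr0; last first.
    by move=> T iT; rewrite (bigD1 i) //= (negbTE iT) /G eqxx mul0r.
  apply: eq_bigr => T iT.
  rewrite [RHS](bigID (mem T)) /= [X in _ * X]big1 ?mulr1; last first.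
    by move=> j /[dup] jT /negbTE ->; rewrite /G; case: eqP jT => // ->; rewrite iT.
  rewrite [RHS](bigID (pred1 i)) /= [X in X * _]big1 ?mul1r; last first.
    by move=> j /andP[-> /eqP ->]; rewrite /F eqxx.
  by apply: eq_bigr => j /andP[-> /negbTE ji]; rewrite /F ji.
rewrite (bigD1 i) //= /F /G eqxx addr0 mul1r.
by apply: eq_bigr => j /negbTE ->; rewrite addrC.
Qed.

(** The divided difference of t^(-c-1): its d-th derivative has exponent -(c+d+1) and coefficient
    (-1)^d (c+1)...(c+d), the sign being absorbed by the d reversed differences. *)
Lemma lambda_power_setT c f : (forall i, 0 < tnth f i) -> injective (tnth f) ->
  \prod_(1 <= j < d.+1) (c + j%:R) / d`!%:R *
    lambda_power [set: 'I_d.+1]%SET (- (c + d%:R + 1)) f =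
  \sum_i tnth f i `^ (- c - 1) * \prod_(j | j != i) (tnth f j - tnth f i)^-1.
Proof.
move=> f0 fI; set T := [set: 'I_d.+1]%SET.
have cT : #|T| = d.+1 by rewrite cardsT card_ord.
have T0 : T != finset.set0 by rewrite -card_gt0 cT.
pose e : R := (-1) ^+ d.
have ee : e * e = 1 by rewrite -expr2 sqrr_sign.
have eV : e^-1 = e by rewrite -exprVn invrN invr1.
have := lambda_power_divided_difference (- c - 1) T0 f0 fI.
rewrite cT /= prod_rising -/e (_ : - c - 1 - d%:R = - (c + d%:R + 1)); last by ring.
set S := \sum_(i in T) _ => E.
transitivity (e * S).
  rewrite -[LHS]mul1r -[X in X * _ = _]ee; have K0 := fact_neq0 d.
  transitivity (e * d`!%:R^-1 * (e * \prod_(1 <= j < d.+1) (c + j%:R) *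
      lambda_power T (- (c + d%:R + 1)) f)).
    by field.
  by rewrite E; field.
rewrite /S mulr_sumr [LHS](eq_bigl xpredT); last by move=> i; rewrite /T inE.
apply: eq_bigr => i _.
rewrite prodfV (_ : \prod_(j in T | j != i) (tnth f i - tnth f j) =
    e * \prod_(j | j != i) (tnth f j - tnth f i)).
  by rewrite invfM eV mulrCA (mulrCA e) (mulrA e) ee mul1r.
have card_i : #|[pred j in T | j != i]| = d by rewrite card_neq_in ?cT// /T inE.
rewrite [in RHS](eq_bigl (fun j => (j \in T) && (j != i))); last first.
  by move=> j; rewrite /T inE.
rewrite /e -[X in _ ^+ X]card_i -prodr_const -big_split /=.
by apply: eq_bigr => j _; ring.
Qed.

(* Exchanging the sums over faces and over their vertices i leaves
   prod_(j != i) (1 + f_i / (f_j - f_i)) = prod_(j != i) f_j / (f_j - f_i). *)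
Lemma face_sum_injective c f : (forall i, 0 < tnth f i) -> injective (tnth f) ->
  \sum_(T : {set 'I_d.+1} | T != finset.set0)
    face_weight c T * lambda_power T (- c) f =
  \prod_i tnth f i * (\prod_(1 <= j < d.+1) (c + j%:R) / d`!%:R *
    lambda_power [set: 'I_d.+1]%SET (- (c + d%:R + 1)) f).
Proof.
move=> f0 fI; rewrite lambda_power_setT// mulr_sumr.
rewrite (eq_bigr _ (fun (T : {set 'I_d.+1}) (T0 : T != finset.set0) =>
  face_weight_lambda_power c T0 f0 fI)).
rewrite (exchange_big_dep xpredT) //=; apply: eq_bigr => i _.
rewrite -mulr_sumr (eq_bigl (fun T : {set 'I_d.+1} => i \in T)); last first.
  by move=> T; apply: andb_idl => iT; apply/set0Pn; exists i.
rewrite sum_face_prod [X in _ = X * _](bigD1 i) //=.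
have -> : tnth f i `^ (- c) = tnth f i * tnth f i `^ (- c - 1).
  rewrite powRD; last by apply/implyP => _; rewrite gt_eqF.
  by rewrite powR_inv1 ?ltW// mulrCA divff ?mulr1// gt_eqF.
rewrite (_ : \prod_(j | j != i) (1 + _) = \prod_(j | j != i) tnth f j *
    \prod_(j | j != i) (tnth f j - tnth f i)^-1); first by ring.
rewrite -big_split /=; apply: eq_bigr => j ji.
have : tnth f j - tnth f i != 0.
  by rewrite subr_eq0; apply: contra ji => /eqP/fI ->.
by move=> ?; field.
Qed.

Lemma cvg_sum_seq (I : Type) (s : seq I) (P : pred I) (F : I -> nat -> R) (l : I -> R) :
  (forall i, P i -> F i n @[n --> \oo] --> l i) ->
  \sum_(i <- s | P i) F i n @[n --> \oo] --> \sum_(i <- s | P i) l i.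
Proof.
move=> Fl; elim: s => [|i s ih].
  by rewrite big_nil; under eq_fun do rewrite big_nil; exact: cvg_cst.
rewrite big_cons; under eq_fun do rewrite big_cons.
by case: ifPn => // Pi; apply: cvgD => //; exact: Fl.
Qed.

Lemma dot_perturbed f (w : d.+1.-tuple R) e x :
  dot [tuple tnth f i + tnth w i * e | i < d.+1] x = dot f x + dot w x * e.
Proof.
rewrite /dot mulr_suml -big_split; apply: eq_bigr => j _.
by rewrite tnth_mktuple /=; ring.
Qed.

Lemma cvg_lambda_power T p f (w : d.+1.-tuple R) :
  (forall i, 0 < tnth f i) -> (forall i, 0 <= tnth w i) ->
  lambda_power T p [tuple tnth f i + tnth w i * n.+1%:R^-1 | i < d.+1]
    @[n --> \oo] --> lambda_power T p f.
Proof.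
move=> f0 w0; have [m [M [m0 fM]]] := positive_bounds f0.
rewrite /lambda_power; under eq_fun do under eq_Rintegral do rewrite dot_perturbed.
apply: (@cvg_integral_perturbed_powR _ _ _ _ _ _ _ m M (\sum_i tnth w i)) => //.
- exact: measurable_simplex.
- apply: le_lt_trans (ltry 1).
  by apply: probability_le1; exact: measurable_simplex.
- by apply: measurable_funTS; exact: measurable_dot.
- by apply: measurable_funTS; exact: measurable_dot.
- exact: dot_itv.
- apply: dot_itv => i; rewrite w0 /= (bigD1 i) //= lerDl.
  by apply: sumr_ge0 => j _; exact: w0.
Qed.

Lemma face_sum c f : (forall i, 0 < tnth f i) ->
  \sum_(T : {set 'I_d.+1} | T != finset.set0)
    face_weight c T * lambda_power T (- c) f =
  \prod_i tnth f i * (\prod_(1 <= j < d.+1) (c + j%:R) / d`!%:R *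
    lambda_power [set: 'I_d.+1]%SET (- (c + d%:R + 1)) f).
Proof.
move=> f0; pose w : d.+1.-tuple R := [tuple i%:R | i < d.+1].
have w0 i : 0 <= tnth w i by rewrite tnth_mktuple.
pose f_ n := [tuple tnth f i + tnth w i * n.+1%:R^-1 | i < d.+1].
have lhs : \sum_(T : {set 'I_d.+1} | T != finset.set0)
    face_weight c T * lambda_power T (- c) (f_ n) @[n --> \oo] -->
  \sum_(T : {set 'I_d.+1} | T != finset.set0)
    face_weight c T * lambda_power T (- c) f.
  by apply: cvg_sum_seq => T _; apply: cvgMr; exact: cvg_lambda_power.
have rhs : \prod_i tnth (f_ n) i * (\prod_(1 <= j < d.+1) (c + j%:R) / d`!%:R *
    lambda_power [set: 'I_d.+1]%SET (- (c + d%:R + 1)) (f_ n)) @[n --> \oo] -->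
  \prod_i tnth f i * (\prod_(1 <= j < d.+1) (c + j%:R) / d`!%:R *
    lambda_power [set: 'I_d.+1]%SET (- (c + d%:R + 1)) f).
  apply: cvgM; last by apply: cvgMr; exact: cvg_lambda_power.
  under eq_fun do under eq_bigr do rewrite tnth_mktuple.
  by apply: cvg_prod_seq => i; exact: cvg_perturbed.
apply: (cvg_unique _ lhs) => //; apply: cvg_trans rhs.
apply: near_eq_cvg.
have wI : injective (tnth w).
  move=> i j; rewrite !tnth_mktuple => /eqP; rewrite eqr_nat => /eqP.
  exact: val_inj.
have := perturbed_injective (tnth f) wI; apply: filterS => n inj.
rewrite face_sum_injective//.
- by move=> i; rewrite tnth_mktuple ltr_wpDr// mulr_ge0.
- by move=> i j; rewrite !(tnth_mktuple (fun i => tnth f i + tnth w i * _)); exact: inj.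
Qed.

End face_sum.

(** * Signed combinations of measures and the first identity *)

Section measure_combination.
Context d (T : measurableType d) (R : realType).
Local Open Scope ereal_scope.

Lemma weighted_measure (I : Type) (s : seq I) (w : I -> R)
    (m : I -> {measure set T -> \bar R}) : (forall i, (0 <= w i)%R) ->
  exists mu : {measure set T -> \bar R},
    (forall A, mu A = \sum_(i <- s) (w i)%:E * m i A) /\
    (forall D F, measurable D -> measurable_fun D F ->
      (forall x, D x -> 0 <= F x) ->
      \int[mu]_(x in D) F x = \sum_(i <- s) (w i)%:E * \int[m i]_(x in D) F x).
Proof.
move=> w0; elim: s => [|i s [mu [muE muI]]].
  exists mzero; split=> [A|D F mD mF F0]; first by rewrite big_nil.
  by rewrite integral_measure_zero big_nil.
exists (measure_add (mscale (NngNum (w0 i)) (m i)) mu); split=> [A|D F mD mF F0].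
  by apply: etrans (measure_addE _ _ _) _; rewrite big_cons muE.
by rewrite ge0_integral_measure_add// ge0_integral_mscale// big_cons muI.
Qed.

(** If p and n are the Jordan parts, p - n = m1 - m2 says that p + m2 and m1 + n are the same
    measure. Their integrals agree, and can be rearranged because all four are finite. So any way of
    writing the charge as a difference computes its integral. *)
Lemma integral_jordan_difference (nu : {charge set T -> \bar R})
    (m1 m2 : {measure set T -> \bar R}) (D : set T) (F : T -> R) (M : R) :
  m1 setT < +oo -> m2 setT < +oo ->
  (forall A, measurable A -> nu A = m1 A - m2 A) ->
  measurable D -> measurable_fun D F -> (forall x, D x -> (0 <= F x <= M)%R) ->
  charge_integral nu D (EFin \o F) =
  \int[m1]_(x in D) (F x)%:E - \int[m2]_(x in D) (F x)%:E.
Proof.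
move=> m1oo m2oo nuE mD mF FM; rewrite /charge_integral.
set hP := cid _; set hN := cid _.
set p := jordan_pos _; set n := jordan_neg _.
have F0 x : D x -> 0 <= (F x)%:E by move=> /FM/andP[? _]; rewrite lee_fin.
have fin (m : {measure set T -> \bar R}) : m setT < +oo ->
    \int[m]_(x in D) (F x)%:E \is a fin_num.
  move=> moo; apply: integrable_fin_num => //.
  apply: (integrable_bounded (M := M)) => //.
    by apply: le_lt_trans moo; apply: le_measure; rewrite ?inE.
  by move=> x /FM/andP[F0' FM']; rewrite ger0_norm.
have finA (m : {measure set T -> \bar R}) A : m setT < +oo -> measurable A ->
    m A \is a fin_num.
  move=> moo mA; rewrite ge0_fin_numE//; apply: le_lt_trans moo.
  by apply: le_measure; rewrite ?inE.
have poo : p setT < +oo by rewrite ltey_eq fin_num_measure.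
have noo : n setT < +oo by rewrite ltey_eq fin_num_measure.
have E A : measurable A -> measure_add p m2 A = measure_add m1 n A.
  move=> mA.
  suff H : p A + m2 A = m1 A + n A.
    apply: etrans (measure_addE _ _ _) _; apply: etrans H _.
    exact/esym/measure_addE.
  have J : nu A = p A - n A.
    by rewrite (jordan_decomp (projT2 hN) mA) /cadd/= cscaleN1.
  have := nuE _ mA; rewrite J.
  have fp : p A \is a fin_num := finA p A poo mA.
  have fn : n A \is a fin_num := finA n A noo mA.
  have f1 : m1 A \is a fin_num := finA m1 A m1oo mA.
  have f2 : m2 A \is a fin_num := finA m2 A m2oo mA.
  rewrite -(fineK fp) -(fineK fn) -(fineK f1) -(fineK f2).
  rewrite -!EFinD => -[H].
  by congr _%:E; lra.
have : \int[measure_add p m2]_(x in D) (F x)%:E =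
       \int[measure_add m1 n]_(x in D) (F x)%:E.
  by apply: eq_measure_integral => A mA _; exact: E.
rewrite !ge0_integral_measure_add//; try exact/measurable_EFinP.
have fp : \int[p]_(x in D) (F x)%:E \is a fin_num := fin p poo.
have fn : \int[n]_(x in D) (F x)%:E \is a fin_num := fin n noo.
have f1 : \int[m1]_(x in D) (F x)%:E \is a fin_num := fin m1 m1oo.
have f2 : \int[m2]_(x in D) (F x)%:E \is a fin_num := fin m2 m2oo.
rewrite -(fineK fp) -(fineK fn) -(fineK f1) -(fineK f2) -!EFinD => -[H].
by congr _%:E; lra.
Qed.

End measure_combination.

Section nu_theory.
Variables (R : realType) (d : nat).
Implicit Types (T : {set 'I_d.+1}).

Definition nu_weight (c : R) T : R :=
  d`!%:R / \prod_(1 <= j < d.+1) (c + j%:R) * face_weight c T.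

Lemma sum_faces_card (G : {set 'I_d.+1} -> R) :
  \sum_(T : {set 'I_d.+1} | T != finset.set0) G T =
  \sum_(k < d.+1) \sum_(T : {set 'I_d.+1} | #|T| == k.+1) G T.
Proof.
rewrite (partition_big (fun T : {set 'I_d.+1} => inord #|T|.-1 : 'I_d.+1) xpredT)//=.
apply: eq_bigr => k _; apply: eq_bigl => T.
rewrite -card_gt0; have [T0|] := ltnP 0 #|T|; last first.
  by rewrite leqn0 => /eqP ->.
have Td : (#|T|.-1 < d.+1)%N.
  by rewrite prednK// (leq_trans (max_card _))// card_ord.
by rewrite -val_eqE /= inordK// -(eqn_add2r 1) !addn1 prednK.
Qed.

Lemma nuE (c : R) A : measurable A ->
  nu d c A = (\sum_(T : {set 'I_d.+1} | T != finset.set0)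
    (nu_weight c T)%:E * lambda R T A)%E.
Proof.
move=> mA; pose l T := fine (lambda R T A).
have lE T : lambda R T A = (l T)%:E by rewrite fineK// fin_num_measure.
have LE k : Lambda R d k A = ((k.+1`!%:R * (d - k)`!%:R / d.+1`!%:R) *
    \sum_(T : {set 'I_d.+1} | #|T| == k.+1) l T)%:E.
  rewrite /Lambda (eq_bigr (fun T => (l T)%:E)); last by move=> T _; exact: lE.
  by rewrite sumEFin -EFinM.
rewrite [RHS](eq_bigr (fun T => (nu_weight c T * l T)%:E)); last first.
  by move=> T _; rewrite lE -EFinM.
rewrite /nu [X in (_ * X)%E](eq_bigr (fun k : 'I_d.+1 =>
  (\prod_(1 <= j < k.+1) (c - j%:R) / (k`!%:R * k.+1`!%:R * (d - k)`!%:R) *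
   (k.+1`!%:R * (d - k)`!%:R / d.+1`!%:R *
     \sum_(T : {set 'I_d.+1} | #|T| == k.+1) l T))%:E)); last first.
  by move=> k _; rewrite LE -EFinM.
rewrite !sumEFin -EFinM sum_faces_card; congr _%:E.
rewrite mulr_sumr; apply: eq_bigr => k _; rewrite !mulr_sumr.
apply: eq_bigr => T /eqP Tk; rewrite /nu_weight /face_weight Tk /=.
have := fact_neq0 R k; have := fact_neq0 R k.+1; have := fact_neq0 R (d - k).
have := fact_neq0 R d.+1 => h1 h2 h3 h4.
rewrite invfM !mulrA; set P := (\prod_(_ <= _ < d.+1) _)^-1.
by field; rewrite h1 h2 h3 h4.
Qed.

Lemma LambdaE A : Lambda R d d A = lambda R [set: 'I_d.+1]%SET A.
Proof.
rewrite /Lambda subnn fact0 mulr1 divff ?fact_neq0// mul1e.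
rewrite (big_pred1 [set: 'I_d.+1]%SET)// => T.
rewrite /= eqEcard finset.subsetT cardsT card_ord /= eqn_leq.
by rewrite -[X in (_ <= X)%N && _](card_ord d.+1) max_card.
Qed.

Lemma nu_weight_prod c : 0 < c ->
  d`!%:R / \prod_(1 <= j < d.+1) (c + j%:R) *
    (\prod_(1 <= j < d.+1) (c + j%:R) / d`!%:R) = 1 :> R.
Proof.
move=> c0; have P0 : \prod_(1 <= j < d.+1) (c + j%:R) != 0 :> R.
  rewrite prodf_seq_neq0; apply/allP => j _ /=.
  by rewrite gt_eqF// ltr_wpDr.
by have K0 := fact_neq0 R d; field; rewrite P0 K0.
Qed.

(** Positive and negative parts are taken weight by weight, which leaves two nonnegative
    combinations of face laws. *)
Lemma nu_decomposition (c : R) : exists m1 m2 : {measure set (d.+1.-tuple R) -> \bar R},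
  [/\ (m1 setT < +oo)%E, (m2 setT < +oo)%E,
     (m1 (~` simplex R d) = 0)%E, (m2 (~` simplex R d) = 0)%E &
     (forall A, measurable A -> nu d c A = m1 A - m2 A)%E /\
     forall f, (forall i, 0 < tnth f i) ->
       (\int[m1]_(x in simplex R d) (dot f x `^ (- c))%:E -
        \int[m2]_(x in simplex R d) (dot f x `^ (- c))%:E =
        (\sum_(T : {set 'I_d.+1} | T != finset.set0)
           nu_weight c T * lambda_power T (- c) f)%:E)%E].
Proof.
pose s := [seq T <- index_enum {set 'I_d.+1} | T != finset.set0].
pose w1 (T : {set 'I_d.+1}) := Num.max (nu_weight c T) 0.
pose w2 (T : {set 'I_d.+1}) := Num.max (- nu_weight c T) 0.
have w1_ge0 T : 0 <= w1 T by rewrite le_max lexx orbT.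
have w2_ge0 T : 0 <= w2 T by rewrite le_max lexx orbT.
have w12 T : w1 T - w2 T = nu_weight c T.
  rewrite /w1 /w2; have [h|h] := leP 0 (nu_weight c T).
    by rewrite max_r ?oppr_le0// subr0.
  by rewrite max_l ?oppr_ge0 ?ltW// opprK add0r.
have [m1 [m1E m1I]] := weighted_measure s (fun T => lambda R T) w1_ge0.
have [m2 [m2E m2I]] := weighted_measure s (fun T => lambda R T) w2_ge0.
have fin (w : {set 'I_d.+1} -> R) A : measurable A ->
    (\sum_(T <- s) (w T)%:E * lambda R T A =
     (\sum_(T <- s) w T * fine (lambda R T A))%:E)%E.
  move=> mA; rewrite -sumEFin; apply: eq_bigr => T _.
  by rewrite EFinM fineK// fin_num_measure.
have mSC : measurable (~` simplex R d).
  by apply: measurableC; exact: measurable_simplex.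
have zero (w : {set 'I_d.+1} -> R) :
    (\sum_(T <- s) (w T)%:E * lambda R T (~` simplex R d) = 0)%E.
  rewrite big_seq big1// => T; rewrite mem_filter => /andP[T0 _].
  by rewrite lambda_simplexC ?mule0.
exists m1, m2; split.
- by rewrite m1E fin// ltry.
- by rewrite m2E fin// ltry.
- by rewrite m1E zero.
- by rewrite m2E zero.
split=> [A mA|f f0].
  rewrite m1E m2E nuE// !fin// -EFinB -sumrB big_filter -sumEFin.
  apply: eq_bigr => T _; rewrite -mulrBl w12 [RHS]EFinM; congr (_ * _)%E.
  by apply/esym/fineK; exact: fin_num_measure.
have mF : measurable_fun (simplex R d) (fun x => (dot f x `^ (- c))%:E).
  by apply: measurable_funTS; apply/measurable_EFinP; exact: measurable_dot_powR.
have F0 x : simplex R d x -> (0 <= (dot f x `^ (- c))%:E)%E.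
  by move=> _; rewrite lee_fin powR_ge0.
have mS := @measurable_simplex R d.
rewrite m1I// m2I//.
under eq_bigr do rewrite integral_lambda_power// -EFinM.
under [X in (_ - X)%E]eq_bigr do rewrite integral_lambda_power// -EFinM.
rewrite !sumEFin -EFinB -sumrB big_filter; congr _%:E.
by apply: eq_bigr => T _; rewrite -mulrBl w12.
Qed.

Lemma integral_Lambda (F : d.+1.-tuple R -> \bar R) D :
  (\int[Lambda R d d]_(x in D) F x =
   \int[lambda R [set: 'I_d.+1]%SET]_(x in D) F x)%E.
Proof. by apply: eq_measure_integral => A _ _; exact: LambdaE. Qed.

Lemma sum_nu_weight c f : 0 < c -> (forall i, 0 < tnth f i) ->
  \sum_(T : {set 'I_d.+1} | T != finset.set0)
    nu_weight c T * lambda_power T (- c) f =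
  \prod_i tnth f i * lambda_power [set: 'I_d.+1]%SET (- (c + d%:R + 1)) f.
Proof.
move=> c0 f0; transitivity (d`!%:R / \prod_(1 <= j < d.+1) (c + j%:R) *
    \sum_(T : {set 'I_d.+1} | T != finset.set0)
      face_weight c T * lambda_power T (- c) f).
  by rewrite mulr_sumr; apply: eq_bigr => T _; rewrite mulrA.
rewrite face_sum// mulrCA; congr (_ * _).
by rewrite mulrA nu_weight_prod// mul1r.
Qed.

Lemma charge_integral_nu c f : 0 < c -> (forall i, 0 < tnth f i) ->
  charge_integral (nu d c) (simplex R d) (fun x => ((dot f x `^ c)^-1)%:E) =
  ((\prod_(i < d.+1) tnth f i)%:E *
    \int[Lambda R d d]_(x in simplex R d)
        ((dot f x `^ (c + d%:R + 1))^-1)%:E)%E.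
Proof.
move=> c0 f0.
have [m1 [m2 [m1oo m2oo _ _ [nuE' I12]]]] := nu_decomposition c.
have [m [M [m0 fM]]] := positive_bounds f0.
under [X in charge_integral _ _ X]eq_fun do rewrite -powRN.
have H := @integral_jordan_difference _ _ _ (nu d c) m1 m2 (simplex R d)
  (fun x => dot f x `^ (- c)) (m `^ (- c) + M `^ (- c)) m1oo m2oo nuE'.
apply: etrans (H _ _ _) _.
- exact: measurable_simplex.
- by apply: measurable_funTS; exact: measurable_dot_powR.
- by move=> x xS; rewrite powR_ge0 /= powR_bound//; exact: dot_itv.
rewrite I12// sum_nu_weight// EFinM -integral_lambda_power// integral_Lambda.
by congr (_ * _)%E; apply: eq_integral => x _; rewrite powRN.
Qed.

End nu_theory.

(** * Transforms determine measures on the simplex *)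

Section indicator_approximation.
Variable R : realType.

Lemma bernoulli_ge (x : R) m : 0 <= x -> 1 + m%:R * x <= (1 + x) ^+ m.
Proof.
move=> x0; elim: m => [|m ih]; first by rewrite mul0r addr0 expr0.
rewrite exprS; have x1 : 0 <= 1 + x by rewrite addr_ge0.
apply: le_trans (ler_wpM2l x1 ih).
have m0 : 0 <= m%:R * x ^+ 2 by rewrite mulr_ge0// sqr_ge0.
by rewrite -natr1; nra.
Qed.

Lemma bernoulli_le (x : R) m : 0 <= x <= 1 -> 1 - m%:R * x <= (1 - x) ^+ m.
Proof.
move=> /andP[x0 x1]; elim: m => [|m ih]; first by rewrite mul0r subr0 expr0.
rewrite exprS; have x1' : 0 <= 1 - x by rewrite subr_ge0.
apply: le_trans (ler_wpM2l x1' ih).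
have m0 : 0 <= m%:R * x ^+ 2 by rewrite mulr_ge0// sqr_ge0.
by rewrite -natr1; nra.
Qed.

(** The product of (1 - x)^m and (1 + x)^m is at most 1, and Bernoulli bounds the second factor
    below. *)
Lemma onemX_le_inv (x : R) m : 0 <= x <= 1 ->
  (1 - x) ^+ m <= (1 + m%:R * x)^-1.
Proof.
move=> /andP[x0 x1].
have m0 : 0 < 1 + m%:R * x by rewrite ltr_pwDl// mulr_ge0.
rewrite -[leRHS]mul1r ler_pdivlMr//.
apply: (@le_trans _ _ ((1 - x) ^+ m * (1 + x) ^+ m)).
  by apply: ler_wpM2l; [rewrite exprn_ge0// subr_ge0|exact: bernoulli_ge].
rewrite -exprMn exprn_ile1//; first by rewrite mulr_ge0 ?subr_ge0// addr_ge0.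
by have := sqr_ge0 x; nra.
Qed.

Lemma cvg_natmul_geometric (r : R) : 0 < r < 1 ->
  n.+1%:R * r ^+ n @[n --> \oo] --> 0.
Proof.
move=> /andP[r0 r1]; pose q := (r + 1) / 2.
have q1 : q < 1 by rewrite /q; lra.
have rq : r < q by rewrite /q; lra.
have q0 : 0 < q by exact: lt_trans rq.
pose dl := q / r - 1.
have d0 : 0 < dl by rewrite /dl subr_gt0 ltr_pdivlMr// mul1r.
(* Bernoulli gives (q/r)^n >= 1 + n dl; the constant is chosen so that (1 + 1/dl)(1 + n dl) >= n +
   1. *)
apply: (@squeeze_cvgr _ _ _ _ (fun=> 0) (fun n => (1 + dl^-1) * q ^+ n)).
- apply: nearW => n; apply/andP; split.
    by rewrite mulr_ge0// exprn_ge0// ltW.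
  have : 1 + n%:R * dl <= (q / r) ^+ n.
    by rewrite (_ : q / r = 1 + dl) ?bernoulli_ge ?ltW// /dl addrC subrK.
  rewrite expr_div_n ler_pdivlMr ?exprn_gt0// => h.
  apply: (@le_trans _ _ ((1 + dl^-1) * ((1 + n%:R * dl) * r ^+ n))); last first.
    by apply: ler_wpM2l => //; rewrite addr_ge0// invr_ge0 ltW.
  have -> : (1 + dl^-1) * ((1 + n%:R * dl) * r ^+ n) =
      (n.+1%:R + (n%:R * dl + dl^-1)) * r ^+ n.
    by rewrite -natr1; field; rewrite gt_eqF.
  apply: ler_wpM2r; first by rewrite exprn_ge0// ltW.
  by rewrite lerDl addr_ge0// ?invr_ge0 ?mulr_ge0// ltW.
- exact: cvg_cst.
- by apply: cvg_geometric; rewrite ger0_norm// ltW.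
Qed.

(** Convergence holds at every point of [0, 1], [x] = [a] included, so equality of moments passes to
    boxes without any condition on the mass of their boundaries. *)
Lemma indicator_approximation (a : R) : exists p m : nat -> nat,
  forall x : R, 0 <= x <= 1 ->
    (1 - x ^+ p n) ^+ m n @[n --> \oo] --> ((x <= a)%R%:R : R).
Proof.
have [a0|a0|a0] := ltgtP a 0.
- exists (fun=> 0%N), (fun=> 1%N) => x /andP[x0 _].
  rewrite leNgt (lt_le_trans a0)//= expr0 subrr expr1; exact: cvg_cst.
- have [a1|a1] := leP 1 a.
    exists (fun=> 0%N), (fun=> 0%N) => x /andP[_ x1].
    by rewrite (le_trans x1 a1) expr0; exact: cvg_cst.
  (* m n is close to a^-n / (n + 1): then m n * x^n tends to 0 for x <= a and to
     infinity for x > a. *)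
  pose m n := (Num.truncn (a ^- n / n.+1%:R)).+1.
  have an n : 0 < a ^+ n by rewrite exprn_gt0.
  have m_le n : (m n)%:R <= a ^- n / n.+1%:R + 1.
    rewrite /m -natr1 lerD2r truncn_le divr_ge0// invr_ge0 ltW//.
  have m_ge n : a ^- n / n.+1%:R <= (m n)%:R by rewrite ltW// truncnS_gt.
  exists id, m => x /andP[x0 x1] /=.
  have xn n : 0 <= x ^+ n <= 1 by rewrite exprn_ge0//= exprn_ile1.
  have [xa|xa] := leP x a.
    apply: (@squeeze_cvgr _ _ _ _ (fun n => 1 - (n.+1%:R^-1 + a ^+ n)) (fun=> 1)).
    + apply: nearW => n; apply/andP; split; last first.
        by have /andP[h1 h2] := xn n; rewrite exprn_ile1 ?subr_ge0// gerBl.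
      apply: le_trans (bernoulli_le _ (xn n)).
      rewrite lerD2l lerN2.
      apply: (@le_trans _ _ ((a ^- n / n.+1%:R + 1) * a ^+ n)).
        apply: ler_pM => //; first by rewrite exprn_ge0.
        by rewrite lerXn2r// nnegrE ltW.
      rewrite mulrDl mul1r mulrAC mulVf ?mul1r// gt_eqF//.
    + rewrite -[X in _ --> X]subr0 -[X in _ - X]addr0.
      apply: cvgB; first exact: cvg_cst.
      apply: cvgD; first exact: cvg_harmonic.
      by apply: cvg_expr; rewrite ger0_norm// ltW.
    + exact: cvg_cst.
  have x0' : 0 < x by exact: lt_trans xa.
  (* By [onemX_le_inv] the term is at most 1/(m_n x^n), and m_n >= a^-n/(n + 1) turns this into (n +
     1)(a/x)^n. *)
  apply: (@squeeze_cvgr _ _ _ _ (fun=> 0) (fun n => n.+1%:R * (a / x) ^+ n)).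
  + apply: nearW => n; apply/andP; split.
      by have /andP[h1 h2] := xn n; rewrite exprn_ge0// subr_ge0.
    apply: le_trans (onemX_le_inv _ (xn n)) _.
    have -> : n.+1%:R * (a / x) ^+ n = (a ^- n / n.+1%:R * x ^+ n)^-1.
      by rewrite expr_div_n !invfM !invrK; ring.
    have xn0 : 0 < x ^+ n by rewrite exprn_gt0.
    rewrite lef_pV2 ?posrE; last 2 first.
    * by rewrite ltr_pwDl// mulr_ge0// ltW.
    * by rewrite !mulr_gt0 ?invr_gt0.
    by rewrite ler_wpDl// ler_wpM2r// ltW.
  + exact: cvg_cst.
  + by apply: cvg_natmul_geometric; rewrite divr_gt0//= ltr_pdivrMr// mul1r.
- exists (fun=> 1%N), id => x /andP[x0 x1] /=; rewrite a0 expr1.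
  have [->|xn0] := eqVneq x 0.
    by rewrite subr0 lexx; under eq_fun do rewrite expr1n; exact: cvg_cst.
  have x0' : 0 < x by rewrite lt_neqAle eq_sym xn0.
  rewrite leNgt x0' /=; apply: cvg_expr; rewrite ger0_norm ?subr_ge0//.
  by rewrite ltrBlDr ltrDl.
Qed.

End indicator_approximation.

Section simplex_moments.
Variables (R : realType) (d : nat).
Variables mu1 mu2 : {measure set (d.+1.-tuple R) -> \bar R}.
Hypotheses (mu1oo : (mu1 setT < +oo)%E) (mu2oo : (mu2 setT < +oo)%E).
Local Notation S := (simplex R d).
Local Notation X := (d.+1.-tuple R).

Let mS : measurable S := @measurable_simplex R d.

Lemma measure_lty (mu : {measure set X -> \bar R}) A :
  (mu setT < +oo)%E -> measurable A -> (mu A < +oo)%E.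
Proof. by move=> muoo mA; apply: le_lt_trans muoo; apply: le_measure; rewrite ?inE. Qed.

Lemma simplex_coord x i : S x -> 0 <= tnth x i <= 1.
Proof.
move=> [x0 <-]; rewrite x0 /= (bigD1 i) //= lerDl.
by apply: sumr_ge0 => j _; exact: x0.
Qed.

(** Differentiation under the integral sign in f_i; [g] holds the coordinates brought down by
    earlier differentiations. The conclusion is a limit of difference quotients because these are
    what two measures with equal transforms share. *)
Lemma cvg_derivative_dot (mu : {measure set X -> \bar R}) (g : X -> R) (C : R)
    (f : X) (b : R) i :
  (mu setT < +oo)%E -> measurable_fun setT g -> (forall x, S x -> `|g x| <= C) ->
  (forall j, 0 < tnth f j) ->
  h^-1 *: (\int[mu]_(x in S) (g x * (dot f x + tnth x i * h) `^ b) -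
           \int[mu]_(x in S) (g x * dot f x `^ b)) @[h --> 0^'] -->
  b * \int[mu]_(x in S) (tnth x i * g x * dot f x `^ (b - 1)).
Proof.
move=> muoo mg gC f0; have [m [M [m0 fM]]] := positive_bounds f0.
have muS : (mu S < +oo)%E by exact: measure_lty.
have mi : measurable_fun setT (fun x : X => tnth x i) by exact: measurable_tnth.
pose F (h : R) (x : X) := g x * (dot f x + tnth x i * h) `^ b.
have E0 : b * \int[mu]_(x in S) (tnth x i * g x * dot f x `^ (b - 1)) =
    \int[mu]_(x in S) (g x * (b * dot f x `^ (b - 1) * tnth x i)).
  rewrite -RintegralZl//.
    by apply: eq_Rintegral => x _; ring.
  apply: (integrable_bounded (M := C * (m `^ (b - 1) + M `^ (b - 1)))) => //.
    apply: measurable_funTS; apply: measurable_funM; last exact: measurable_dot_powR.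
    exact: measurable_funM.
  move=> x xS; have /andP[t0 t1] := simplex_coord i xS.
  rewrite normrM ler_pM//.
    rewrite normrM ger0_norm// -[leRHS]mul1r ler_pM//; exact: gC.
  by rewrite ger0_norm ?powR_ge0//; apply: powR_bound => //; exact: dot_itv.
(* As x_i is in [0, 1], a displacement |h| < m/2 keeps the base above m/2, which gives a uniform
   domination. *)
have m2 : 0 < m / 2 by lra.
have bnd h x : `](- (m / 2)), (m / 2)[%classic h -> S x ->
    m / 2 <= dot f x + tnth x i * h <= M + m.
  rewrite /= in_itv /= => /andP[h1 h2] xS.
  have /andP[d1 d2] := dot_itv fM xS.
  have /andP[t0 t1] := simplex_coord i xS.
  by apply/andP; split; nra.
have mF h p : measurable_fun setT (fun x => (dot f x + tnth x i * h) `^ p).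
  apply: (measurableT_comp (measurable_powR p)).
  by apply: measurable_funD; [exact: measurable_dot|exact: measurable_funM].
have C0 x : S x -> 0 <= C by move=> xS; exact: le_trans (gC _ xS).
have intF h : `](- (m / 2)), (m / 2)[%classic h ->
    mu.-integrable S (EFin \o F h).
  move=> hI; apply: (integrable_bounded
    (M := C * ((m / 2) `^ b + (M + m) `^ b))) => //.
    by apply: measurable_funTS; apply: measurable_funM => //; exact: mF.
  move=> x xS; rewrite normrM ler_pM//; first exact: gC.
  by rewrite ger0_norm ?powR_ge0//; apply: powR_bound => //; exact: bnd.
have dF h x : `](- (m / 2)), (m / 2)[%classic h -> S x ->
    is_derive h 1 (F^~ x) (g x * (b * (dot f x + tnth x i * h) `^ (b - 1) * tnth x i)).
  move=> hI xS.
  have Fh : 0 < dot f x + h * tnth x i.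
    by rewrite mulrC; have /andP[+ _] := bnd _ _ hI xS; exact: lt_le_trans.
  have H := is_derive_powR_affine b Fh.
  rewrite (_ : F^~ x = fun h => g x *: (dot f x + h * tnth x i) `^ b); last first.
    by apply/funext => h'; rewrite /F mulrC [h' * _]mulrC mulrC.
  by rewrite [tnth x i * h]mulrC; exact: is_deriveZ.
have I0 : `](- (m / 2)), (m / 2)[%classic 0 by rewrite /= in_itv /=; apply/andP; split; lra.
have dE h x : `](- (m / 2)), (m / 2)[%classic h -> S x -> partial1of2 F h x =
    g x * (b * (dot f x + tnth x i * h) `^ (b - 1) * tnth x i).
  by move=> hI xS; rewrite /partial1of2 derive1E; have [_ ->] := dF h x hI xS.
(* The outer absolute value makes [G] nonnegative outright, whereas the sign of [C] is known only
   through a point of the simplex. *)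
pose G := `|C * (`|b| * ((m / 2) `^ (b - 1) + (M + m) `^ (b - 1)))|.
have intG : mu.-integrable S (EFin \o (cst G : X -> R)).
  apply: (integrable_bounded (M := G)) => // x _.
  by rewrite /= /G normr_id.
have ubG h x : `](- (m / 2)), (m / 2)[%classic h -> S x ->
    `|partial1of2 F h x| <= (cst G : X -> R) x.
  move=> hI xS; rewrite dE//= /G; apply: le_trans (ler_norm _).
  have /andP[t0 t1] := simplex_coord i xS.
  rewrite normrM ler_pM//; first exact: gC.
  rewrite -mulrA normrM ler_wpM2l// normrM -[leRHS]mulr1.
  rewrite ler_pM// ?ger0_norm ?powR_ge0//.
  by apply: powR_bound => //; exact: bnd.
have E2 : b * \int[mu]_(x in S) (tnth x i * g x * dot f x `^ (b - 1)) =
    \int[mu]_(x in S) partial1of2 F 0 x.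
  by rewrite E0; apply: eq_Rintegral => x /[!inE] xS; rewrite dE// mulr0 addr0.
have E1 : (fun h => h^-1 *: (\int[mu]_(x in S) (g x * (dot f x + tnth x i * h) `^ b) -
           \int[mu]_(x in S) (g x * dot f x `^ b))) =
    (fun h => h^-1 *: (\int[mu]_(x in S) F (h + 0) x - \int[mu]_(x in S) F 0 x)).
  have F0E : \int[mu]_(x in S) F 0 x = \int[mu]_(x in S) (g x * dot f x `^ b).
    by apply: eq_Rintegral => x _; rewrite /F mulr0 addr0.
  by rewrite F0E; apply/funext => h; rewrite addr0.
rewrite E1 E2; exact: (@cvg_differentiation_under_integral R _ _ mu F S mS 0 (- (m / 2)) (m / 2)
  I0 intF (fun h x hI xS => let: DeriveDef H _ := dF h x hI xS in H) (cst G)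
  (fun x => normr_ge0 _) intG ubG).
Qed.

Definition same_integral (g : X -> R) :=
  \int[mu1]_(x in S) g x = \int[mu2]_(x in S) g x.

(* Differentiating in f_i at exponent b brings down a factor b * x_i; iterating
   reaches all moments. *)
Lemma same_integral_coord (g : X -> R) (C b : R) i : b != 0 ->
  measurable_fun setT g -> (forall x, S x -> `|g x| <= C) ->
  (forall f : X, (forall j, 0 < tnth f j) ->
     same_integral (fun x => g x * dot f x `^ b)) ->
  forall f : X, (forall j, 0 < tnth f j) ->
     same_integral (fun x => tnth x i * g x * dot f x `^ (b - 1)).
Proof.
move=> b0 mg gC H f f0; apply: (mulfI b0).
have L1 := @cvg_derivative_dot mu1 g C f b i mu1oo mg gC f0.
have L2 := @cvg_derivative_dot mu2 g C f b i mu2oo mg gC f0.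
apply: (cvg_unique _ L1) => //; apply: cvg_trans L2.
apply: near_eq_cvg; have fi := f0 i.
near=> h; congr (_ *: (_ - _)); last exact/esym/H.
(* Adding h x_i to <f, x> amounts to moving f along the i-th basis vector [w]; for |h| < f_i the
   moved point is still positive and [H] applies to it. *)
pose w : X := [tuple (j == i)%:R | j < d.+1].
have wE x : dot w x = tnth x i.
  rewrite /dot (bigD1 i) //= tnth_mktuple eqxx mul1r big1 ?addr0// => j /negbTE ji.
  by rewrite tnth_mktuple ji mul0r.
have fE x : dot f x + tnth x i * h = dot [tuple tnth f j + tnth w j * h | j < d.+1] x.
  by rewrite dot_perturbed wE.
under eq_Rintegral do rewrite fE.
under [RHS]eq_Rintegral do rewrite fE.
apply/esym/H => j; rewrite !tnth_mktuple; case: eqP => [->|_]; last first.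
  by rewrite mul0r addr0.
rewrite mul1r -ltrBlDl sub0r ltrNl.
have : `|h| < tnth f i by near: h; exact: dnbhs0_lt.
by rewrite ltr_norml => /andP[? _]; rewrite ltrNl.
Unshelve. all: by end_near. Qed.

End simplex_moments.

Section box_generators.
Variables (R : realType) (n : nat).
Local Notation X := (n.-tuple R).

(** One-sided boxes form a pi-system that generates the sigma-algebra, and their indicators are
    products over the coordinates, hence limits of products of polynomials in one variable. *)
Definition box (a : 'I_n -> R) : set X := [set x | forall i, tnth x i <= a i].

Definition boxes : set (set X) := range box.

Lemma measurable_box a : measurable (box a).
Proof.
rewrite (_ : box a =
    \bigcap_(i in [set: 'I_n]) ((@tnth n R ^~ i) @^-1` `]-oo, a i]%classic)).
  apply: fin_bigcap_measurable => [|i _]; first exact: finite_finset.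
  rewrite -[X in measurable X]setTI.
  by apply: measurable_tnth => //; exact: measurable_itv.
apply/seteqP; split=> x /= xa; first by move=> i _ /=; rewrite in_itv; exact: xa.
by move=> i; have := xa i I; rewrite /= in_itv; exact.
Qed.

Lemma boxes_setI : setI_closed boxes.
Proof.
move=> _ _ [a _ <-] [b _ <-]; exists (fun i => Num.min (a i) (b i)) => //.
apply/seteqP; split=> x /=.
  by move=> xab; split=> i; have := xab i; rewrite le_min => /andP[].
by move=> [xa xb] i; rewrite le_min xa xb.
Qed.

Lemma boxes_cover : \bigcup_k box (fun=> k%:R) = setT.
Proof.
apply/seteqP; split=> // x _.
exists (Num.truncn (\sum_i `|tnth x i|)).+1 => // i.
have xi : `|tnth x i| <= \sum_i `|tnth x i|.
  by rewrite (bigD1 i) //= lerDl; apply: sumr_ge0.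
exact: le_trans (ler_norm _) (le_trans xi (ltW (truncnS_gt _))).
Qed.

Lemma measurable_boxes : @measurable _ X = <<s boxes >>.
Proof.
apply/seteqP; split; last first.
  apply: smallest_sub; first exact: sigma_algebra_measurable.
  by move=> _ [a _ <-]; exact: measurable_box.
apply: smallest_sub; first exact: smallest_sigma_algebra.
have mi i : measurable_fun setT (fun x : g_sigma_algebraType boxes => tnth (x : X) i).
  apply: (measurability (rT := R) (RGenOInfty.G (R:=R)) (RGenOInfty.measurableE R)).
  move=> _ [_ [a ->] <-]; rewrite setTI.
  (* A half-space bounds one coordinate only; its complement is the union of boxes whose other sides
     grow with k. *)
  have -> : (fun x : g_sigma_algebraType boxes => tnth (x : X) i) @^-1` `]a, +oo[%classic =
      ~` (\bigcup_k box (fun j => if j == i then a else k%:R)).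
    apply/seteqP; split=> x /=.
      rewrite in_itv /= andbT => ax [k _] /(_ i); rewrite eqxx.
      by rewrite leNgt ax.
    rewrite in_itv /= andbT ltNge; apply: contra_notN => xa.
    have : setT x by []; rewrite -boxes_cover => -[k _ xk]; exists k => // j.
    by case: eqP => [->|_]; [|exact: xk].
  apply: measurableC; apply: bigcup_measurable => k _.
  by apply: sub_sigma_algebra; eexists.
rewrite -bigcup_seq /= => _ [i _ [Y mY <-]].
exact: (mi i measurableT Y mY).
Qed.

End box_generators.

Section simplex_determinacy.
Variables (R : realType) (d : nat).
Variables mu1 mu2 : {measure set (d.+1.-tuple R) -> \bar R}.
Hypotheses (mu1oo : (mu1 setT < +oo)%E) (mu2oo : (mu2 setT < +oo)%E).
Hypotheses (mu1S : (mu1 (~` simplex R d) = 0)%E)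
  (mu2S : (mu2 (~` simplex R d) = 0)%E).
Local Notation S := (simplex R d).
Local Notation X := (d.+1.-tuple R).
Variable s : R.
Hypothesis s0 : 0 < s.
Hypothesis transform : forall f : X, (forall j, 0 < tnth f j) ->
  same_integral mu1 mu2 (fun x => dot f x `^ (- s)).

Let mS : measurable S := @measurable_simplex R d.

Lemma measurable_monomial (l : seq 'I_d.+1) :
  measurable_fun setT (fun x : X => \prod_(i <- l) tnth x i).
Proof. by apply: measurable_prod => i _; exact: measurable_tnth. Qed.

Lemma monomial_itv (l : seq 'I_d.+1) (x : X) : S x ->
  0 <= \prod_(i <- l) tnth x i <= 1.
Proof.
move=> xS; apply/andP; split.
  by apply: prodr_ge0 => i _; have /andP[] := simplex_coord i xS.
by apply: prodr_ile1 => i _; exact: simplex_coord.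
Qed.

Lemma same_integral_monomial_dot (l : seq 'I_d.+1) (f : X) :
  (forall j, 0 < tnth f j) ->
  same_integral mu1 mu2
    (fun x => \prod_(i <- l) tnth x i * dot f x `^ (- s - (size l)%:R)).
Proof.
elim: l f => [|i l ih] f f0.
  have E (mu : {measure set X -> \bar R}) :
    \int[mu]_(x in S) (\prod_(i <- [::]) tnth x i * dot f x `^ (- s - 0)) =
    \int[mu]_(x in S) (dot f x `^ (- s)).
    by apply: eq_Rintegral => x _; rewrite big_nil mul1r subr0.
  by rewrite /same_integral !E; exact: transform.
(* As s > 0 the exponent stays negative, so the factor that each differentiation brings down can be
   cancelled. *)
have b0 : - s - (size l)%:R != 0 by rewrite -opprD oppr_eq0 gt_eqF// ltr_pwDl.
have := same_integral_coord mu1oo mu2oo i b0 (measurable_monomial l)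
  (C := 1) _ ih f0.
rewrite /same_integral /= => H.
have E (mu : {measure set X -> \bar R}) :
    \int[mu]_(x in S)
      (\prod_(j <- i :: l) tnth x j * dot f x `^ (- s - (size l).+1%:R)) =
    \int[mu]_(x in S) (tnth x i * \prod_(j <- l) tnth x j *
      dot f x `^ (- s - (size l)%:R - 1)).
  by apply: eq_Rintegral => x _; rewrite big_cons -natr1 opprD addrA.
rewrite !E; apply: H => x xS; have /andP[p0 p1] := monomial_itv l xS.
by rewrite ger0_norm.
Qed.

(** At f = (1, ..., 1) the power of <f, x> is 1 on the simplex and the bare moment remains. *)
Lemma same_integral_monomial (l : seq 'I_d.+1) :
  same_integral mu1 mu2 (fun x => \prod_(i <- l) tnth x i).
Proof.
have f0 j : 0 < tnth ([tuple 1 | _ < d.+1] : X) j by rewrite tnth_mktuple.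
have := same_integral_monomial_dot l f0; rewrite /same_integral.
have E (mu : {measure set X -> \bar R}) :
    \int[mu]_(x in S) (\prod_(i <- l) tnth x i *
      dot [tuple 1 | _ < d.+1] x `^ (- s - (size l)%:R)) =
    \int[mu]_(x in S) \prod_(i <- l) tnth x i.
  apply: eq_Rintegral => x /[!inE] -[_ x1].
  by rewrite dot1 x1 powR1 mulr1.
by rewrite !E.
Qed.

(** Testing against every monomial multiple makes the class stable under multiplication by a
    coordinate. The approximating polynomials are then reached by closure properties, without being
    expanded. *)
Definition moment_class (g : X -> R) := [/\ measurable_fun setT g,
  exists C, forall x, S x -> `|g x| <= C &
  forall l : seq 'I_d.+1, same_integral mu1 mu2 (fun x => \prod_(i <- l) tnth x i * g x)].

Lemma moment_class1 : moment_class (fun=> 1).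
Proof.
split; [exact: measurable_cst|by exists 1 => x _; rewrite normr1|move=> l].
have E (mu : {measure set X -> \bar R}) :
    \int[mu]_(x in S) (\prod_(i <- l) tnth x i * 1) =
    \int[mu]_(x in S) \prod_(i <- l) tnth x i.
  by apply: eq_Rintegral => x _; rewrite mulr1.
by rewrite /same_integral !E; exact: same_integral_monomial.
Qed.

Lemma moment_classM i g : moment_class g -> moment_class (fun x => tnth x i * g x).
Proof.
move=> [mg [C gC] gl]; split.
- by apply: measurable_funM => //; exact: measurable_tnth.
- exists C => x xS; have /andP[t0 t1] := simplex_coord i xS.
  by rewrite normrM ger0_norm// -[leRHS]mul1r ler_pM//; exact: gC.
- move=> l; have := gl (i :: l); rewrite /same_integral.
  have E (mu : {measure set X -> \bar R}) :
    \int[mu]_(x in S) (\prod_(j <- i :: l) tnth x j * g x) =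
    \int[mu]_(x in S) (\prod_(j <- l) tnth x j * (tnth x i * g x)).
    by apply: eq_Rintegral => x _; rewrite big_cons; ring.
  by rewrite !E.
Qed.

Lemma moment_classX i p g : moment_class g -> moment_class (fun x => tnth x i ^+ p * g x).
Proof.
move=> Mg; elim: p => [|p ih].
  by rewrite (_ : (fun x => _) = g)//; apply/funext => x; rewrite expr0 mul1r.
rewrite (_ : (fun x => _) = (fun x => tnth x i * (tnth x i ^+ p * g x))).
  exact: moment_classM.
by apply/funext => x; rewrite exprS mulrA.
Qed.

Lemma integrable_monomial (mu : {measure set X -> \bar R}) l (g : X -> R) (C : R) :
  (mu setT < +oo)%E -> measurable_fun setT g -> (forall x, S x -> `|g x| <= C) ->
  mu.-integrable S (EFin \o (fun x => \prod_(i <- l) tnth x i * g x)).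
Proof.
move=> muoo mg gC; apply: (integrable_bounded (M := C)) => //.
- exact: measure_lty.
- by apply: measurable_funTS; apply: measurable_funM => //; exact: measurable_monomial.
- move=> x xS; have /andP[p0 p1] := monomial_itv l xS.
  by rewrite normrM ger0_norm// -[leRHS]mul1r ler_pM//; exact: gC.
Qed.

Lemma moment_classB g h : moment_class g -> moment_class h ->
  moment_class (fun x => g x - h x).
Proof.
move=> [mg [C gC] gl] [mh [C' hC] hl]; split.
- exact: measurable_funB.
- exists (C + C') => x xS; apply: le_trans (ler_normB _ _) _.
  by rewrite lerD ?gC ?hC.
- move=> l; have := gl l; have := hl l; rewrite /same_integral.
  have E (mu : {measure set X -> \bar R}) : (mu setT < +oo)%E ->
    \int[mu]_(x in S) (\prod_(j <- l) tnth x j * (g x - h x)) =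
    \int[mu]_(x in S) (\prod_(j <- l) tnth x j * g x) -
    \int[mu]_(x in S) (\prod_(j <- l) tnth x j * h x).
    move=> muoo; rewrite -RintegralB//.
    - by apply: eq_Rintegral => x _; rewrite mulrBr.
    - exact: integrable_monomial gC.
    - exact: integrable_monomial hC.
  by rewrite !E// => -> ->.
Qed.

Lemma moment_class_onemX i p m g : moment_class g ->
  moment_class (fun x => (1 - tnth x i ^+ p) ^+ m * g x).
Proof.
move=> Mg; elim: m => [|m ih].
  by rewrite (_ : (fun x => _) = g)//; apply/funext => x; rewrite expr0 mul1r.
rewrite (_ : (fun x => _) = (fun x => (1 - tnth x i ^+ p) ^+ m * g x -
    tnth x i ^+ p * ((1 - tnth x i ^+ p) ^+ m * g x))).
  by apply: moment_classB => //; exact: moment_classX.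
by apply/funext => x; rewrite exprS; ring.
Qed.

Lemma moment_class_prod (p m : 'I_d.+1 -> nat) (r : seq 'I_d.+1) :
  moment_class (fun x => \prod_(i <- r) (1 - tnth x i ^+ p i) ^+ m i).
Proof.
elim: r => [|i r ih].
  rewrite (_ : (fun x => _) = fun=> 1); first exact: moment_class1.
  by apply/funext => x; rewrite big_nil.
rewrite (_ : (fun x => _) = fun x => (1 - tnth x i ^+ p i) ^+ m i *
    \prod_(i <- r) (1 - tnth x i ^+ p i) ^+ m i).
  exact: moment_class_onemX.
by apply/funext => x; rewrite big_cons.
Qed.

Lemma same_integral_prod (p m : 'I_d.+1 -> nat) :
  same_integral mu1 mu2 (fun x => \prod_i (1 - tnth x i ^+ p i) ^+ m i).
Proof.
have [_ _ /(_ [::])] := moment_class_prod p m (index_enum 'I_d.+1).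
rewrite /same_integral.
have E (mu : {measure set X -> \bar R}) :
    \int[mu]_(x in S) (\prod_(j <- [::]) tnth x j *
      \prod_i (1 - tnth x i ^+ p i) ^+ m i) =
    \int[mu]_(x in S) \prod_i (1 - tnth x i ^+ p i) ^+ m i.
  by apply: eq_Rintegral => x _; rewrite big_nil mul1r.
by rewrite !E.
Qed.

Lemma cvg_integral_box (mu : {measure set X -> \bar R})
    (a : 'I_d.+1 -> R) (p m : 'I_d.+1 -> nat -> nat) :
  (mu setT < +oo)%E ->
  (forall i (x : R), 0 <= x <= 1 ->
    (1 - x ^+ p i n) ^+ m i n @[n --> \oo] --> ((x <= a i)%R%:R : R)) ->
  \int[mu]_(x in S) \prod_i (1 - tnth x i ^+ p i n) ^+ m i n @[n --> \oo] -->
  fine (mu (box a `&` S)).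
Proof.
move=> muoo pm; have muS : (mu S < +oo)%E by exact: measure_lty.
have mB := measurable_box a.
have mBS : measurable (box a `&` S) by exact: measurableI.
have F01 n x : S x -> 0 <= \prod_i (1 - tnth x i ^+ p i n) ^+ m i n <= 1.
  move=> xS; have h i : 0 <= (1 - tnth x i ^+ p i n) ^+ m i n <= 1.
    have /andP[t0 t1] := simplex_coord i xS.
    have q0 : 0 <= 1 - tnth x i ^+ p i n by rewrite subr_ge0 exprn_ile1.
    by rewrite exprn_ge0//= exprn_ile1// gerBl exprn_ge0.
  apply/andP; split; first by apply: prodr_ge0 => i _; case/andP: (h i).
  by apply: prodr_ile1 => i _; exact: h.
have mF n : measurable_fun S (fun x => \prod_i (1 - tnth x i ^+ p i n) ^+ m i n).
  apply: measurable_funTS; apply: measurable_prod => i _.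
  apply: measurable_funX; apply: measurable_funB => //.
  by apply: measurable_funX; exact: measurable_tnth.
apply: fine_cvg.
rewrite fineK; last by rewrite ge0_fin_numE//; exact: measure_lty.
rewrite -integral_indic//.
apply: (@dominated_cvg _ _ _ mu S mS
  (fun n x => (\prod_i (1 - tnth x i ^+ p i n) ^+ m i n)%:E)
  (fun x => (\1_(box a) x)%:E) (cst 1%:E)).
- by move=> n; exact/measurable_EFinP.
- move=> x xS; apply/fine_cvgP; split; first exact: nearW.
  have -> : \1_(box a) x = \prod_i ((tnth x i <= a i)%R%:R : R).
    rewrite indicE; have [xa|xa] := boolP (x \in box a).
      by rewrite big1// => i _; move: xa; rewrite inE => ->.
    have [i xi] : exists i, ~ tnth x i <= a i.
      by apply/existsNP => H; move: xa; rewrite notin_setE; exact.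
    by rewrite (bigD1 i) //= (negbTE (introN idP xi)) mul0r.
  by apply: cvg_prod_seq => i; apply: pm; exact: simplex_coord.
- by [].
- by apply: (integrable_bounded (M := 1)) => // x _; rewrite normr1.
- by move=> n x xS; have /andP[h0 h1] := F01 n x xS; rewrite lee_fin ger0_norm.
Qed.

(** Two finite measures that agree on the pi-system of boxes are equal, and on a box both masses are
    limits of integrals of the same polynomials. *)
Lemma simplex_determinacy A : measurable A -> mu1 A = mu2 A.
Proof.
apply: (measure_unique (@boxes R d.+1) (fun k => box (fun=> k%:R))).
- exact: measurable_boxes.
- exact: boxes_setI.
- by move=> k; eexists.
- exact: boxes_cover.
- move=> _ [a _ <-].
  have mB := measurable_box a.
  have mBS : measurable (box a `&` S) by exact: measurableI.
  rewrite (measure_full_set mS mu1S mB) (measure_full_set mS mu2S mB).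
  pose p i := sval (cid (indicator_approximation (a i))).
  pose m i := sval (cid (svalP (cid (indicator_approximation (a i))))).
  have pm i : forall x : R, 0 <= x <= 1 ->
    (1 - x ^+ p i n) ^+ m i n @[n --> \oo] --> ((x <= a i)%R%:R : R).
    exact: svalP (cid (svalP (cid (indicator_approximation (a i))))).
  rewrite -[LHS]fineK; last by rewrite ge0_fin_numE//; exact: measure_lty.
  rewrite -[RHS]fineK; last by rewrite ge0_fin_numE//; exact: measure_lty.
  congr _%:E.
  have L1 := cvg_integral_box mu1oo pm; have L2 := cvg_integral_box mu2oo pm.
  apply: (cvg_unique _ L1) => //; apply: cvg_trans L2.
  by apply: near_eq_cvg; apply: nearW => n; exact/esym/same_integral_prod.
- by move=> k; apply: measure_lty => //; exact: measurable_box.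
Qed.

End simplex_determinacy.

(** * The perpetuity equation *)

Section beta_transform.
Variable R : realType.
Variables (a b p q : R).
Hypotheses (a0 : 0 < a) (b0 : 0 < b).
Local Notation mu := (@lebesgue_measure R).

Let den (t : R) := a + t * (b - a).

(* phi t = b t / (a (1 - t) + b t) maps ]0, 1[ onto itself and turns the beta
   density into a multiple of the tilted one. *)
Let phi (t : R) := b * t * (den t `^ (-1)).

Let dphi (t : R) := a * b * den t `^ (-2).

Let rho (K t : R) := K * t `^ (p - 1) * (1 - t) `^ (q - 1).

Let den_gt0 (t : R) : 0 <= t <= 1 -> 0 < den t.
Proof. by move=> t01; apply: (@affine_gt0 _ _ _ 1) => //; rewrite mul1r addrC subrK. Qed.

Let is_derive_phi (t : R) : 0 <= t <= 1 -> is_derive t 1 phi (dphi t).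
Proof.
move=> t01; have D0 := den_gt0 t01.
have H1 : is_derive t 1 (fun t => b * t) b.
  have : is_derive t 1 (fun t : R => b *: t) (b *: 1) by exact: is_deriveZ.
  by rewrite /GRing.scale /= mulr1.
have H2 := is_derive_powR_affine (-1) D0.
have E : den t `^ (-1) = den t * den t `^ (-2).
  rewrite -[X in X * _](powRr1 (ltW D0)) -powRD; last by apply/implyP => _; rewrite gt_eqF.
  by congr (_ `^ _); ring.
apply: (is_derive_eq (is_deriveM H1 H2)).
rewrite /GRing.scale /= -/(den t) E (_ : -1 - 1 = -2 :> R); last by ring.
by rewrite /dphi /den; ring.
Qed.

Let phi_bound (t : R) : 0 < t < 1 -> 0 < phi t < 1.
Proof.
move=> /andP[t0 t1]; have t01 : 0 <= t <= 1 by rewrite !ltW.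
have D0 := den_gt0 t01; rewrite /phi powR_inv1 ?ltW//.
have h : 0 < a * (1 - t) by rewrite mulr_gt0// subr_gt0.
by rewrite divr_gt0 ?mulr_gt0//= ltr_pdivrMr// mul1r /den; lra.
Qed.

Let onem_phi (t : R) : 0 <= t <= 1 -> 1 - phi t = a * (1 - t) * den t `^ (-1).
Proof.
move=> t01; have D0 := den_gt0 t01.
have E : den t * den t `^ (-1) = 1 by rewrite powR_inv1 ?ltW// mulfV ?gt_eqF.
by rewrite -[X in X - _ = _]E /phi /den; ring.
Qed.

(** The exponents of [den] add up: -(p-1) from [phi], -(q-1) from [1 - phi] and -2 from the
    derivative, in all -(p+q). *)
Let rho_phi (K t : R) : 0 < t < 1 ->
  rho K (phi t) * dphi t = a `^ q * b `^ p * (rho K t * den t `^ (- (p + q))).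
Proof.
move=> /andP[t0 t1]; have t01 : 0 <= t <= 1 by rewrite !ltW.
have D0 := den_gt0 t01; have Di := powR_ge0 (den t) (-1).
have t1' : 0 <= 1 - t by rewrite subr_ge0 ltW.
have [a0' b0' t0'] : [/\ 0 <= a, 0 <= b & 0 <= t] by rewrite !ltW.
rewrite /rho onem_phi// /phi.
rewrite (powRM _ (mulr_ge0 b0' t0') Di) (powRM _ b0' t0').
rewrite (powRM _ (mulr_ge0 a0' t1') Di) (powRM _ a0' t1') -!powRrM !mulN1r.
rewrite /dphi.
have -> : b `^ p = b `^ (p - 1) * b.
  by rewrite -[X in _ = _ * X](powRr1 (ltW b0)) -powRD ?subrK//; apply/implyP => _; rewrite gt_eqF.
have -> : a `^ q = a `^ (q - 1) * a.
  by rewrite -[X in _ = _ * X](powRr1 (ltW a0)) -powRD ?subrK//; apply/implyP => _; rewrite gt_eqF.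
have -> : den t `^ (- (p + q)) = den t `^ (- (p - 1)) * den t `^ (- (q - 1)) * den t `^ (- 2).
  rewrite -!powRD; [|by apply/implyP => _; rewrite gt_eqF..].
  by congr (_ `^ _); ring.
ring.
Qed.

Let derive_phi (t : R) : 0 <= t <= 1 -> phi^`()%classic t = dphi t.
Proof. by move=> t01; rewrite derive1E; have [_ ->] := is_derive_phi t01. Qed.

Let continuous_dphi (t : R) : 0 < t < 1 -> {for t, continuous phi^`()%classic}.
Proof.
move=> t01; have /andP[t0 t1] := t01; have t01' : 0 <= t <= 1 by rewrite !ltW.
have : {for t, continuous dphi}.
  have [H _] := is_derive_powR_affine (-2) (den_gt0 t01').
  have : {for t, continuous (fun t => den t `^ (-2))}.
    by apply: differentiable_continuous; exact/derivable1_diffP.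
  move=> c; rewrite /dphi; apply: cvgM => //; exact: cvg_cst.
rewrite /prop_for /continuous_at derive_phi//; apply: cvg_trans.
apply: near_eq_cvg.
have tI : t \in `]0, 1[ by rewrite in_itv.
near=> z.
have : z \in `]0, 1[ by near: z; exact: near_in_itvoo.
rewrite in_itv /= => /andP[z0 z1]; rewrite derive_phi// !ltW//.
Unshelve. all: by end_near. Qed.

Let continuous_rho (K t : R) : 0 < t < 1 -> {for t, continuous (rho K)}.
Proof.
move=> /andP[t0 t1]; rewrite /rho.
have c1 : {for t, continuous (@powR R ^~ (p - 1))}.
  have [H _] := is_derive1_powR (p - 1) t0.
  by apply: differentiable_continuous; exact/derivable1_diffP.
have c2 : {for t, continuous (fun t : R => (1 - t) `^ (q - 1))}.
  have t1' : 0 < 1 + t * -1 by rewrite mulrN1 subr_gt0.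
  have [H _] := is_derive_powR_affine (q - 1) t1'.
  rewrite (_ : (fun t => _) = (fun t : R => (1 + t * -1) `^ (q - 1))).
    by apply: differentiable_continuous; exact/derivable1_diffP.
  by apply/funext => z; rewrite mulrN1.
apply: cvgM => //; apply: cvgM => //; exact: cvg_cst.
Qed.

Let phi_lt (x y : R) : 0 <= x <= 1 -> 0 <= y <= 1 -> x < y -> phi x < phi y.
Proof.
move=> x01 y01 xy; have Dx := den_gt0 x01; have Dy := den_gt0 y01.
rewrite /phi !powR_inv1 ?ltW// ltr_pdivrMr// mulrAC ltr_pdivlMr//.
have h : 0 < a * b * (y - x) by rewrite !mulr_gt0// subr_gt0.
by rewrite /den; lra.
Qed.

Let substitution (K u v : R) : 0 < u -> u <= v -> v < 1 ->
  (\int[mu]_(x in `[phi u, phi v]) (rho K x)%:E =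
   \int[mu]_(x in `[u, v]) (a `^ q * b `^ p * (rho K x * den x `^ (- (p + q))))%:E)%E.
Proof.
move=> u0 uv v1.
have uv01 (t : R) : t \in `[u, v] -> 0 < t < 1.
  rewrite in_itv /= => /andP[ut tv].
  by rewrite (lt_le_trans u0 ut) (le_lt_trans tv v1).
have le01 (t : R) : 0 < t < 1 -> 0 <= t <= 1 by move=> /andP[? ?]; rewrite !ltW.
have phi_incr : {in `[u, v] &, {homo phi : x y / x < y}}.
  by move=> x y /uv01/le01 x01 /uv01/le01 y01; exact: phi_lt.
have cphi (t : R) : 0 < t < 1 -> {for t, continuous phi}.
  move=> /le01/is_derive_phi[H _].
  by apply: differentiable_continuous; exact/derivable1_diffP.
have u01 : 0 < u < 1 by rewrite u0 (le_lt_trans uv v1).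
have v01 : 0 < v < 1 by rewrite v1 (lt_le_trans u0 uv).
rewrite integration_by_substitution_increasing//.
- apply: eq_integral => x /[!inE] /uv01 x01.
  by congr _%:E; rewrite -rho_phi// -derive_phi// le01.
- move=> t tuv; apply: continuous_dphi; apply: uv01.
  by apply: subset_itv_oo_cc tuv.
- apply/cvg_ex; exists (phi^`()%classic u); apply: cvg_at_right_filter.
  exact: continuous_dphi.
- apply/cvg_ex; exists (phi^`()%classic v); apply: cvg_at_left_filter.
  exact: continuous_dphi.
- split.
  + move=> t tuv; have [] // := is_derive_phi (le01 _ (uv01 t _)).
    by apply: subset_itv_oo_cc tuv.
  + by apply: cvg_at_right_filter; exact: cphi.
  + by apply: cvg_at_left_filter; exact: cphi.
- apply: continuous_in_subspaceT => x /[!inE] /=; rewrite in_itv /= => /andP[h1 h2].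
  apply: continuous_rho.
  have /andP[l0 _] := phi_bound u01; have /andP[_ l1] := phi_bound v01.
  by rewrite (lt_le_trans l0 h1) (le_lt_trans h2 l1).
Qed.

Let left n : R := n.+2%:R^-1.

Let right n : R := 1 - n.+2%:R^-1.

Let left_right n : [/\ 0 < left n, left n <= right n & right n < 1].
Proof.
have n0 : 0 < left n by rewrite invr_gt0.
have n2 : left n <= 2^-1 by rewrite lef_pV2 ?posrE// ler_nat.
by split=> //; rewrite /right -/(left n); lra.
Qed.

(** The density is unbounded near 0 or 1 when p < 1 or q < 1, so the substitution is made on compact
    subintervals and monotone convergence passes to the open interval on both sides. *)
Lemma beta_transform (K : R) : 0 <= K ->
  (\int[mu]_(x in `]0%R, 1%R[) (rho K x)%:E =
   (a `^ q * b `^ p)%:E * \int[mu]_(x in `]0%R, 1%R[)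
     (rho K x * (a * (1 - x) + b * x) `^ (- (p + q)))%:E)%E.
Proof.
move=> K0.
have l_le n m : (n <= m)%N -> left m <= left n.
  by move=> nm; rewrite lef_pV2 ?posrE// ler_nat.
have l01 n : 0 <= left n <= 1.
  by have [l0 lr r1] := left_right n; rewrite ltW//= (le_trans lr)// ltW.
have r01 n : 0 <= right n <= 1.
  by have [l0 lr r1] := left_right n; rewrite (le_trans (ltW l0) lr)//= ltW.
have phi_le (x y : R) : 0 <= x <= 1 -> 0 <= y <= 1 -> x <= y -> phi x <= phi y.
  by move=> x01 y01; rewrite le_eqVlt => /predU1P[->//|xy]; rewrite ltW// phi_lt.
have left_lt (e : R) : 0 < e -> exists n, left n <= e.
  move=> e0; have [n ne] := ltr_add_invr e0; exists n; rewrite add0r in ne.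
  by apply: le_trans (ltW ne); rewrite lef_pV2 ?posrE// ler_nat.
pose I n := `[left n, right n]%classic.
pose J n := `[phi (left n), phi (right n)]%classic.
have UI : \bigcup_n I n = `]0, 1[%classic.
  apply/seteqP; split=> [x [n _]|x]; rewrite /I /= !in_itv /=.
    move=> /andP[lx xr]; have [l0 _ r1] := left_right n.
    by apply/andP; split; [exact: lt_le_trans lx|exact: le_lt_trans xr r1].
  move=> /andP[x0 x1]; have : 0 < Num.min x (1 - x) by rewrite lt_min x0 subr_gt0.
  move=> /left_lt[n]; rewrite le_min => /andP[nx n1]; exists n => //=.
  by rewrite in_itv /= nx /right -/(left n); lra.
have UJ : \bigcup_n J n = `]0, 1[%classic.
  apply/seteqP; split=> [x [n _]|x]; rewrite /J /= !in_itv /=.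
    move=> /andP[lx xr]; have [l0 lr r1] := left_right n.
    have /phi_bound/andP[h0 _] : 0 < left n < 1 by rewrite l0 (le_lt_trans lr).
    have /phi_bound/andP[_ h1] : 0 < right n < 1 by rewrite r1 (lt_le_trans l0).
    by apply/andP; split; [exact: lt_le_trans lx|exact: le_lt_trans xr h1].
  move=> /andP[x0 x1]; pose m := Num.min a b.
  have m0 : 0 < m by rewrite lt_min a0.
  have den_ge (t : R) : 0 <= t <= 1 -> m <= den t.
    move=> /andP[t0 t1]; have ma : m <= a by rewrite ge_min lexx.
    have mb : m <= b by rewrite ge_min lexx orbT.
    have h1 : 0 <= (a - m) * (1 - t) by rewrite mulr_ge0// subr_ge0.
    have h2 : 0 <= (b - m) * t by rewrite mulr_ge0// subr_ge0.
    by rewrite /den; lra.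
  (* Since [den] is at least [m], phi (left n) <= b * left n / m and 1 - phi (right n) <= a * left n
     / m. With [left n <= e] these are at most x and 1 - x. *)
  pose e := Num.min x (1 - x) * m / (a + b).
  have e0 : 0 < e.
    by rewrite divr_gt0 ?addr_gt0// mulr_gt0// lt_min x0 subr_gt0.
  have [n ne] := left_lt e e0; exists n => //=.
  have [l0 lr r1] := left_right n.
  have bound : (a + b) * left n <= Num.min x (1 - x) * m.
    by rewrite mulrC -ler_pdivlMr ?addr_gt0.
  have xm : Num.min x (1 - x) * m <= x * m by rewrite ler_wpM2r ?(ltW m0)// ge_min lexx.
  have xm' : Num.min x (1 - x) * m <= (1 - x) * m.
    by rewrite ler_wpM2r ?(ltW m0)// ge_min lexx orbT.
  have al : 0 < a * left n by rewrite mulr_gt0.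
  have bl : 0 < b * left n by rewrite mulr_gt0.
  rewrite in_itv /=; apply/andP; split.
    rewrite /phi (powR_inv1 (ltW (den_gt0 (l01 n)))) ler_pdivrMr ?den_gt0//.
    apply: (@le_trans _ _ (x * m)); first by lra.
    by rewrite ler_wpM2l ?(ltW x0)// den_ge.
  rewrite -lerN2 -(lerD2l 1).
  rewrite onem_phi// (powR_inv1 (ltW (den_gt0 (r01 n)))) ler_pdivrMr ?den_gt0//.
  apply: (@le_trans _ _ ((1 - x) * m)).
    by rewrite /right -/(left n); lra.
  by rewrite ler_wpM2l ?den_ge// subr_ge0 (ltW x1).
have mrho : measurable_fun setT (fun x => (rho K x)%:E).
  apply/measurable_EFinP; apply: measurable_funM.
    by apply: measurable_funM => //; exact: measurable_powR.
  by apply: (measurableT_comp (measurable_powR _)); exact: measurable_funB.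
have rho0 x : (0 <= (rho K x)%:E)%E by rewrite lee_fin !mulr_ge0 ?powR_ge0.
pose g x := rho K x * (a * (1 - x) + b * x) `^ (- (p + q)).
have mg : measurable_fun setT (fun x => (g x)%:E).
  apply/measurable_EFinP; apply: measurable_funM; first exact/measurable_EFinP.
  apply: (measurableT_comp (measurable_powR _)); apply: measurable_funD.
    by apply: measurable_funM => //; exact: measurable_funB.
  exact: measurable_funM.
have g0 x : (0 <= (g x)%:E)%E by rewrite lee_fin mulr_ge0 ?powR_ge0// -lee_fin.
have cI : (\int[mu]_(x in I n) (g x)%:E)%E @[n --> \oo] -->
    (\int[mu]_(x in \bigcup_n I n) (g x)%:E)%E.
  apply: ge0_nondecreasing_set_cvg_integral => //.
  - move=> n m nm; apply/subsetPset => x; rewrite /I /= !in_itv /=.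
    have := l_le _ _ nm => lnm /andP[h1 h2].
    rewrite (le_trans lnm h1) (le_trans h2)// /right -/(left n) -/(left m).
    by rewrite lerD2l lerN2.
  - by move=> n; exact: measurable_itv.
  - by move=> n; exact: measurable_funTS.
have cJ : (\int[mu]_(x in J n) (rho K x)%:E)%E @[n --> \oo] -->
    (\int[mu]_(x in \bigcup_n J n) (rho K x)%:E)%E.
  apply: ge0_nondecreasing_set_cvg_integral => //.
  - move=> n m nm; apply/subsetPset => x; rewrite /J /= !in_itv /=.
    have lnm := l_le _ _ nm => /andP[h1 h2].
    rewrite (le_trans (phi_le _ _ _ _ lnm) h1)//= (le_trans h2)// phi_le//.
    by rewrite /right -/(left n) -/(left m) lerD2l lerN2.
  - by move=> n; exact: measurable_itv.
  - by move=> n; exact: measurable_funTS.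
rewrite -[in LHS]UJ -[in RHS]UI -/g; apply: (cvg_unique _ cJ) => //.
have C0 : 0 <= a `^ q * b `^ p by rewrite mulr_ge0 ?powR_ge0.
have {}cI := cvgeZl (y := (a `^ q * b `^ p)%:E) isT cI.
apply: cvg_trans cI; apply: near_eq_cvg; apply: nearW => n.
have [l0 lr r1] := left_right n.
rewrite /J substitution// -ge0_integralZl//.
- apply: eq_integral => x _; rewrite -EFinM; congr (_ * (_ * _ `^ _))%:E.
  by rewrite /den; ring.
- exact: measurable_itv.
- exact: measurable_funTS.
Qed.

End beta_transform.

Section density.
Context d (T : measurableType d) (R : realType).
Variables (mu nu : {measure set T -> \bar R}) (D : set T) (rho : T -> R).
Hypotheses (mD : measurable D) (mrho : measurable_fun setT rho)
  (rho0 : forall x, 0 <= rho x).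
Local Open Scope ereal_scope.
Hypothesis nuE : forall A, measurable A ->
  nu A = \int[mu]_(x in A `&` D) (rho x)%:E.

Import HBNNSimple.

Let integral_density_nnsfun (f : {nnsfun T >-> R}) :
  \int[nu]_x (f x)%:E = \int[mu]_(x in D) ((rho x)%:E * (f x)%:E).
Proof.
transitivity (\int[mu]_(x in D)
    \sum_(k \in range f) (rho x * (k * \1_(f @^-1` [set k]) x))%:E).
  rewrite ge0_integral_fsum//; last 2 first.
  - move=> k; apply/measurable_EFinP; apply: measurable_funTS.
    by apply: measurable_funM => //; exact: measurable_funM.
  - move=> k x _; rewrite lee_fin mulr_ge0// -lee_fin; exact: nnfun_muleindic_ge0.
  rewrite integralT_nnsfun sintegralE; apply: eq_fsbigr => k kf.
  have k0 : (0 <= k)%R by move: kf; rewrite inE => -[x _ <-].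
  have mA : measurable (f @^-1` [set k]) by exact: measurable_sfunP.
  rewrite (nuE mA) setIC integral_mkcondr -ge0_integralZl//; last 2 first.
  - rewrite epatch_indic; apply: emeasurable_funM; apply/measurable_EFinP.
      exact: measurable_funTS.
    exact: measurable_indic.
  - by move=> x _; apply: erestrict_ge0 => y _; rewrite lee_fin.
  apply: eq_integral => x _; rewrite epatch_indic -!EFinM; congr _%:E; ring.
apply: eq_integral => x _; rewrite fsumEFin// -EFinM; congr _%:E.
by rewrite [in RHS](fimfunE f) mulr_fsumr.
Qed.

Lemma integral_density (h : T -> \bar R) : measurable_fun setT h ->
  (forall x, 0 <= h x) ->
  \int[nu]_x h x = \int[mu]_(x in D) ((rho x)%:E * h x).
Proof.
move=> mh h0; pose f_ := nnsfun_approx measurableT mh.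
have f_h x : (f_ n x)%:E @[n --> \oo] --> h x by exact: cvg_nnsfun_approx.
have f_nd x : {homo (fun n => (f_ n x)%:E) : m n / (m <= n)%N >-> m <= n}.
  by move=> m n mn; rewrite lee_fin; exact/lefP/nd_nnsfun_approx.
have c1 : \int[nu]_x (f_ n x)%:E @[n --> \oo] --> \int[nu]_x h x.
  rewrite (_ : \int[nu]_x h x = \int[nu]_x limn (fun n => (f_ n x)%:E)).
    apply: cvg_monotone_convergence => //.
    - by move=> n; exact/measurable_EFinP.
    - by move=> n x _; rewrite lee_fin.
  by apply: eq_integral => x _; apply/esym/cvg_lim.
have c2 : \int[mu]_(x in D) ((rho x)%:E * (f_ n x)%:E) @[n --> \oo] -->
    \int[mu]_(x in D) ((rho x)%:E * h x).
  rewrite (_ : \int[mu]_(x in D) ((rho x)%:E * h x) =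
      \int[mu]_(x in D) limn (fun n => (rho x)%:E * (f_ n x)%:E)).
    apply: cvg_monotone_convergence => //.
    - move=> n; apply: measurable_funTS; apply/measurable_EFinP.
      exact: measurable_funM.
    - by move=> n x _; rewrite -EFinM lee_fin mulr_ge0.
    - by move=> x _ m n mn; rewrite lee_wpmul2l ?lee_fin//; exact: f_nd.
  apply: eq_integral => x _; apply/esym/cvg_lim => //.
  by apply: cvgeZl => //; exact: f_h.
apply: (cvg_unique _ c1) => //; apply: cvg_trans c2.
by apply: near_eq_cvg; apply: nearW => n; rewrite integral_density_nnsfun.
Qed.

End density.

Section independence.
Context disp (Om : measurableType disp) (R : realType).
Variable P : probability Om R.
Local Open Scope ereal_scope.

Lemma integral_has_law d (T : measurableType d) (X : {mfun Om >-> T})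
    (mu : {measure set T -> \bar R}) (F : T -> \bar R) :
  has_law P X mu -> measurable_fun setT F -> (forall x, 0 <= F x) ->
  \int[P]_w F (X w) = \int[mu]_x F x.
Proof.
move=> Xmu mF F0.
have := ge0_integral_pushforward (measurable_funPT X) P measurableT mF (fun x _ => F0 x).
rewrite preimage_setT => <-.
by apply: eq_measure_integral => A mA _; exact: Xmu.
Qed.

Lemma has_law_distribution d (T : measurableType d) (X : {mfun Om >-> T}) :
  has_law P X (distribution P X).
Proof. by []. Qed.

Lemma integral_independent d1 d2 (T1 : measurableType d1) (T2 : measurableType d2)
    (U : {mfun Om >-> T1}) (V : {mfun Om >-> T2}) (F : T1 * T2 -> \bar R) :
  independent P U V -> measurable_fun setT F -> (forall x, 0 <= F x) ->
  \int[P]_w F (U w, V w) =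
  \int[distribution P U]_u \int[distribution P V]_v F (u, v).
Proof.
move=> UV mF F0.
have mUV : measurable_fun setT (fun w => (U w, V w)).
  by apply: measurable_fun_pair; exact: measurable_funPT.
have := ge0_integral_pushforward mUV P measurableT mF (fun x _ => F0 x).
rewrite preimage_setT => <-.
transitivity (\int[distribution P U \x distribution P V]_z F z).
  apply: eq_measure_integral => A mA _; apply/esym.
  by apply: product_measure_unique => // A1 A2 mA1 mA2; exact: UV.
exact: (fubini_tonelli1 F mF F0).
Qed.

End independence.

Section mixture.
Variables (R : realType) (d : nat) (c : R).
Hypothesis c0 : 0 < c.
Context disp (Om : measurableType disp).
Variable P : probability Om R.
Variables (Y : {mfun Om >-> R}) (X B : {mfun Om >-> d.+1.-tuple R}).
Hypotheses (Ylaw : has_law P Y (beta_law c d.+1%:R))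
  (Xlaw : has_law P X (Lambda R d d)) (YX : independent P Y X)
  (BS : forall w, simplex R d (B w))
  (BYX : independent P B (fun w => (Y w, X w))).
Local Notation S := (simplex R d).
Local Notation q := (d.+1%:R : R).
Local Notation K := (Gamma (c + q) / (Gamma c * Gamma q)).

Let mS : measurable S := @measurable_simplex R d.

Lemma Gamma_ge0 (p : R) : 0 <= Gamma p.
Proof. by apply: Rintegral_ge0 => t _; rewrite mulr_ge0 ?powR_ge0 ?expR_ge0. Qed.

(* The existence of Y normalises the beta density, so that no relation between
   Gamma and beta integrals is needed. *)
Lemma integral_beta_density :
  (\int[@lebesgue_measure R]_(x in `]0%R, 1%R[)
    (K * x `^ (c - 1) * (1 - x) `^ (q - 1))%:E = 1)%E.
Proof.
have := Ylaw measurableT; rewrite /pushforward preimage_setT probability_setT.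
by rewrite /beta_law setTI.
Qed.

Lemma distribution_simplexC : distribution P X (~` S) = 0%E.
Proof.
have mSC : measurable (~` S) by exact: measurableC.
rewrite /distribution (Xlaw mSC) LambdaE lambda_simplexC//.
by rewrite -card_gt0 cardsT card_ord.
Qed.

Lemma integral_beta_law (h : R -> \bar R) : measurable_fun setT h ->
  (forall y, 0 <= h y)%E ->
  (\int[distribution P Y]_y h y =
   \int[@lebesgue_measure R]_(y in `]0%R, 1%R[)
     ((K * y `^ (c - 1) * (1 - y) `^ (q - 1))%:E * h y))%E.
Proof.
move=> mh h0.
(* [integral_density] relates measures on one and the same type, and Lebesgue measure is taken on
   [measurableTypeR R]. Going through the integral over [P] trades the law of [Y] for that of its
   copy [Y'] there. *)
have mY : measurable_fun setT (Y : Om -> measurableTypeR R).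
  exact: (measurable_funPT Y).
pose Y' : {mfun Om >-> measurableTypeR R} :=
  @mfun_Sub _ _ Om (measurableTypeR R) Y (mem_set mY).
rewrite -(integral_has_law (has_law_distribution P Y) mh h0).
have mh' : measurable_fun setT (h : measurableTypeR R -> \bar R) by exact: mh.
transitivity (\int[distribution P Y']_y h y)%E.
  exact: (integral_has_law (has_law_distribution P Y') mh' h0).
apply: integral_density => //.
- apply: measurable_funM.
    by apply: measurable_funM => //; exact: measurable_powR.
  by apply: (measurableT_comp (measurable_powR _)); exact: measurable_funB.
- move=> y; rewrite mulr_ge0 ?powR_ge0// mulr_ge0 ?powR_ge0// mulr_ge0 ?Gamma_ge0//.
  by rewrite invr_ge0 mulr_ge0 ?Gamma_ge0.
Qed.

Lemma beta_mixture (x b : R) : 0 < x -> 0 < b ->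
  (\int[distribution P Y]_y (((1 - y) * x + y * b) `^ (- (c + q)))%:E =
   (x `^ (- q) * b `^ (- c))%:E)%E.
Proof.
move=> x0 b0; rewrite integral_beta_law; last 2 first.
- apply/measurable_EFinP; apply: (measurableT_comp (measurable_powR _)).
  apply: measurable_funD; apply: measurable_funM => //.
  exact: measurable_funB.
- by move=> y; rewrite lee_fin powR_ge0.
have K0 : 0 <= K.
  by rewrite mulr_ge0 ?Gamma_ge0// invr_ge0 mulr_ge0 ?Gamma_ge0.
have := beta_transform c q x0 b0 K0; rewrite integral_beta_density => H.
transitivity (\int[@lebesgue_measure R]_(y in `]0%R, 1%R[)
    (K * y `^ (c - 1) * (1 - y) `^ (q - 1) *
      (x * (1 - y) + b * y) `^ (- (c + q)))%:E)%E.
  by apply: eq_integral => y _; rewrite -EFinM (mulrC x) (mulrC b).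
rewrite !powRN.
have w0 : x `^ q * b `^ c != 0 by rewrite gt_eqF// mulr_gt0 ?powR_gt0.
rewrite -invfM -[RHS]mule1 H muleA -EFinM mulVf// mul1e//.
Qed.

Let mixf (f : d.+1.-tuple R) (b : d.+1.-tuple R) (y : R) (x : d.+1.-tuple R) :=
  ((1 - y) * dot f x + y * dot f b) `^ (- (c + q)).

Lemma dot_mix (f : d.+1.-tuple R) w :
  dot f (mix Y X B w) = (1 - Y w) * dot f (X w) + Y w * dot f (B w).
Proof.
rewrite /dot !mulr_sumr -big_split; apply: eq_bigr => i _.
by rewrite tnth_mktuple /=; ring.
Qed.

(** Integrating over [Y] first separates the variables into <f, X>^-q <f, B>^-c. The first factor
    has mean 1/(f_0...f_d) because q = d + 1 is the number of vertices. *)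
Lemma mix_transform (f : d.+1.-tuple R) : (forall i, 0 < tnth f i) ->
  (\int[P]_w (dot f (mix Y X B w) `^ (- (c + q)))%:E =
   ((\prod_i tnth f i)^-1)%:E *
     \int[distribution P B]_(b in S) (dot f b `^ (- c))%:E)%E.
Proof.
move=> f0.
have T0 : [set: 'I_d.+1]%SET != finset.set0 by rewrite -card_gt0 cardsT card_ord.
have mYX : measurable_fun setT (fun w => (Y w, X w)).
  by apply: measurable_fun_pair; exact: measurable_funPT.
pose YXf : {mfun Om >-> (R * d.+1.-tuple R)%type} := mfun_Sub (mem_set mYX).
pose F (z : d.+1.-tuple R * (R * d.+1.-tuple R)) : \bar R := (mixf f z.1 z.2.1 z.2.2)%:E.
have mF : measurable_fun setT F.
  apply/measurable_EFinP; apply: (measurableT_comp (measurable_powR _)).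
  have md : measurable_fun setT (dot f) := measurable_dot f.
  have m21 : measurable_fun setT
    (fun z : d.+1.-tuple R * (R * d.+1.-tuple R) => z.2.1).
    by apply: measurableT_comp => //; exact: measurable_fst.
  apply: measurable_funD; apply: measurable_funM => //.
  - exact: measurable_funB.
  - apply: measurableT_comp => //; apply: measurableT_comp => //.
  - exact: measurableT_comp.
have F0 z : (0 <= F z)%E by rewrite lee_fin powR_ge0.
have BYX' : independent P B YXf by [].
transitivity (\int[P]_w F (B w, YXf w))%E.
  by apply: eq_integral => w _; rewrite dot_mix.
rewrite (integral_independent BYX' mF F0).
(* [integral_independent] integrates over its second variable first, and this has to be [Y]. *)
have XY : independent P X Y.
  by move=> A1 A2 mA1 mA2; rewrite setIC YX// muleC.
have inner b : S b -> (\int[distribution P YXf]_v F (b, v) =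
    ((\prod_i tnth f i)^-1 * dot f b `^ (- c))%:E)%E.
  move=> bS; have b0 := dot_gt0 f0 bS.
  have mFb : measurable_fun setT (fun v => F (b, v)) by exact: measurableT_comp.
  rewrite -(integral_has_law (has_law_distribution P YXf) mFb (fun v => F0 _)).
  pose F' (z : d.+1.-tuple R * R) : \bar R := (mixf f b z.2 z.1)%:E.
  have mF' : measurable_fun setT F'.
    have msw : measurable_fun setT (fun z : d.+1.-tuple R * R => (z.2, z.1)).
      exact: measurable_fun_pair.
    exact: (measurableT_comp mFb msw).
  have F'0 z : (0 <= F' z)%E by rewrite lee_fin powR_ge0.
  rewrite (integral_independent XY mF' F'0).
  rewrite (ge0_integral_full_set mS distribution_simplexC); last 2 first.
  - exact: measurable_fun_fubini_tonelli_F.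
  - by move=> x; exact: integral_ge0.
  rewrite (eq_integral (fun x => (dot f b `^ (- c))%:E * (dot f x `^ (- q))%:E)%E); last first.
    move=> x /[!inE] xS; rewrite /F' /mixf /= beta_mixture ?dot_gt0//.
    by rewrite EFinM muleC.
  have mD : measurable_fun S (fun x => (dot f x `^ (- q))%:E).
    by apply: measurable_funTS; apply/measurable_EFinP; exact: measurable_dot_powR.
  have D0 x : S x -> (0 <= (dot f x `^ (- q))%:E)%E.
    by move=> _; rewrite lee_fin powR_ge0.
  have b0' : (0 <= (dot f b `^ (- c))%:E)%E by rewrite lee_fin powR_ge0.
  rewrite (ge0_integralZl _ mS mD D0 b0').
  have -> : (\int[distribution P X]_(x in S) (dot f x `^ (- q))%:E =
      \int[lambda R [set: 'I_d.+1]%SET]_(x in S) (dot f x `^ (- q))%:E)%E.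
    apply: eq_measure_integral => A mA _; apply: etrans (Xlaw mA) _; exact: LambdaE.
  have := lambda_power_prod T0 f0; rewrite cardsT card_ord => E.
  rewrite integral_lambda_power// E -EFinM mulrC; congr (_^-1 * _)%:E.
  by apply: eq_bigl => i; rewrite inE.
have BSC : distribution P B (~` S) = 0%E.
  rewrite /distribution /pushforward (_ : _ @^-1` _ = set0) ?measure0//.
  by apply/seteqP; split=> // w /=; apply; exact: BS.
have mG : measurable_fun setT
    (fun b => \int[distribution P YXf]_v F (b, v))%E.
  exact: (measurable_fun_fubini_tonelli_F (m2 := distribution P YXf) F mF F0).
have G0 z : (0 <= \int[distribution P YXf]_v F (z, v))%E by exact: integral_ge0.
apply: etrans (ge0_integral_full_set mS BSC mG G0) _.
have mD : measurable_fun S (fun x => (dot f x `^ (- c))%:E).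
  by apply: measurable_funTS; apply/measurable_EFinP; exact: measurable_dot_powR.
have D0 x : S x -> (0 <= (dot f x `^ (- c))%:E)%E.
  by move=> _; rewrite lee_fin powR_ge0.
have P0 : (0 <= ((\prod_i tnth f i)^-1)%:E :> \bar R)%E.
  by rewrite lee_fin invr_ge0 prodr_ge0// => i _; exact: ltW.
rewrite -(ge0_integralZl _ mS mD D0 P0).
by apply: eq_integral => b /[!inE] bS; rewrite inner.
Qed.

End mixture.

Section solution_law.
Variables (R : realType) (d : nat) (c : R).
Hypothesis c0 : 0 < c.
Context disp (Om : measurableType disp).
Variable P : probability Om R.
Variables (Y : {mfun Om >-> R}) (X B : {mfun Om >-> d.+1.-tuple R}).
Hypotheses (Ylaw : has_law P Y (beta_law c d.+1%:R))
  (Xlaw : has_law P X (Lambda R d d)) (YX : independent P Y X)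
  (BS : forall w, simplex R d (B w))
  (BYX : independent P B (fun w => (Y w, X w))).
Local Notation S := (simplex R d).
Local Notation q := (d.+1%:R : R).

Let mS : measurable S := @measurable_simplex R d.

Lemma measurable_mix : measurable_fun setT (mix Y X B).
Proof.
apply/measurable_fun_tnthP => i.
rewrite (_ : _ \o _ = fun w => (1 - Y w) * tnth (X w) i + Y w * tnth (B w) i).
  have mt (Z : {mfun Om >-> d.+1.-tuple R}) :
    measurable_fun setT (fun w => tnth (Z w) i).
    apply: (measurableT_comp (@measurable_tnth _ _ d.+1 i)).
    exact: measurable_funPT.
  by apply: measurable_funD; apply: measurable_funM => //; exact: measurable_funB.
by apply/funext => w /=; rewrite tnth_mktuple.
Qed.

Lemma integral_Lambda_power (f : d.+1.-tuple R) p : (forall i, 0 < tnth f i) ->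
  (\int[Lambda R d d]_(x in S) (dot f x `^ p)%:E =
   (lambda_power [set: 'I_d.+1]%SET p f)%:E)%E.
Proof. by move=> f0; rewrite integral_Lambda integral_lambda_power. Qed.

Lemma integral_X_power (f : d.+1.-tuple R) p : (forall i, 0 < tnth f i) ->
  (\int[P]_w (dot f (X w) `^ p)%:E =
   (lambda_power [set: 'I_d.+1]%SET p f)%:E)%E.
Proof.
move=> f0; have mF : measurable_fun setT (fun x => (dot f x `^ p)%:E).
  by apply/measurable_EFinP; exact: measurable_dot_powR.
have F0 (x : d.+1.-tuple R) : (0 <= (dot f x `^ p)%:E)%E by rewrite lee_fin powR_ge0.
rewrite (integral_has_law (has_law_distribution P X) mF F0).
rewrite (ge0_integral_full_set mS (distribution_simplexC Xlaw) mF F0).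
rewrite -integral_Lambda_power//.
by apply: eq_measure_integral => A mA _; exact: (Xlaw mA).
Qed.

Lemma distribution_BC : distribution P B (~` S) = 0%E.
Proof.
rewrite /distribution /pushforward (_ : _ @^-1` _ = set0) ?measure0//.
by apply/seteqP; split=> // w /=; apply; exact: BS.
Qed.

Lemma solution_transform : has_law P X (pushforward P (mix Y X B)) ->
  forall f : d.+1.-tuple R, (forall i, 0 < tnth f i) ->
  (\int[distribution P B]_(b in S) (dot f b `^ (- c))%:E =
   (\prod_i tnth f i *
     lambda_power [set: 'I_d.+1]%SET (- (c + d%:R + 1)) f)%:E)%E.
Proof.
move=> XM f f0.
have mF : measurable_fun setT (fun x => (dot f x `^ (- (c + q)))%:E).
  by apply/measurable_EFinP; exact: measurable_dot_powR.
have F0 (x : d.+1.-tuple R) : (0 <= (dot f x `^ (- (c + q)))%:E)%E.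
  by rewrite lee_fin powR_ge0.
pose M : {mfun Om >-> d.+1.-tuple R} := mfun_Sub (mem_set measurable_mix).
have E1 : (\int[P]_w (dot f (X w) `^ (- (c + q)))%:E =
           \int[P]_w (dot f (mix Y X B w) `^ (- (c + q)))%:E)%E.
  rewrite (integral_has_law (has_law_distribution P X) mF F0).
  have -> : (\int[P]_w (dot f (mix Y X B w) `^ (- (c + q)))%:E =
    \int[distribution P M]_x (dot f x `^ (- (c + q)))%:E)%E.
    exact: (integral_has_law (has_law_distribution P M) mF F0).
  by apply: eq_measure_integral => A mA _; exact: (XM A mA).
have := mix_transform Ylaw Xlaw YX BS BYX f0.
rewrite -E1 integral_X_power// => E.
have p0 : 0 < \prod_i tnth f i by apply: prodr_gt0 => i _.
have -> : c + d%:R + 1 = c + q by rewrite -natr1 addrA.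
rewrite EFinM E muleA -EFinM divff ?mul1e// gt_eqF//.
Qed.

(** That [nu] is nonnegative is not yet known, so uniqueness is applied to the measures m1 and law
    of [B] plus m2; subtracting the finite m2 gives the claim. *)
Lemma solution_law : has_law P X (pushforward P (mix Y X B)) ->
  has_law P B (nu d c).
Proof.
move=> XM A mA.
have [m1 [m2 [m1oo m2oo m1S m2S [nuE' I12]]]] := nu_decomposition d c.
have PB : (distribution P B setT < +oo)%E by rewrite probability_setT ltry.
pose mB2 : {measure set (d.+1.-tuple R) -> \bar R} := measure_add (distribution P B) m2.
have mB2E C : mB2 C = (distribution P B C + m2 C)%E by exact: measure_addE.
have key : m1 A = mB2 A.
  apply: (@simplex_determinacy R d m1 mB2 m1oo _ m1S _ c) => //.
  - by rewrite mB2E lte_add_pinfty.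
  - by rewrite mB2E m2S adde0; exact: distribution_BC.
  move=> f f0; rewrite /same_integral /Rintegral; congr fine.
  have mF : measurable_fun S (fun x => (dot f x `^ (- c))%:E).
    by apply: measurable_funTS; apply/measurable_EFinP; exact: measurable_dot_powR.
  have F0 x : S x -> (0 <= (dot f x `^ (- c))%:E)%E.
    by move=> _; rewrite lee_fin powR_ge0.
  have -> : (\int[mB2]_(x in S) (dot f x `^ (- c))%:E =
      \int[distribution P B]_(x in S) (dot f x `^ (- c))%:E +
      \int[m2]_(x in S) (dot f x `^ (- c))%:E)%E.
    exact: ge0_integral_measure_add.
  rewrite solution_transform// -sum_nu_weight// -I12// subeK//.
  apply: integrable_fin_num => //; apply: integrable_dot => //.
  exact: measure_lty.
have f2 : m2 A \is a fin_num.
  by rewrite ge0_fin_numE//; exact: measure_lty.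
rewrite nuE'// key mB2E addeK//.
Qed.

End solution_law.

(** * Masses of open faces and the sign of nu *)

Section nu_sign.
Variables (R : realType) (d : nat).
Implicit Types (T : {set 'I_d.+1}).
Local Notation X := (d.+1.-tuple R).

(** The points of R^(d+1) with support exactly [T], which on the simplex is the relative interior of
    the face. These sets are disjoint for different [T], so each isolates one term of [nu]. *)
Definition face_interior T : set X :=
  [set x | forall i, (tnth x i != 0) = (i \in T)].

Lemma measurable_coord_eq0 i : measurable [set x : X | tnth x i = 0].
Proof.
rewrite (_ : [set x | _] = (@tnth d.+1 R ^~ i) @^-1` [set 0])//.
by rewrite -[X in measurable X]setTI; exact: measurable_tnth.
Qed.

Lemma measurable_coord_neq0 i : measurable [set x : X | tnth x i != 0].
Proof.
rewrite (_ : [set x | _] = ~` [set x : X | tnth x i = 0]).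
  by apply: measurableC; exact: measurable_coord_eq0.
by apply/seteqP; split=> x /= /eqP.
Qed.

Let wrong T i : set X :=
  if i \in T then [set x | tnth x i = 0] else [set x | tnth x i != 0].

Let measurable_wrong T i : measurable (wrong T i).
Proof.
by rewrite /wrong; case: ifP => _;
  [exact: measurable_coord_eq0|exact: measurable_coord_neq0].
Qed.

Let face_interiorC T : ~` face_interior T = \big[setU/set0]_i wrong T i.
Proof.
rewrite -bigcup_seq; apply/seteqP; split=> x /=.
  move=> /existsNP[i xi]; exists i; first exact: mem_index_enum.
  move: xi; rewrite /wrong; case: ifP => _ /=; last by case: eqP.
  by case: eqP.
move=> [i _]; rewrite /wrong => + /(_ i); case: ifP => _ /=.
  by move=> ->; rewrite eqxx.
by move=> ->.
Qed.

Lemma measurable_face_interior T : measurable (face_interior T).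
Proof.
rewrite -[face_interior T]setCK face_interiorC; apply: measurableC.
exact: bigsetU_measurable.
Qed.

Lemma lambda_face_interior T : T != finset.set0 ->
  lambda R T (face_interior T) = 1%E.
Proof.
move=> T0; rewrite -[face_interior T]setCK probability_setC; last first.
  by apply: measurableC; exact: measurable_face_interior.
rewrite (_ : lambda R T (~` face_interior T) = 0%E) ?sube0// face_interiorC.
have w0 i : lambda R T (wrong T i) = 0%E.
  rewrite /wrong; case: ifPn => iT; first exact: lambda_coord_in.
  exact: lambda_coord_notin.
elim: (index_enum _) => [|i r ih]; first by rewrite big_nil measure0.
have mr : measurable (\big[setU/set0]_(j <- r) wrong T j).
  exact: bigsetU_measurable.
rewrite big_cons; exact: (null_set_setU (measurable_wrong T i) mr (w0 i) ih).
Qed.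

(** At a vertex [i] in exactly one of the two sets, every point with support [T] has the coordinate
    status that is null for the law on [T']. *)
Lemma lambda_face_interior_neq T T' : T' != finset.set0 -> T' != T ->
  lambda R T' (face_interior T) = 0%E.
Proof.
move=> T'0 T'T.
have [i iT] : exists i, (i \in T') != (i \in T).
  apply: contrapT => /forallNP h; case/eqP: T'T; apply/setP => i.
  by apply/eqP/negPn/negP; exact: h i.
apply: (@subset_measure0 _ _ _ _ _ (wrong T' i)) => //.
- exact: measurable_face_interior.
- move=> x xT; move: (xT i) iT; rewrite /wrong; case: ifP => _ /= <-.
    by case: (tnth x i =P 0).
  by case: (tnth x i =P 0).
- rewrite /wrong; case: ifPn => iT'; first exact: lambda_coord_in.
  exact: lambda_coord_notin.
Qed.

Lemma nu_face_interior c T : T != finset.set0 ->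
  nu d c (face_interior T) = (nu_weight c T)%:E.
Proof.
move=> T0; rewrite nuE; last exact: measurable_face_interior.
rewrite (bigD1 T)// lambda_face_interior// mule1.
rewrite big1 => [|T' /andP[T'0 T'T]]; first exact: adde0.
by rewrite lambda_face_interior_neq// mule0.
Qed.

Lemma nu_weight_ge0 (c : R) T : 0 < c -> (exists n : nat, c = n%:R) \/ d%:R < c ->
  T != finset.set0 -> 0 <= nu_weight c T.
Proof.
move=> c0 cP T0.
have Td : (#|T| <= d.+1)%N by rewrite (leq_trans (max_card _))// card_ord.
rewrite mulr_ge0//.
  rewrite divr_ge0// prodr_ge0// => j _; rewrite addr_ge0// ltW//.
rewrite divr_ge0//; case: cP => [[n cn]|dc]; last first.
  rewrite big_nat_cond prodr_ge0// => j /andP[/andP[_ jT] _].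
  rewrite subr_ge0 ltW// (le_lt_trans _ dc)// ler_nat -ltnS.
  exact: leq_trans jT Td.
have n0 : (0 < n)%N by rewrite -(ltr_nat R) -cn.
(* A face with more than [n] vertices has the zero factor of index [n]; on a smaller one all indices
   are below [n]. *)
have [nT|Tn] := ltnP n #|T|.
  rewrite (big_cat_nat _ (n := n)) //=; last exact: ltnW.
  by rewrite (big_ltn nT) cn subrr mul0r mulr0.
rewrite big_nat_cond prodr_ge0// => j /andP[/andP[_ jT] _].
by rewrite cn subr_ge0 ler_nat ltnW// (leq_trans jT).
Qed.

Lemma nu_ge0_integer_or_large (c : R) : 0 < c ->
  (forall A : set X, measurable A -> (0 <= nu d c A)%E) ->
  (exists n : nat, c = n%:R) \/ d%:R < c.
Proof.
move=> c0 nu0; have [|cd] := ltP d%:R c; first by right.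
left; apply: contrapT => cn.
pose m := Num.truncn c.
have /andP[mc cm] : m%:R <= c < m.+1%:R by apply: truncn_itv; exact: ltW.
have mc' : m%:R < c.
  by rewrite lt_neqAle mc andbT; apply/eqP => E; apply: cn; exists m.
(* From m < c <= d: the simplex has enough vertices for the face chosen below. *)
have md : (m.+2 <= d.+1)%N by rewrite ltnS -(ltr_nat R) (lt_le_trans mc').
(* On a face with floor(c) + 2 vertices the factor c - (floor(c) + 1) is the only
   negative one. *)
pose T := [set widen_ord md i | i : 'I_m.+2]%SET.
have cT : #|T| = m.+2.
  by rewrite card_imset ?card_ord// => i j /(congr1 val) /= /val_inj.
have T0 : T != finset.set0 by rewrite -card_gt0 cT.
have := nu0 _ (measurable_face_interior T).
rewrite nu_face_interior// lee_fin leNgt => /negP; apply.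
have neg : \prod_(1 <= j < m.+2) (c - j%:R) < 0.
  rewrite big_nat_recr//= pmulr_rlt0 ?subr_lt0// big_nat_cond.
  apply: prodr_gt0 => j /andP[/andP[_ jm] _].
  by rewrite subr_gt0 (le_lt_trans _ mc')// ler_nat -ltnS.
have pos : 0 < d`!%:R / \prod_(1 <= j < d.+1) (c + j%:R).
  rewrite divr_gt0 ?ltr0n ?fact_gt0//; apply: prodr_gt0 => j _.
  by rewrite ltr_wpDr.
by rewrite /nu_weight /face_weight cT pmulr_rlt0// pmulr_llt0// invr_gt0 ltr0n fact_gt0.
Qed.

End nu_sign.

Section nu_probability.
Variables (R : realType) (d : nat) (c : R).
Hypotheses (c0 : 0 < c) (cP : (exists n : nat, c = n%:R) \/ d%:R < c).
Local Notation X := (d.+1.-tuple R).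

Lemma lambda_power1 (T : {set 'I_d.+1}) (p : R) : T != finset.set0 ->
  lambda_power T p ([tuple 1 | _ < d.+1] : X) = 1.
Proof.
move=> T0; rewrite /lambda_power (@eq_Rintegral _ _ _ _ _ (cst 1)); last first.
  by move=> x /[!inE] -[_ x1]; rewrite dot1 x1 powR1.
have mS := @measurable_simplex R d.
have S1 : lambda R T (simplex R d) = 1%E.
  rewrite -[simplex R d]setCK probability_setC; last exact: measurableC.
  by rewrite lambda_simplexC// sube0.
rewrite Rintegral_cst// mul1r; exact: etrans (congr1 (@fine R) S1) _.
Qed.

Lemma nu_probability : exists Q : probability X R,
  [/\ forall A, measurable A -> Q A = nu d c A,
      Q (~` simplex R d) = 0%E &
      forall f : X, (forall i, 0 < tnth f i) ->
        (\int[Q]_(x in simplex R d) (dot f x `^ (- c))%:E =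
         (\prod_i tnth f i *
           lambda_power [set: 'I_d.+1]%SET (- (c + d%:R + 1)) f)%:E)%E].
Proof.
pose s := [seq T <- index_enum {set 'I_d.+1} | T != finset.set0].
have w0 (T : {set 'I_d.+1}) : 0 <= Num.max (nu_weight c T) 0.
  by rewrite le_max lexx orbT.
have [m [mE mI]] := weighted_measure s (fun T => lambda R T) w0.
have mnu A : measurable A -> m A = nu d c A.
  move=> mA; rewrite mE nuE// big_filter; apply: eq_bigr => T T0.
  by rewrite max_l// nu_weight_ge0.
(* The total mass is read off the first identity at f = (1, ..., 1), where every integrand is 1. *)
have mT : m setT = 1%E.
  rewrite mnu// nuE//.
  have f0 i : 0 < tnth ([tuple 1 | _ < d.+1] : X) i by rewrite tnth_mktuple.
  rewrite (eq_bigr (fun T : {set 'I_d.+1} => (nu_weight c T *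
    lambda_power T (- c) [tuple 1 | _ < d.+1])%:E)); last first.
    move=> T T0; rewrite lambda_power1// mulr1.
    by rewrite (_ : lambda R T setT = 1%E) ?mule1//; exact: probability_setT.
  rewrite sumEFin sum_nu_weight// lambda_power1; last first.
    by rewrite -card_gt0 cardsT card_ord.
  by rewrite mulr1 big1// => i _; rewrite tnth_mktuple.
(* Normalising a measure of mass 1 changes nothing; it supplies the structure of a probability, with
   [D] as a default value that is never reached. *)
pose D : probability X R := \d_ ([tuple 0 | _ < d.+1] : X).
have QE A : mnormalize m D A = m A.
  by rewrite /mnormalize mT onee_eq0 /= invr1 mule1.
exists (mnormalize m D : probability X R); split=> [A mA||f f0].
- by apply: etrans (QE A) _; exact: mnu.
- have mSC : measurable (~` simplex R d).
    by apply: measurableC; exact: measurable_simplex.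
  apply: etrans (QE _) _; rewrite mnu// nuE// big1// => T T0.
  by rewrite lambda_simplexC// mule0.
- have -> : (\int[mnormalize m D]_(x in simplex R d) (dot f x `^ (- c))%:E =
      \int[m]_(x in simplex R d) (dot f x `^ (- c))%:E)%E.
    by apply: eq_measure_integral => A _ _; exact: QE.
  rewrite mI; last 3 first.
  + exact: measurable_simplex.
  + by apply: measurable_funTS; apply/measurable_EFinP; exact: measurable_dot_powR.
  + by move=> x _; rewrite lee_fin powR_ge0.
  rewrite -sum_nu_weight// -sumEFin big_filter; apply: eq_bigr => T T0.
  by rewrite max_l ?nu_weight_ge0// integral_lambda_power// -EFinM.
Qed.

End nu_probability.

(** * Construction of a solution *)

Section retraction.
Variables (R : realType) (d : nat).
Local Notation X := (d.+1.-tuple R).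
Local Notation S := (simplex R d).

(* A solution must take its values in the simplex everywhere, not only almost
   surely: points outside are sent to e_0. *)
Definition simplex_retraction (x : X) : X :=
  [tuple tnth x i * \1_S x + (i == ord0)%:R * (1 - \1_S x) | i < d.+1].

Lemma simplex_retractionE x : S x -> simplex_retraction x = x.
Proof.
move=> xS; apply: eq_from_tnth => i; rewrite tnth_mktuple indicE mem_set//=.
by rewrite subrr mulr0 addr0 mulr1.
Qed.

Lemma simplex_retractionP x : S (simplex_retraction x).
Proof.
have [xS|xS] := pselect (S x); first by rewrite simplex_retractionE.
have E i : tnth (simplex_retraction x) i = (i == ord0)%:R.
  by rewrite tnth_mktuple indicE memNset// mulr0 subr0 mulr1 add0r.
split=> [i|]; first by rewrite E.
under eq_bigr do rewrite E.
rewrite (bigD1 ord0)//= big1 ?addr0// => i /negbTE ->//.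
Qed.

Lemma measurable_simplex_retraction : measurable_fun setT simplex_retraction.
Proof.
apply/measurable_fun_tnthP => i.
rewrite (_ : _ \o _ = fun x => tnth x i * \1_S x + (i == ord0)%:R * (1 - \1_S x)).
  have m1 : measurable_fun setT (\1_S : X -> R).
    by apply: measurable_indic; exact: measurable_simplex.
  apply: measurable_funD; apply: measurable_funM => //.
    exact: measurable_tnth.
  exact: measurable_funB.
by apply/funext => x /=; rewrite tnth_mktuple.
Qed.

End retraction.

Section perpetuity_equation.
Variables (R : realType) (d : nat) (c : R).
Hypothesis c0 : 0 < c.
Context disp (Om : measurableType disp).
Variable P : probability Om R.
Variables (Y : {mfun Om >-> R}) (X B : {mfun Om >-> d.+1.-tuple R}).
Hypotheses (Ylaw : has_law P Y (beta_law c d.+1%:R))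
  (Xlaw : has_law P X (Lambda R d d)) (YX : independent P Y X)
  (BS : forall w, simplex R d (B w))
  (BYX : independent P B (fun w => (Y w, X w))).
Local Notation S := (simplex R d).

Let mS : measurable S := @measurable_simplex R d.

Lemma beta_law_itvC : P (Y @^-1` (~` `[0, 1])) = 0%E.
Proof.
have mI : measurable (~` `[0, 1] : set R).
  by apply: measurableC; exact: measurable_itv.
apply: etrans (Ylaw mI) _.
rewrite /beta_law (_ : _ `&` _ = set0) ?integral_set0//.
apply/seteqP; split=> // y [/= y01]; rewrite in_itv/= => /andP[y0 y1].
by apply: y01; rewrite in_itv/= !ltW.
Qed.

Lemma mix_simplex w : 0 <= Y w <= 1 -> S (X w) -> S (mix Y X B w).
Proof.
move=> /andP[Y0 Y1] [X0 X1]; have [B0 B1] := BS w; split=> [i|].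
  by rewrite tnth_mktuple addr_ge0// mulr_ge0// subr_ge0.
under eq_bigr do rewrite tnth_mktuple.
by rewrite big_split -!mulr_sumr /= X1 B1; ring.
Qed.

(** The transform of the law of [B] has exponent c, but the laws of [X] and of the mixture are
    compared through the exponent c + d + 1, at which the variables separate. *)
Lemma perpetuity_equation :
  (forall f : d.+1.-tuple R, (forall i, 0 < tnth f i) ->
    (\int[distribution P B]_(b in S) (dot f b `^ (- c))%:E =
     (\prod_i tnth f i *
       lambda_power [set: 'I_d.+1]%SET (- (c + d%:R + 1)) f)%:E)%E) ->
  has_law P X (pushforward P (mix Y X B)).
Proof.
move=> Btransform A mA.
have mM : measurable_fun setT (mix Y X B) by exact: measurable_mix.
pose M : {mfun Om >-> d.+1.-tuple R} := mfun_Sub (mem_set mM).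
have XSC : distribution P X (~` S) = 0%E by exact: distribution_simplexC Xlaw.
have mSC : measurable (~` S) by exact: measurableC.
(* [X] and [Y] are controlled in law only: the mixture lies in the simplex off the null events where
   [X] leaves the simplex or [Y] leaves [0, 1]. *)
have MSC : distribution P M (~` S) = 0%E.
  have mX1 : measurable (X @^-1` (~` S)).
    by rewrite -[X in measurable X]setTI; exact: measurable_funPT.
  have mY1 : measurable (Y @^-1` (~` `[0, 1])).
    rewrite -[X in measurable X]setTI; apply: measurable_funPT => //.
    by apply: measurableC; exact: measurable_itv.
  apply: (@subset_measure0 _ _ _ P _ (X @^-1` (~` S) `|` Y @^-1` (~` `[0, 1]))).
  - by rewrite -[X in measurable X]setTI; exact: measurable_mix.
  - exact: measurableU.
  - move=> w /= wS; apply: contrapT => /not_orP[/contrapT XS /contrapT].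
    by rewrite /= in_itv => Y01; apply: wS; exact: mix_simplex.
  - exact: (null_set_setU mX1 mY1 XSC beta_law_itvC).
have Xoo : (distribution P X setT < +oo)%E by rewrite probability_setT ltry.
have Moo : (distribution P M setT < +oo)%E by rewrite probability_setT ltry.
have s0 : 0 < c + d.+1%:R by rewrite addr_gt0.
apply: (@simplex_determinacy R d (distribution P X) (distribution P M)
  Xoo Moo XSC MSC _ s0 _ _ mA).
move=> f f0; rewrite /same_integral /Rintegral; congr fine.
have mF : measurable_fun setT (fun x => (dot f x `^ (- (c + d.+1%:R)))%:E).
  by apply/measurable_EFinP; exact: measurable_dot_powR.
have F0 (x : d.+1.-tuple R) : (0 <= (dot f x `^ (- (c + d.+1%:R)))%:E)%E.
  by rewrite lee_fin powR_ge0.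
rewrite -(ge0_integral_full_set mS XSC mF F0) -(ge0_integral_full_set mS MSC mF F0).
rewrite -(integral_has_law (has_law_distribution P X) mF F0).
rewrite -(integral_has_law (has_law_distribution P M) mF F0).
rewrite (integral_X_power Xlaw)//.
rewrite [RHS](mix_transform Ylaw Xlaw YX BS BYX f0).
have p0 : 0 < \prod_i tnth f i by apply: prodr_gt0 => i _.
rewrite Btransform// -natr1 addrA -EFinM mulrA mulVf ?mul1r// gt_eqF//.
Qed.

End perpetuity_equation.

Section transport.
Context disp (Om : measurableType disp) disp' (Om' : measurableType disp')
  (R : realType).
Variables (P : probability Om R) (P' : probability Om' R) (pi : {mfun Om' >-> Om}).
Hypothesis piP : has_law P' pi P.

Lemma has_law_comp d (T : measurableType d) (X : {mfun Om >-> T}) mu :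
  has_law P X mu -> has_law P' (X \o pi) mu.
Proof.
move=> Xmu A mA; rewrite -Xmu//; apply: piP.
by rewrite -[X in measurable X]setTI; exact: measurable_funPT.
Qed.

Lemma independent_comp d1 d2 (T1 : measurableType d1) (T2 : measurableType d2)
    (X : {mfun Om >-> T1}) (Y : {mfun Om >-> T2}) :
  independent P X Y -> independent P' (X \o pi) (Y \o pi).
Proof.
move=> XY A B mA mB.
have mX : measurable (X @^-1` A).
  by rewrite -[X in measurable X]setTI; exact: measurable_funPT.
have mY : measurable (Y @^-1` B).
  by rewrite -[X in measurable X]setTI; exact: measurable_funPT.
have EX : P' (pi @^-1` (X @^-1` A)) = P (X @^-1` A) by exact: piP.
have EY : P' (pi @^-1` (Y @^-1` B)) = P (Y @^-1` B) by exact: piP.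
have EXY : P' (pi @^-1` (X @^-1` A `&` Y @^-1` B)) = P (X @^-1` A `&` Y @^-1` B).
  by apply: piP; exact: measurableI.
apply: etrans EXY _; apply: etrans (XY _ _ mA mB) _.
by rewrite -EX -EY.
Qed.

End transport.

Section construction.
Variables (R : realType) (d : nat) (c : R).
Hypotheses (c0 : 0 < c) (cP : (exists n : nat, c = n%:R) \/ d%:R < c).
Context disp (Om : measurableType disp).
Variable P : probability Om R.
Variables (Y : {mfun Om >-> R}) (X : {mfun Om >-> d.+1.-tuple R}).
Hypotheses (Ylaw : has_law P Y (beta_law c d.+1%:R))
  (Xlaw : has_law P X (Lambda R d d)) (YX : independent P Y X).
Local Notation S := (simplex R d).
Local Notation T := (d.+1.-tuple R).

(** The extension is the product of [Om] with a copy of the state space under nu, here a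
    probability; the second coordinate is then independent of everything on [Om]. *)
Lemma perpetuity_solution_exists :
  exists (disp' : measure_display) (Om' : measurableType disp')
         (P' : probability Om' R) (pi : {RV P' >-> Om})
         (B : {RV P' >-> T}),
    has_law P' pi P /\ perpetuity_solution P' (Y \o pi) (X \o pi) B.
Proof.
have [Q [Qnu QS Qtransform]] := nu_probability c0 cP.
have mS : measurable S by exact: measurable_simplex.
pose P' : probability (Om * T)%type R := (P \x Q)%E.
have P'X A1 A2 : measurable A1 -> measurable A2 ->
    P' (A1 `*` A2) = (P A1 * Q A2)%E.
  by move=> mA1 mA2; exact: product_measure1E.
have mfst : measurable_fun setT (@fst Om T) by exact: measurable_fst.
have mret : measurable_fun setT (@simplex_retraction R d \o @snd Om T).
  apply: measurableT_comp; first exact: measurable_simplex_retraction.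
  exact: measurable_snd.
pose pi : {mfun (Om * T)%type >-> Om} := mfun_Sub (mem_set mfst).
pose B : {mfun (Om * T)%type >-> T} := mfun_Sub (mem_set mret).
have piP : has_law P' pi P.
  move=> A mA; rewrite /pushforward (_ : _ @^-1` _ = A `*` setT).
    by rewrite P'X// probability_setT mule1.
  by apply/seteqP; split=> -[w x] //= [].
have mretA A : measurable A -> measurable (@simplex_retraction R d @^-1` A).
  move=> mA; rewrite -[X in measurable X]setTI.
  exact: measurable_simplex_retraction.
(* The retraction moves only points outside the simplex, a null set for [Q], so it does not alter
   the law. *)
have QB A : measurable A -> Q (@simplex_retraction R d @^-1` A) = Q A.
  move=> mA.
  rewrite (measure_full_set mS QS (mretA _ mA)) (measure_full_set mS QS mA).
  congr (Q _); apply/seteqP; split=> x /= [xA xS]; split=> //.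
    by rewrite simplex_retractionE in xA.
  by rewrite simplex_retractionE.
have BQ A : measurable A -> P' (B @^-1` A) = Q A.
  move=> mA.
  rewrite (_ : _ @^-1` _ = setT `*` (@simplex_retraction R d @^-1` A)); last first.
    by apply/seteqP; split=> -[w x] //= [].
  by rewrite P'X; [rewrite probability_setT mul1e QB| |exact: mretA].
have BS w : S (B w) by exact: simplex_retractionP.
have BYX : independent P' B (fun w => ((Y \o pi) w, (X \o pi) w)).
  move=> A C mA mC.
  have mYX : measurable_fun setT (fun w => (Y w, X w)).
    by apply: measurable_fun_pair; exact: measurable_funPT.
  have mYXC : measurable ((fun w => (Y w, X w)) @^-1` C).
    by rewrite -[X in measurable X]setTI; exact: mYX.
  have E : P' ((fun w => ((Y \o pi) w, (X \o pi) w)) @^-1` C) =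
      P ((fun w => (Y w, X w)) @^-1` C) by exact: (piP _ mYXC).
  rewrite E BQ// (_ : _ `&` _ = ((fun w => (Y w, X w)) @^-1` C) `*`
      (@simplex_retraction R d @^-1` A)); last first.
    by apply/seteqP; split=> -[w x] /= [].
  by rewrite P'X; [rewrite QB// muleC| |exact: mretA].
exists _, (Om * T)%type, P', pi, B; split=> //; split=> //.
have Ylaw' : has_law P' (Y \o pi) (beta_law c d.+1%:R) by exact: has_law_comp Ylaw.
have Xlaw' : has_law P' (X \o pi) (Lambda R d d) by exact: has_law_comp Xlaw.
have YX' : independent P' (Y \o pi) (X \o pi) by exact: independent_comp YX.
apply: (perpetuity_equation c0 Ylaw' Xlaw' YX' BS BYX) => f f0.
rewrite -Qtransform//.
by apply: eq_measure_integral => A mA _; exact: BQ.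
Qed.

End construction.

Theorem theorem4p3 (R : realType) (d : nat) (hd : (1 <= d)%N) (c : R)
    (hc : 0 < c) :
  (forall f : d.+1.-tuple R, (forall i, 0 < tnth f i) ->
     charge_integral (nu d c) (simplex R d)
       (fun x => ((dot f x `^ c)^-1)%:E) =
     ((\prod_(i < d.+1) tnth f i)%:E *
      \int[Lambda R d d]_(x in simplex R d)
        ((dot f x `^ (c + d%:R + 1))^-1)%:E)%E)
  /\
  (forall (disp : measure_display) (Om : measurableType disp)
          (P : probability Om R)
          (Y : {RV P >-> R}) (X : {RV P >-> d.+1.-tuple R}),
     has_law P Y (beta_law c (d.+1)%:R) ->
     has_law P X (Lambda R d d) ->
     independent P Y X ->
     ((exists (disp' : measure_display) (Om' : measurableType disp')
              (P' : probability Om' R) (pi : {RV P' >-> Om})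
              (B : {RV P' >-> d.+1.-tuple R}),
         has_law P' pi P /\ perpetuity_solution P' (Y \o pi) (X \o pi) B)
      <-> ((exists n : nat, c = n%:R) \/ d%:R < c))
     /\
     (forall (disp' : measure_display) (Om' : measurableType disp')
             (P' : probability Om' R) (pi : {RV P' >-> Om})
             (B : {RV P' >-> d.+1.-tuple R}),
        has_law P' pi P ->
        perpetuity_solution P' (Y \o pi) (X \o pi) B ->
        has_law P' B (nu d c))).
Proof.
split=> [f f0|disp Om P Y X Ylaw Xlaw YX]; first exact: charge_integral_nu.
have solution (disp' : measure_display) (Om' : measurableType disp')
    (P' : probability Om' R) (pi : {RV P' >-> Om})
    (B : {RV P' >-> d.+1.-tuple R}) : has_law P' pi P ->
    perpetuity_solution P' (Y \o pi) (X \o pi) B -> has_law P' B (nu d c).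
  move=> piP [BS BYX eqX].
  have Ylaw' : has_law P' (Y \o pi) (beta_law c d.+1%:R).
    exact: has_law_comp Ylaw.
  have Xlaw' : has_law P' (X \o pi) (Lambda R d d) by exact: has_law_comp Xlaw.
  have YX' : independent P' (Y \o pi) (X \o pi) by exact: independent_comp YX.
  exact: (solution_law hc Ylaw' Xlaw' YX' BS BYX eqX).
split=> //; split=> [[disp' [Om' [P' [pi [B [piP sol]]]]]]|cP].
  apply: nu_ge0_integer_or_large => // A mA.
  by rewrite -(solution _ _ _ _ _ piP sol)//; exact: measure_ge0.
exact: (perpetuity_solution_exists hc cP Ylaw Xlaw YX).
Qed.
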